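(* Let $X \subseteq \mathbb{R}^d$ be a H\''older set and let $M=(M_k)_{k\in\mathbb{N}}$ be a non-quasianalytic log-convex positive sequence. Then \[ \mathcal{A}^\infty_M(X) = \mathcal{A}^\infty(X) = \mathcal{C}^\infty(X). \] In particular, $X$ is $\mathcal{A}^\infty$-admissible, i.e. $\mathcal{A}^\infty(X)=\mathcal{C}^\infty(X)$.
   Context: For $X\subseteq\mathbb{R}^d$: $\mathcal{C}^\infty(\mathbb{R},X)$ is the set of smooth $c:\mathbb{R}\to\mathbb{R}^d$ with $c(\mathbb{R})\subseteq X$. $\mathcal{A}^\infty(X)$ is the set of $f:X\to\mathbb{R}$ such that $f\circ c\in\mathcal{C}^\infty(\mathbb{R},\mathbb{R})$ for all $c\in\mathcal{C}^\infty(\mathbb{R},X)$. For a positive sequence $M$, the Denjoy--Carleman class $\mathcal{C}^M(\mathbb{R},\mathbb{R}^d)$ is the set of smooth $c$ such that for every compact $K\subseteq\mathbb{R}$ there are $C,\rho>0$ with $|c^{(k)}(t)|\le C\rho^k k!\,M_k$ for all $k\in\mathbb{N}$, $t\in K$; $\mathcal{C}^M(\mathbb{R},X)$ consists of those with image in $X$, and $\mathcal{A}^\infty_M(X)$ is the set of $f:X\to\mathbb{R}$ with $f\circ c\in\mathcal{C}^\infty(\mathbb{R},\mathbb{R})$ for all $c\in\mathcal{C}^M(\mathbb{R},X)$. $M$ is non-quasianalytic if $\sum_k M_k/((k+1)M_{k+1})<\infty$. A function $f:X\to\mathbb{R}$ belongs to $\mathcal{C}^\infty(X)$ if every $x\in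 X$ has an open neighborhood $U$ in $\mathbb{R}^d$ and a smooth $F:U\to\mathbb{R}$ with $F=f$ on $U\cap X$. H\''older sets: write $x=(x',x_d)\in\mathbb{R}^{d-1}\times\mathbb{R}$. For $0<\alpha\le1$, $r,h>0$, the truncated open cusp is $\Gamma^\alpha_d(r,h)=\{(x',x_d): |x'|<r,\ h(|x'|/r)^\alpha<x_d<h\}$. An open set $U\subseteq\mathbb{R}^d$ has the uniform cusp property of index $\alpha$ if for every $x\in\partial U$ there exist $\epsilon>0$, a truncated open cusp $\Gamma=\Gamma^\alpha_d(r,h)$ and an orthogonal $A\in O(d)$ such that $y+A\Gamma\subseteq U$ for all $y\in\overline U\cap B(x,\epsilon)$. A closed set $X$ is fat if $X=\overline{\mathrm{int}(X)}$ (and $X\neq\emptyset$). An $\alpha$-set is a fat closed set $X$ such that $\mathrm{int}(X)$ has the uniform cusp property of index $\alpha$; a H\''older set is an $\alpha$-set for some $\alpha\in(0,1]$. *)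

(* Defs.v *)
From HB Require Import structures.
From mathcomp Require Import all_boot all_order all_algebra.
From mathcomp Require Import all_classical all_reals all_analysis.
Set Implicit Arguments. Unset Strict Implicit. Unset Printing Implicit Defensive.
Import Order.TTheory GRing.Theory Num.Theory.
Import numFieldNormedType.Exports.
Local Open Scope classical_set_scope.
Local Open Scope ring_scope.

Section Defs.
Variable R : realType.

Definition smooth_curve (V : normedModType R) (c : R -> V) : Prop :=
  forall (k : nat) (t : R), derivable (derive1n k c) t 1.

Definition enorm (d : nat) (x : 'rV[R]_d) : R :=
  Num.sqrt (\sum_(i < d) x 0 i ^+ 2).

Definition Cinf_curves (d : nat) (X : set 'rV[R]_d) : set (R -> 'rV[R]_d) :=
  [set c | smooth_curve c /\ forall t, X (c t)].

Definition DC_curve (M : nat -> R) (d : nat) (c : R -> 'rV[R]_d) : Prop :=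
  smooth_curve c /\
  forall K : set R, compact K ->
    exists C : R, exists rho : R, 0 < C /\ 0 < rho /\
      forall (k : nat) (t : R), K t ->
        enorm (derive1n k c t) <= C * rho ^+ k * (k`!)%:R * M k.

Definition CM_curves (M : nat -> R) (d : nat) (X : set 'rV[R]_d)
  : set (R -> 'rV[R]_d) :=
  [set c | DC_curve M c /\ forall t, X (c t)].

(* A^infty(X): functions (given as total functions, only values on X matter) *)
Definition Ainf (d : nat) (X : set 'rV[R]_d) : set ('rV[R]_d -> R) :=
  [set f : 'rV[R]_d -> R | forall c, Cinf_curves X c -> smooth_curve (f \o c)].

Definition AinfM (M : nat -> R) (d : nat) (X : set 'rV[R]_d)
  : set ('rV[R]_d -> R) :=
  [set f : 'rV[R]_d -> R | forall c, CM_curves M X c -> smooth_curve (f \o c)].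

Fixpoint Ck_on (d : nat) (k : nat) (U : set 'rV[R]_d) (F : 'rV[R]_d -> R)
  : Prop :=
  match k with
  | 0 => forall x, U x -> {for x, continuous F}
  | k'.+1 => (forall x, U x -> differentiable F x) /\
             forall i : 'I_d,
               Ck_on k' U (fun x => 'D_(delta_mx 0 i) F x)
  end.

Definition smooth_on (d : nat) (U : set 'rV[R]_d) (F : 'rV[R]_d -> R) : Prop :=
  forall k, Ck_on k U F.

Definition Cinf_on (d : nat) (X : set 'rV[R]_d) : set ('rV[R]_d -> R) :=
  [set f : 'rV[R]_d -> R | forall x, X x -> exists U : set 'rV[R]_d,
      [/\ open U, U x &
       exists F : 'rV[R]_d -> R, smooth_on U F /\
         forall y, U y -> X y -> F y = f y]].

Definition non_quasianalytic (M : nat -> R) : Prop :=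
  cvgn (series (fun k : nat => M k / ((k.+1)%:R * M k.+1))).

Definition log_convex (M : nat -> R) : Prop :=
  forall k : nat, M k.+1 ^+ 2 <= M k * M k.+2.

Definition positive_seq (M : nat -> R) : Prop := forall k, 0 < M k.

(* Hoelder sets, in R^d with d = n.+1; x = (x', x_d), x_d the last coordinate *)
Definition xprime_norm (n : nat) (x : 'rV[R]_n.+1) : R :=
  Num.sqrt (\sum_(i < n) x 0 (widen_ord (leqnSn n) i) ^+ 2).

Definition xlast (n : nat) (x : 'rV[R]_n.+1) : R := x 0 ord_max.

Definition cusp (n : nat) (alpha r h : R) : set 'rV[R]_n.+1 :=
  [set x | xprime_norm x < r /\
           h * powR (xprime_norm x / r) alpha < xlast x /\ xlast x < h].

Definition orthogonal_mx (d : nat) (A : 'M[R]_d) : Prop :=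
  A *m A^T = 1%:M.

Definition uniform_cusp (n : nat) (alpha : R) (U : set 'rV[R]_n.+1) : Prop :=
  forall x, (closure U `\` U) x ->
    exists eps : R, exists r : R, exists h : R, exists A : 'M[R]_n.+1,
      [/\ 0 < eps, 0 < r, 0 < h, orthogonal_mx A &
       forall y, closure U y -> enorm (y - x) < eps ->
         forall z, cusp alpha r h z -> U (y + z *m A)].

Definition fat (d : nat) (X : set 'rV[R]_d) : Prop :=
  closed X /\ X = closure (interior X) /\ X !=set0.

Definition alpha_set (n : nat) (alpha : R) (X : set 'rV[R]_n.+1) : Prop :=
  0 < alpha /\ alpha <= 1 /\ fat X /\ uniform_cusp alpha (interior X).

Definition holder_set (n : nat) (X : set 'rV[R]_n.+1) : Prop :=
  exists alpha : R, alpha_set alpha X.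

End Defs.

(* Main.v *)
Require Import Defs.
From HB Require Import structures.
From mathcomp Require Import all_boot all_order all_algebra.
From mathcomp Require Import all_classical all_reals all_analysis.
From mathcomp Require Import ring lra.
Import Order.TTheory GRing.Theory Num.Theory.
Import numFieldNormedType.Exports.
Local Open Scope classical_set_scope.
Local Open Scope ring_scope.
Set Implicit Arguments. Unset Strict Implicit. Unset Printing Implicit Defensive.

(** Only [AinfM M X `<=` Cinf_on X] is at stake. Non-quasianalyticity provides
    plateau functions so small in the class of [M] that infinitely many rescaled
    copies fit into one curve; hence, if [f] is smooth along all curves of class
    [M] in [X], its derivatives at [s = 0] along the curves
    [y + s^2 e + s^(2p) v], which stay in the cusp at [y], are bounded uniformly
    in [y] near a given point. Taking differences in [v] bounds all pure
    directional derivatives of [f]; polarisation of finite differences then shows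
    that [f] is smooth in the interior, with all derivatives bounded up to the
    boundary. Near a boundary point, [f] is extended by [sum_k chi_k (P_(k+1) f -
    P_k f)], where [P_k f (y)] extrapolates [f (y)] from the values of [f] at
    [y + j eps_k e], [1 <= j <= N_k], and [chi_k] cuts off at the distance
    [~ eps_k^p] from [X] up to which these points lie in the interior: the
    increments are [O(eps_k^N)] for every [N], so the series converges together
    with all its derivatives. *)

(** * One-variable calculus with explicit derivative sequences *)

Section OneVariable.
Variable R : realType.
Implicit Types (f g : R -> R) (t l : R).

Lemma is_derive_epsP f t l :
  (forall e, 0 < e -> exists2 d, 0 < d &
     forall h, `|h| < d -> `|f (t + h) - f t - h * l| <= e * `|h|) ->
  is_derive t 1 f l.
Proof.
move=> H; have cv : (fun h => h^-1 *: ((f \o shift t) (h *: 1) - f t)) @ 0^' --> l.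
  apply/cvgrPdist_le => e e0; have [d d0 hd] := H e e0.
  near=> h; have hn0 : h != 0 by near: h; exact: nbhs_dnbhs_neq.
  have hlt : `|h| < d by near: h; exact: dnbhs0_lt.
  have := hd h hlt; rewrite /= /shift [h *: 1]mulr1 [h + t]addrC => hh.
  rewrite -normrN opprB.
  have -> : h^-1 *: (f (t + h) - f t) - l = h^-1 * (f (t + h) - f t - h * l).
    by rewrite [h * l]mulrC mulrBr mulrCA mulVf// mulr1.
  by rewrite normrM normfV ler_pdivrMl ?normr_gt0// [leRHS]mulrC.
by apply: DeriveDef; [apply/cvg_ex; exists l|exact: cvg_lim cv].
Unshelve. all: by end_near. Qed.

Lemma is_derive_eps f t l : is_derive t 1 f l ->
  forall e, 0 < e -> exists2 d, 0 < d &
     forall h, `|h| < d -> `|f (t + h) - f t - h * l| <= e * `|h|.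
Proof.
move=> [dv dl] e e0; have : (fun h => h^-1 *: ((f \o shift t) (h *: 1) - f t)) @ 0^' --> l.
  by rewrite -dl; exact: dv.
move/cvgrPdist_le => /(_ e e0).
move=> /nbhs_ballP[d /= d0 hd]; exists d => // h hlt.
have [->|hn0] := eqVneq h 0; first by rewrite addr0 subrr mul0r subr0 normr0 mulr0.
have := hd h; rewrite /ball/= sub0r normrN => /(_ hlt hn0).
rewrite /= /shift [h *: 1]mulr1 [h + t]addrC -normrN opprB.
have -> : h^-1 *: (f (t + h) - f t) - l = h^-1 * (f (t + h) - f t - h * l).
  by rewrite [h * l]mulrC mulrBr mulrCA mulVf// mulr1.
by rewrite normrM normfV ler_pdivrMl ?normr_gt0// [leRHS]mulrC.
Qed.

Lemma is_derive_quad f t l (C d : R) : 0 < d ->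
  (forall h, `|h| < d -> `|f (t + h) - f t - h * l| <= C * h ^+ 2) ->
  is_derive t 1 f l.
Proof.
move=> d0 H; apply: is_derive_epsP => e e0.
have C0 : 0 < `|C| + 1 by rewrite ltr_wpDl.
exists (Num.min d (e / (`|C| + 1))); first by rewrite lt_min d0 divr_gt0.
move=> h; rewrite lt_min => /andP[h1 h2]; apply: (le_trans (H h h1)).
have -> : h ^+ 2 = `|h| * `|h| by rewrite -normrM ger0_norm// -expr2 sqr_ge0.
rewrite mulrA ler_wpM2r//; rewrite ltr_pdivlMr// in h2.
apply: le_trans (ltW h2); rewrite mulrC ler_wpM2l//.
by rewrite (le_trans (ler_norm C))// lerDl.
Qed.

Lemma is_derive_cont f t l : is_derive t 1 f l -> {for t, continuous f}.
Proof.
by case=> dv _; apply: differentiable_continuous; apply/derivable1_diffP.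
Qed.

Lemma isd_eq f t l l' : is_derive t 1 f l -> l = l' -> is_derive t 1 f l'.
Proof. by move=> ? <-. Qed.

Lemma isd_add f g t l l' : is_derive t 1 f l -> is_derive t 1 g l' ->
  is_derive t 1 (fun x => f x + g x) (l + l').
Proof. by move=> ? ?; exact: is_deriveD. Qed.

Lemma isd_sub f g t l l' : is_derive t 1 f l -> is_derive t 1 g l' ->
  is_derive t 1 (fun x => f x - g x) (l - l').
Proof. by move=> ? ?; exact: is_deriveB. Qed.

Lemma isd_mul f g t l l' : is_derive t 1 f l -> is_derive t 1 g l' ->
  is_derive t 1 (fun x => f x * g x) (l * g t + f t * l').
Proof.
move=> h1 h2; apply: isd_eq (@is_deriveM _ _ f g t 1 l l' h1 h2) _.
by rewrite addrC [g t *: l]mulrC.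
Qed.

Lemma isd_scale f t l (a : R) : is_derive t 1 f l ->
  is_derive t 1 (fun x => a * f x) (a * l).
Proof. by move=> ?; exact: (@is_deriveZ _ _ _ f a t 1 l). Qed.

Lemma isd_exp f t l n : is_derive t 1 f l ->
  is_derive t 1 (fun x => f x ^+ n) (n%:R * f t ^+ n.-1 * l).
Proof.
move=> h; have -> : (fun x => f x ^+ n) = f ^+ n by rewrite exprfctE.
exact: (@is_deriveX _ _ f n t 1 l h).
Qed.

Lemma isd_cst (a t : R) : is_derive t 1 (fun=> a) 0.
Proof. exact: is_derive_cst. Qed.

Lemma isd_id t : is_derive t 1 (fun x => x) 1.
Proof. exact: is_derive_id. Qed.

Lemma isd_affine f (a b t l : R) : is_derive (a * t + b) 1 f l ->
  is_derive t 1 (fun x => f (a * x + b)) (a * l).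
Proof.
move=> /is_derive_eps H; apply: is_derive_epsP => e e0.
have a0 : 0 < `|a| + 1 by rewrite ltr_wpDl.
have [d d0 hd] := H _ (divr_gt0 e0 a0).
exists (d / (`|a| + 1)); first exact: divr_gt0.
move=> h; rewrite ltr_pdivlMr// => hlt.
have alt : `|a * h| < d.
  by apply: le_lt_trans hlt; rewrite normrM mulrC ler_wpM2l// lerDl.
have := hd _ alt; have -> : a * (t + h) + b = a * t + b + a * h by ring.
rewrite -mulrA [a * (h * l)]mulrCA => /le_trans; apply.
rewrite mulrAC ler_pdivrMr// normrM [leLHS]mulrA mulrAC ler_wpM2l ?mulr_ge0// ?ltW//.
by rewrite ltrDl.
Qed.

Lemma isd_near f g t l : (\forall x \near t, f x = g x) ->
  is_derive t 1 f l -> is_derive t 1 g l.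
Proof. by move=> ? ?; apply: near_eq_is_derive; eassumption. Qed.

Lemma isd_sum (I : Type) (r : seq I) (P : pred I) (F : I -> R -> R) (L : I -> R) t :
  (forall i, P i -> is_derive t 1 (F i) (L i)) ->
  is_derive t 1 (fun x => \sum_(i <- r | P i) F i x) (\sum_(i <- r | P i) L i).
Proof.
move=> H; elim: r => [|i r ih].
  rewrite big_nil; under [fun x => _]eq_fun do rewrite big_nil; exact: isd_cst.
rewrite big_cons; under [fun x => _]eq_fun do rewrite big_cons.
by case: ifP => // Pi; apply: isd_add => //; exact: H.
Qed.

Lemma isd_uniq f t l l' : is_derive t 1 f l -> is_derive t 1 f l' -> l = l'.
Proof. by move=> [_ <-] [_ <-]. Qed.

Lemma mean_value f g (a b : R) :
  (forall t, Num.min a b <= t <= Num.max a b -> is_derive t 1 f (g t)) ->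
  exists2 c, Num.min a b <= c <= Num.max a b & f b - f a = g c * (b - a).
Proof.
wlog: a b / a <= b => [hw H|ab].
  case/orP: (le_total a b) => [ab|ba]; first exact: hw.
  have [|c cc E] := hw b a ba _; first by rewrite minC maxC.
  exists c; first by rewrite minC maxC.
  by rewrite -opprB E -mulrN opprB.
rewrite (min_idPl ab) (max_idPr ab) => H.
have [||c] := @MVT_segment R f g a b ab.
- by move=> x; rewrite in_itv/= => /andP[x1 x2]; apply: H; rewrite !ltW.
- apply: derivable_within_continuous => x; rewrite in_itv/= => xab.
  by have [] := H x xab.
- by rewrite in_itv/= => cab E; exists c.
Qed.

Lemma mean_value_le f g (a b K : R) :
  (forall t, Num.min a b <= t <= Num.max a b -> is_derive t 1 f (g t)) ->
  (forall t, Num.min a b <= t <= Num.max a b -> `|g t| <= K) ->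
  `|f b - f a| <= K * `|b - a|.
Proof.
move=> H1 H2; have [c cab ->] := mean_value H1.
by rewrite normrM ler_wpM2r// H2.
Qed.

(* [u k] plays the role of the k-th derivative of [u 0] on [O]; unlike
   [derive1n], such a sequence can be given on part of the line only. *)
Definition jet_on (O : set R) (u : nat -> R -> R) :=
  forall k t, O t -> is_derive t 1 (u k) (u k.+1 t).

Lemma jet_on_sub (O O' : set R) u : O' `<=` O -> jet_on O u -> jet_on O' u.
Proof. by move=> s H k t /s; exact: H. Qed.

Lemma jet_on_shift O u : jet_on O u -> jet_on O (fun k => u k.+1).
Proof. by move=> H k t; exact: H. Qed.

Fixpoint taylor (N : nat) (u : nat -> R -> R) (a b : R) : R :=
  if N is N'.+1 then taylor N' u a b + u N' a * (b - a) ^+ N' / N'`!%:R else 0.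

Lemma isd_taylorS N u (a b : R) :
  is_derive b 1 (taylor N.+1 u a) (taylor N (fun k => u k.+1) a b).
Proof.
elim: N => [|N IH].
  have -> : taylor 1 u a = fun=> u 0%N a.
    by apply/funext => x; rewrite /= add0r expr0 mulr1 divr1.
  exact: isd_cst.
have -> : taylor N.+2 u a = fun b => taylor N.+1 u a b + u N.+1 a * (b - a) ^+ N.+1 / N.+1`!%:R by [].
rewrite [taylor N.+1 _ a b]/=; apply: isd_add => //.
have d1 : is_derive b 1 (fun x => x - a) 1.
  by apply: isd_eq (isd_sub (isd_id b) (isd_cst a b)) _; rewrite subr0.
have d2 := isd_exp N.+1 d1.
have := isd_mul (isd_mul (isd_cst (u N.+1 a) b) d2) (isd_cst (N.+1`!%:R^-1) b).
move=> /isd_eq; apply.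
rewrite mul0r add0r mulr0 addr0 mulr1 factS natrM.
have n1 : (N.+1)%:R != 0 :> R by rewrite pnatr_eq0.
have n2 : (N`!)%:R != 0 :> R by rewrite pnatr_eq0 -lt0n fact_gt0.
rewrite /=; move: n1 n2; move: (N.+1%:R) (N`!%:R) => p q p0 q0.
by field; rewrite p0 q0.
Qed.

Lemma taylor0 N u (a : R) : taylor N.+1 u a a = u 0 a.
Proof.
elim: N => [|N IH]; first by rewrite /= add0r expr0 mulr1 divr1.
by rewrite /= -/(taylor N.+1 u a a) IH subrr expr0n/= mulr0 mul0r addr0.
Qed.

Definition seg (a b : R) : set R := [set t | Num.min a b <= t <= Num.max a b].

Lemma segl (a b : R) : seg a b a.
Proof. by rewrite /seg/= ge_min lexx le_max lexx. Qed.

Lemma segr (a b : R) : seg a b b.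
Proof. by rewrite /seg/= ge_min lexx le_max lexx !orbT. Qed.

Lemma seg_sub (a b c d : R) : seg a b c -> seg a b d -> seg c d `<=` seg a b.
Proof.
move=> /andP[c1 c2] /andP[d1 d2] x /andP[x1 x2]; apply/andP; split.
  by rewrite (le_trans _ x1)// le_min c1.
by rewrite (le_trans x2)// ge_max c2.
Qed.

Lemma seg_dist (a b t : R) : seg a b t -> `|t - a| <= `|b - a|.
Proof.
move=> /andP[]; have [ab|ba] := leP a b => t1 t2.
  by rewrite !ger0_norm ?subr_ge0// lerB.
by rewrite -normrN opprB -[leRHS]normrN opprB !ger0_norm ?subr_ge0// ?lerB// ltW.
Qed.

(* The factor [1 / N!] of the remainder is dropped: it is never needed. *)
Lemma taylor_le N u (a b K : R) : jet_on (seg a b) u ->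
  (forall t, seg a b t -> `|u N t| <= K) ->
  `|u 0 b - taylor N u a b| <= K * `|b - a| ^+ N.
Proof.
elim: N u b => [|N IH] u b J H.
  by rewrite /= subr0 expr0 mulr1 H//; exact: segr.
have K0 : 0 <= K by rewrite (le_trans _ (H a (segl _ _))).
have D t : seg a b t ->
    is_derive t 1 (fun x => u 0 x - taylor N.+1 u a x) (u 1 t - taylor N (fun k => u k.+1) a t).
  by move=> ht; apply: isd_sub; [exact: J|exact: isd_taylorS].
have B t : seg a b t -> `|u 1 t - taylor N (fun k => u k.+1) a t| <= K * `|b - a| ^+ N.
  move=> ht; have ss : seg a t `<=` seg a b by apply: seg_sub => //; exact: segl.
  have := IH (fun k => u k.+1) t (jet_on_shift (jet_on_sub ss J)) (fun x hx => H x (ss x hx)).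
  move/le_trans; apply; rewrite ler_wpM2l// lerXn2r ?nnegrE//; exact: seg_dist.
have := mean_value_le D B.
by rewrite taylor0 subrr subr0 -mulrA -exprSr.
Qed.

End OneVariable.

(** * Finite differences *)

Section FiniteDifferences.
Variable R : realType.

Fixpoint mfd (V : lmodType R) (vs : seq V) (f : V -> R) (x : V) : R :=
  if vs is v :: vs' then mfd vs' f (x + v) - mfd vs' f x else f x.

Definition bcoef (m j : nat) : R := (-1) ^+ (m - j) * 'C(m, j)%:R.

Lemma mfd_nseq (V : lmodType R) m (v : V) f x :
  mfd (nseq m v) f x = \sum_(j < m.+1) bcoef m j * f (x + v *+ j).
Proof.
elim: m x => [|m IH] x.
  by rewrite big_ord_recl big_ord0 /= /bcoef bin0 expr0 mulr0n !addr0 !mul1r.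
rewrite [LHS]/= !IH [RHS]big_ord_recl [X in _ - X]big_ord_recl /=.
rewrite opprD addrCA; congr (_ + _).
  by rewrite /bcoef !subn0 !bin0 exprS mulN1r !mulr1 mulNr.
have -> : \sum_(i < m) bcoef m (bump 0 i) * f (x + v *+ bump 0 i) =
          \sum_(i < m.+1) bcoef m i.+1 * f (x + v *+ i.+1).
  rewrite [RHS]big_ord_recr /= /bcoef bin_small// mulr0 mul0r addr0.
  by apply: eq_bigr.
rewrite -sumrB; apply: eq_bigr => i _; rewrite /bump leq0n add1n.
rewrite -addrA -mulrS -mulrBl; congr (_ * _).
rewrite /bcoef subSS binS natrD mulrDr addrC; congr (_ + _).
have [im|mi] := ltnP i m; first by rewrite -[(m - i)%N]subnSK// exprS mulN1r mulNr.
by rewrite bin_small// !mulr0 oppr0.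
Qed.

Lemma bcoef_norm_sum m : \sum_(j < m.+1) `|bcoef m j| = 2 ^+ m.
Proof.
rewrite -natrX -[2%N]/(1 + 1)%N Pascal natr_sum; apply: eq_bigr => i _.
by rewrite !exp1n !mul1n muln1 /bcoef normrM normrX normrN1 expr1n mul1r ger0_norm.
Qed.

Lemma mfd_sub (V : lmodType R) (vs : seq V) (f g : V -> R) x :
  mfd vs (fun y => f y - g y) x = mfd vs f x - mfd vs g x.
Proof. by elim: vs x => //= v vs IH x; rewrite !IH; ring. Qed.

Lemma mfd_scale (V : lmodType R) (vs : seq V) (f : V -> R) a x :
  mfd vs (fun y => a * f y) x = a * mfd vs f x.
Proof. by elim: vs x => //= v vs IH x; rewrite !IH; ring. Qed.

Lemma mfd_shift (V : lmodType R) (vs : seq V) (f : V -> R) v x :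
  mfd vs (fun y => f (y + v)) x = mfd vs f (x + v).
Proof. by elim: vs x => //= w vs IH x; rewrite !IH addrAC. Qed.

Lemma mfd_rcons (V : lmodType R) (vs : seq V) (f : V -> R) v x :
  mfd vs (fun y => f (y + v) - f y) x = mfd (v :: vs) f x.
Proof. by rewrite mfd_sub mfd_shift. Qed.

Lemma mfd_swap (V : lmodType R) (vs : seq V) (v w : V) f x :
  mfd (v :: w :: vs) f x = mfd (w :: v :: vs) f x.
Proof. by rewrite /= (addrAC x v w); ring. Qed.

Fixpoint fdn (m : nat) (h : R) (u : R -> R) (t : R) : R :=
  if m is m'.+1 then fdn m' h u (t + h) - fdn m' h u t else u t.

Lemma fdn_line (V : lmodType R) m h (v : V) f x t :
  mfd (nseq m (h *: v)) f (x + t *: v) = fdn m h (fun s => f (x + s *: v)) t.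
Proof. by elim: m t => //= m IH t; rewrite -!IH -addrA -scalerDl. Qed.

Lemma fdn_line0 (V : lmodType R) m h (v : V) f x :
  mfd (nseq m (h *: v)) f x = fdn m h (fun s => f (x + s *: v)) 0.
Proof. by rewrite -fdn_line scale0r addr0. Qed.

Lemma fdnS m h u t : fdn m.+1 h u t = fdn m h (fun s => u (s + h) - u s) t.
Proof. elim: m t => // m IH t.
by change (fdn m.+1 h u (t + h) - fdn m.+1 h u t =
  fdn m.+1 h (fun s => u (s + h) - u s) t); rewrite !IH. Qed.

Lemma fdn_sum m h u t : fdn m h u t = \sum_(j < m.+1) bcoef m j * u (t + h *+ j).
Proof.
have := @fdn_line0 R^o m h 1 u t; rewrite mfd_nseq.
have -> : fdn m h (fun s : R => u (t + s *: (1 : R^o))) 0 = fdn m h u t.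
  have E s : fdn m h (fun s : R => u (t + s *: (1 : R^o))) s = fdn m h u (t + s).
    elim: m s => [|m IH] s /=; first by rewrite [s *: _]mulr1.
    by rewrite !IH addrA.
  by rewrite E addr0.
by move=> <-; apply: eq_bigr => j _; rewrite [h *: _]mulr1.
Qed.

Lemma seg_ge (t h s : R) : 0 <= h -> seg t (t + h) s <-> t <= s <= t + h.
Proof. by move=> h0; rewrite /seg/= (min_idPl _) ?(max_idPr _) // lerDl. Qed.

Lemma seg_le (t h s : R) : h <= 0 -> seg t (t + h) s <-> t + h <= s <= t.
Proof. by move=> h0; rewrite /seg/= (min_idPr _) ?(max_idPl _) // gerDl. Qed.

Lemma seg_step m (t h s : R) : seg t (t + h *+ m) s ->
  seg t (t + h *+ m.+1) s /\ seg t (t + h *+ m.+1) (s + h).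
Proof.
have [h0|/ltW h0] := leP 0 h.
  have mh := mulrn_wge0 m h0; have mh1 := mulrn_wge0 m.+1 h0.
  move/(seg_ge _ _ mh) => H; split; apply/(seg_ge _ _ mh1); move: H mh h0;
  rewrite mulrSr; lra.
have mh : h *+ m <= 0 by rewrite mulrn_wle0.
have mh1 : h *+ m.+1 <= 0 by rewrite mulrn_wle0.
move/(seg_le _ _ mh) => H; split; apply/(seg_le _ _ mh1); move: H mh h0;
rewrite mulrSr; lra.
Qed.

Lemma fdn_jet_le m (h : R) u t c d : jet_on (seg t (t + h *+ m)) u ->
  (forall s, seg t (t + h *+ m) s -> `|u m s - c| <= d) ->
  `|fdn m h (u 0%N) t - c * h ^+ m| <= d * `|h| ^+ m.
Proof.
elim: m u t c d => [|m IH] u t c d J H.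
  by rewrite /= !expr0 !mulr1; apply: H; exact: segl.
rewrite fdnS.
have := IH (fun k s => u k (s + h) - u k s) t (c * h) (d * `|h|).
rewrite -!mulrA -!exprS; apply.
- move=> k s /seg_step[s1 s2]; apply: isd_sub; last exact: J.
  have := @isd_affine _ (u k) 1 h s (u k.+1 (s + h)); rewrite !mul1r.
  have -> : (fun x => u k (1 * x + h)) = (fun x => u k (x + h)).
    by apply/funext => x; rewrite mul1r.
  by apply; exact: J.
- move=> s /seg_step[s1 s2]; have ss := seg_sub s1 s2.
  have [x xs ->] : exists2 x, seg s (s + h) x & u m (s + h) - u m s = u m.+1 x * h.
    have [|x xs E] := @mean_value _ (u m) (u m.+1) s (s + h).
      by move=> x /ss; exact: J.
    by exists x => //; rewrite E addrAC subrr add0r.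
  by rewrite -mulrBl normrM ler_wpM2r// H//; exact: ss.
Qed.

(* The k-th derivative of a product, by recursion on k: this avoids binomial
   sums, and [leib_le] is the only estimate needed. *)
Fixpoint leib (k : nat) (u v : nat -> R -> R) (t : R) : R :=
  if k is k'.+1 then leib k' (fun i => u i.+1) v t + leib k' u (fun i => v i.+1) t
  else u 0%N t * v 0%N t.

Lemma jet_leib (O : set R) (u v : nat -> R -> R) : jet_on O u -> jet_on O v ->
  jet_on O (fun k => leib k u v).
Proof.
move=> Ju Jv k; elim: k u v Ju Jv => [|k IH] u v Ju Jv t Ot.
  by apply: isd_mul; [exact: Ju|exact: Jv].
by apply: isd_add; apply: IH => //; exact: jet_on_shift.
Qed.

Lemma leib_le k u v t (A B D : R) : 0 <= D ->
  (forall i, (i <= k)%N -> `|u i t| <= A * D ^+ i) ->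
  (forall i, (i <= k)%N -> `|v i t| <= B * D ^+ i) ->
  `|leib k u v t| <= A * B * (2 * D) ^+ k.
Proof.
move=> D0; elim: k u v A B => [|k IH] u v A B Hu Hv.
  rewrite /= expr0 mulr1 normrM; apply: ler_pM => //.
    by have := Hu 0%N isT; rewrite expr0 mulr1.
  by have := Hv 0%N isT; rewrite expr0 mulr1.
rewrite /= (le_trans (ler_normD _ _))//.
have h1 := IH (fun i => u i.+1) v (A * D) B.
have h2 := IH u (fun i => v i.+1) A (B * D).
have {}h1 : `|leib k (fun i => u i.+1) v t| <= A * D * B * (2 * D) ^+ k.
  apply: h1 => i ik; last by apply: Hv; exact: leqW.
  by rewrite -mulrA -exprS; exact: Hu.
have {}h2 : `|leib k u (fun i => v i.+1) t| <= A * (B * D) * (2 * D) ^+ k.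
  apply: h2 => i ik; first by apply: Hu; exact: leqW.
  by rewrite -mulrA -exprS; exact: Hv.
apply: le_trans (lerD h1 h2) _; rewrite [in leRHS]exprS le_eqVlt; apply/orP; left; apply/eqP; ring.
Qed.

Lemma leib_eq0 k u v t : (forall i, u i t = 0) -> leib k u v t = 0.
Proof.
elim: k u v => [|k IH] u v H /=; first by rewrite H mul0r.
by rewrite !IH// addr0.
Qed.

Lemma jet_affine (O : set R) u a b : jet_on O u ->
  jet_on [set t | O (a * t + b)] (fun k t => a ^+ k * u k (a * t + b)).
Proof.
move=> J k t /= Ot; rewrite exprSr -mulrA; apply: isd_scale.
by apply: isd_affine; exact: J.
Qed.

Lemma jet_add (O : set R) (u v : nat -> R -> R) : jet_on O u -> jet_on O v ->
  jet_on O (fun k t => u k t + v k t).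
Proof. by move=> Ju Jv k t Ot; apply: isd_add; [exact: Ju|exact: Jv]. Qed.

Lemma jet_sub (O : set R) (u v : nat -> R -> R) : jet_on O u -> jet_on O v ->
  jet_on O (fun k t => u k t - v k t).
Proof. by move=> Ju Jv k t Ot; apply: isd_sub; [exact: Ju|exact: Jv]. Qed.

Lemma jet_scale (O : set R) (u : nat -> R -> R) (a : R) : jet_on O u -> jet_on O (fun k t => a * u k t).
Proof. by move=> Ju k t Ot; apply: isd_scale; exact: Ju. Qed.

Lemma jet_cst (O : set R) (a : R) : jet_on O (fun k _ => if k is 0%N then a else 0).
Proof. by move=> [|k] t Ot; exact: isd_cst. Qed.

Lemma jet_sum (O : set R) (I : Type) (r : seq I) (P : pred I) (U : I -> nat -> R -> R) :
  (forall i, P i -> jet_on O (U i)) ->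
  jet_on O (fun k t => \sum_(i <- r | P i) U i k t).
Proof. by move=> H k t Ot; apply: isd_sum => i Pi; exact: H. Qed.

Lemma cvgn_norm_le (u : nat -> R) (l C : R) : u @ \oo --> l ->
  (forall n, `|u n| <= C) -> `|l| <= C.
Proof.
move=> ul H; have {}ul : (fun n => `|u n|) @ \oo --> `|l| by exact: cvg_norm.
rewrite -(cvg_lim _ ul)//; apply: limr_le; first by apply/cvg_ex; exists `|l|.
by apply: nearW => n; exact: H.
Qed.

Lemma cvg_series_bound (a b : nat -> R) : cvgn (series b) ->
  (forall n, `|a n| <= b n) -> cvgn (series a) /\
  `|limn (series a)| <= limn (series b).
Proof.
move=> cb H; have b0 n : 0 <= b n by exact: le_trans (H n).
have cn : cvgn [normed series a].
  by apply: (@series_le_cvg _ _ b) => // n; rewrite normr_ge0.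
split; first exact: normed_cvg.
apply: le_trans (lim_series_norm cn) _.
exact: lim_series_le.
Qed.

Lemma jet_series (O : set R) (U : nat -> nat -> R -> R) (a : nat -> nat -> R) :
  open O -> (forall n, jet_on O (U n)) ->
  (forall n k t, O t -> `|U n k t| <= a k n) ->
  (forall k, cvgn (series (a k))) ->
  jet_on O (fun k t => limn (series (fun n => U n k t))).
Proof.
move=> oO J H ca k t Ot.
have [r r0 hr] : exists2 r, 0 < r & forall s, `|s| < r -> O (t + s).
  have /nbhs_ballP[r r0 hr] : nbhs t O by exact: open_nbhs_nbhs.
  exists r => // s sr; apply: hr.
  by rewrite -ball_normE /ball_/= opprD addNKr normrN.
apply: (@is_derive_quad _ _ _ _ (limn (series (a k.+2))) r r0) => h hlt.
have cvU j s : O s -> series (fun n => U n j s) @ \oo --> limn (series (fun n => U n j s)).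
  by move=> Os; have [] := cvg_series_bound (ca j) (fun n => H n j s Os).
have Oth := hr h hlt.
have C : (fun N => series (fun n => U n k (t + h)) N - series (fun n => U n k t) N -
    h * series (fun n => U n k.+1 t) N) @ \oo -->
    limn (series (fun n => U n k (t + h))) - limn (series (fun n => U n k t)) -
    h * limn (series (fun n => U n k.+1 t)).
  apply: cvgB; first by apply: cvgB; exact: cvU.
  by apply: cvgM; [exact: cvg_cst|exact: cvU].
apply: (cvgn_norm_le C) => N.
rewrite /series/= mulr_sumr -!sumrB /=.
apply: le_trans (ler_norm_sum _ _ _) _.
apply: (@le_trans _ _ (\sum_(0 <= n < N) a k.+2 n * h ^+ 2)).
  rewrite !big_nat; apply: ler_sum => n _.
  have ss : seg t (t + h) `<=` O.
    move=> s /seg_dist; rewrite [t + h]addrC addrK => hs.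
    by rewrite -[s](subrK t) [_ + t]addrC; apply: hr; exact: le_lt_trans hlt.
  have := @taylor_le _ 2 (fun j => U n (k + j)%N) t (t + h) (a k.+2 n).
  rewrite /= !add0r expr0 expr1 !divr1 mulr1 addn0 addn1 addn2.
  have -> : t + h - t = h by rewrite addrAC subrr add0r.
  have -> : `|h| ^+ 2 = h ^+ 2 by rewrite -normrX ger0_norm// sqr_ge0.
  rewrite opprD addrA [U n k.+1 t * h]mulrC; apply.
    by move=> j s /ss Os; rewrite addnS; exact: J.
  by move=> s /ss; exact: H.
rewrite -mulr_suml ler_wpM2r ?sqr_ge0//.
apply: nondecreasing_cvgn_le; last exact: ca.
apply: nondecreasing_series => n _ _; exact: le_trans (H n k.+2 t Ot).
Qed.

Lemma jet_derive1n (O : set R) u g : open O -> jet_on O u ->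
  (forall t, O t -> g t = u 0%N t) ->
  forall k t, O t -> derive1n k g t = u k t.
Proof.
move=> oO J gu; elim=> [|k IH] t Ot; first exact: gu.
rewrite derive1nS derive1E.
have [_ <-] := J k t Ot; apply: near_eq_derive.
by near=> s; apply: IH; near: s; exact: open_nbhs_nbhs.
Unshelve. all: by end_near. Qed.

Lemma jet_derivable (O : set R) u g : open O -> jet_on O u ->
  (forall t, O t -> g t = u 0%N t) ->
  forall k t, O t -> derivable (derive1n k g) t 1.
Proof.
move=> oO J gu k t Ot.
have [dv _] := J k t Ot; apply: near_eq_derivable dv.
near=> s; apply/esym/(jet_derive1n oO J gu); near: s; exact: open_nbhs_nbhs.
Unshelve. all: by end_near. Qed.

Lemma smooth_jet (g : R -> R) : smooth_curve g -> jet_on setT (fun k => derive1n k g).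
Proof.
move=> H k t _; apply: DeriveDef; first exact: H.
by rewrite derive1nS derive1E.
Qed.

Lemma isd_locbd (f : R -> R) (t l : R) : is_derive t 1 f l ->
  exists2 d, 0 < d & forall h, `|h| < d -> `|f (t + h)| <= `|f t| + `|l| + 1.
Proof.
move=> /is_derive_eps /(_ 1 ltr01)[d d0 H]; exists (Num.min d (2^-1)).
  by rewrite lt_min d0 invr_gt0 ltr0n.
move=> h; rewrite lt_min => /andP[/H h1 h2].
have -> : f (t + h) = (f (t + h) - f t - h * l) + f t + h * l by ring.
rewrite (le_trans (ler_normD _ _))// (le_trans (lerD (ler_normD _ _) (lexx _)))//.
rewrite normrM.
have : `|h| * `|l| <= 2^-1 * `|l| by rewrite ler_wpM2r// ltW.
have := normr_ge0 l; have := normr_ge0 h.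
move: h1 h2; lra.
Qed.

Lemma coef_step (r : R) u i c : 0 < r -> jet_on [set t | `|t| < r] u ->
  (forall j, (j < i)%N -> u j 0 = 0) ->
  (forall e, 0 < e -> exists2 d, 0 < d & forall s, 0 < s < d ->
     `|u 0%N s - c * s ^+ i| <= e * s ^+ i) ->
  u i 0 = c * i`!%:R.
Proof.
move=> r0 J uj H; have O0 : [set t : R | `|t| < r] 0 by rewrite /= normr0.
have [d1 d10 B] := isd_locbd (J i.+1 0 O0).
set K := `|_| + _ + 1 in B.
have K0 : 0 <= K by rewrite /K addr_ge0// addr_ge0.
have ty s : taylor i.+1 u 0 s = u i 0 * s ^+ i / i`!%:R.
  rewrite /= subr0; suff -> : taylor i u 0 s = 0 by rewrite add0r.
  elim: i uj {H B J K K0} => //= i IH uj; rewrite IH ?uj// ?mul0r ?addr0//.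
  by move=> j ji; apply: uj; exact: ltnW.
have f0 : i`!%:R != 0 :> R by rewrite pnatr_eq0 -lt0n fact_gt0.
apply/eqP; rewrite -subr_eq0 -normr_le0; apply/ler_addgt0Pl => e e0; rewrite addr0.
have fp : 0 < i`!%:R :> R by rewrite ltr0n fact_gt0.
pose e' := e / i`!%:R / 2.
have e'0 : 0 < e' by rewrite !divr_gt0.
have [d2 d20 {}H] := H _ e'0.
pose s := Num.min (Num.min (d1 / 2) (d2 / 2)) (Num.min (r / 2) (e' / (K + 1))).
have s0 : 0 < s by rewrite !lt_min !divr_gt0// ltr_wpDl.
have sd1 : s < d1 by rewrite !gt_min; apply/orP; left; apply/orP; left; move: d10; lra.
have sd2 : s < d2 by rewrite !gt_min; apply/orP; left; apply/orP; right; move: d20; lra.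
have sr : s < r by rewrite !gt_min; apply/orP; right; apply/orP; left; move: r0; lra.
have sK : s * K <= e'.
  apply: (@le_trans _ _ (s * (K + 1))); first by rewrite ler_pM2l// lerDl.
  by rewrite -ler_pdivlMr ?ltr_wpDl// !ge_min lexx !orbT.
have seg0 t : seg 0 s t -> 0 <= t <= s by rewrite -[s]add0r => /(seg_ge _ _ (ltW s0)); rewrite add0r.
have T := @taylor_le _ i.+1 u 0 s K.
have {}T : `|u 0%N s - u i 0 * s ^+ i / i`!%:R| <= K * s ^+ i.+1.
  move: T; rewrite ty subr0 [`|s|]gtr0_norm//; apply=> [j t|t] /seg0 /andP[t0 ts].
    by apply: J; rewrite /= ger0_norm// (le_lt_trans ts).
  by rewrite -[t]add0r; apply: B; rewrite ger0_norm// (le_lt_trans ts).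
have {}H := H s; rewrite s0 sd2 in H; have {}H := H isT.
have P : 0 < s ^+ i by rewrite exprn_gt0.
have Q : `|u i 0 / i`!%:R - c| * s ^+ i <= (e' + e') * s ^+ i.
  rewrite -{1}[s ^+ i]gtr0_norm// -normrM.
  have -> : (u i 0 / i`!%:R - c) * s ^+ i =
    (u 0%N s - c * s ^+ i) - (u 0%N s - u i 0 * s ^+ i / i`!%:R) by ring.
  rewrite (le_trans (ler_normB _ _))// mulrDl lerD//.
  by rewrite (le_trans T)// exprS mulrA ler_pM2r// mulrC.
rewrite ler_pM2r// in Q.
have -> : u i 0 - c * i`!%:R = (u i 0 / i`!%:R - c) * i`!%:R by rewrite mulrBl divfK.
rewrite normrM [`|i`!%:R|]gtr0_norm// -ler_pdivlMr//.
by apply: le_trans Q _; rewrite /e'; lra.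
Qed.

Lemma jet_coef (r : R) u N c : 0 < r -> jet_on [set t | `|t| < r] u ->
  (forall e, 0 < e -> exists2 d, 0 < d & forall s, 0 < s < d ->
     `|u 0%N s - c * s ^+ N| <= e * s ^+ N) ->
  u N 0 = c * N`!%:R.
Proof.
move=> r0 J H; apply: (coef_step r0 J _ H) => j.
elim/ltn_ind: j => j IH jN.
rewrite (@coef_step r u j 0) ?mul0r// => [i ij|e e0].
  by apply: IH => //; exact: ltn_trans jN.
have [d d0 {}H] := H 1 ltr01.
have C0 : 0 < `|c| + 1 by rewrite ltr_wpDl.
exists (Num.min (Num.min d 1) (e / (`|c| + 1))).
  by rewrite !lt_min d0 ltr01 divr_gt0.
move=> s; rewrite !lt_min => /andP[s0 /andP[/andP[sd s1] se]].
rewrite mul0r subr0 -[u 0%N s](subrK (c * s ^+ N)).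
rewrite (le_trans (ler_normD _ _))//.
have {}H := H s; rewrite s0 sd in H; have {}H := H isT.
have P : 0 < s ^+ N by rewrite exprn_gt0.
rewrite normrM [`|s ^+ N|]gtr0_norm//.
apply: (@le_trans _ _ ((`|c| + 1) * s ^+ N)).
  by rewrite mulrDl addrC lerD2l.
apply: (@le_trans _ _ ((`|c| + 1) * s ^+ j.+1)).
  by rewrite ler_pM2l// ler_wiXn2l// ltW.
rewrite exprS mulrA ler_pM2r ?exprn_gt0// mulrC -ler_pdivlMr//.
exact: ltW.
Qed.

End FiniteDifferences.

(** * Step functions in a non-quasianalytic class *)

Section Antiderivative.
Variable R : realType.
Implicit Types (t x y C : R) (u v : R -> R).
Let mu := @lebesgue_measure R.

Lemma antiderivative_right (u : R -> R) (a : R) : continuous u ->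
  exists U : R -> R, forall t : R, a < t -> is_derive t 1 U (u t).
Proof.
move=> cu; exists (fun x => (\int[mu]_(t in [set` `[a, x]]) u t)%R) => t at_.
have [||dF EF] := @continuous_FTC1_closed R u a t (t + 1) _ _ at_ (cu t).
- by rewrite ltrDl.
- apply: continuous_compact_integrable; first exact: segment_compact.
  by apply: continuous_subspaceT; exact: cu.
- by split; [exact: dF|rewrite -derive1E; exact: EF].
Qed.

Lemma antiderivative (u : R -> R) : continuous u ->
  exists U : R -> R, forall t : R, is_derive t 1 U (u t).
Proof.
move=> cu; pose F a := sval (cid (antiderivative_right a cu)).
have FE (a t : R) : a < t -> is_derive t 1 (F a) (u t) by exact: (svalP (cid (antiderivative_right a cu))).
have indep (a b x : R) : a < x -> a < 0 -> b < x -> b < 0 -> F a x - F a 0 = F b x - F b 0.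
  move=> ax a0 bx b0.
  have : `|(F a x - F b x) - (F a 0 - F b 0)| <= 0 * `|x - 0|.
    apply: (@mean_value_le _ (fun t => F a t - F b t) (fun=> 0)) => [t|t _]; last by rewrite normr0.
    move=> /andP[t1 _]; apply: isd_eq (isd_sub (FE a t _) (FE b t _)) _; last exact: subrr.
    - by apply: lt_le_trans t1; rewrite lt_min a0.
    - by apply: lt_le_trans t1; rewrite lt_min b0.
  rewrite mul0r normr_le0 => /eqP E; lra.
exists (fun x => F (- `|x| - 1) x - F (- `|x| - 1) 0) => t.
have neg (x : R) : - `|x| - 1 < 0 :> R by have := normr_ge0 x; lra.
have below (x : R) : - `|x| - 1 < x.
  by have := ler_norm (- x); rewrite normrN; lra.
apply: (@isd_near _ (fun x => F (- `|t| - 2) x - F (- `|t| - 2) 0)).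
  near=> x.
  have xt : `|x - t| < 1.
    by near: x; apply/nbhs_ballP; exists 1 => //= y; rewrite -ball_normE /= distrC.
  have := ler_norm (- t); have := ler_norm (- x); have := normr_ge0 t.
  move: xt; rewrite ltr_norml !normrN => /andP[h1 h2] h3 h4 h5.
  by apply: indep => //; lra.
apply: isd_eq (isd_sub (FE _ t _) (isd_cst _ t)) _; last by rewrite subr0.
by have := below t; lra.
Unshelve. all: by end_near. Qed.

Definition prim (u : R -> R) : R -> R :=
  if pselect (continuous u) is left cu then sval (cid (antiderivative cu)) else u.

Lemma primP u t : continuous u -> is_derive t 1 (prim u) (u t).
Proof. by rewrite /prim; case: pselect => // cu _; exact: (svalP (cid (antiderivative cu))). Qed.

Definition avg (a : R) (u : R -> R) (t : R) : R := (prim u (t + a) - prim u t) / a.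

Lemma isd_shift (f : R -> R) (a t l : R) : is_derive (t + a) 1 f l ->
  is_derive t 1 (fun x => f (x + a)) l.
Proof.
move=> H; have := @isd_affine _ f 1 a t l; rewrite !mul1r.
have -> : (fun x => f (1 * x + a)) = (fun x => f (x + a)).
  by apply/funext => x; rewrite mul1r.
by apply.
Qed.

Variables (a : R) (a0 : 0 < a).

Lemma isd_avg u t : continuous u -> is_derive t 1 (avg a u) ((u (t + a) - u t) / a).
Proof.
move=> cu; have D := isd_sub (isd_shift (primP (t + a) cu)) (primP t cu).
apply: isd_eq (isd_mul D (isd_cst a^-1 t)) _.
by rewrite mulr0 addr0.
Qed.

Lemma avg_mean u t : continuous u -> exists2 c, t <= c <= t + a & avg a u t = u c.
Proof.
move=> cu; have [x _|c cc E] := @mean_value _ (prim u) u t (t + a); first exact: primP.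
exists c; first by apply/(seg_ge _ _ (ltW a0)).
by rewrite /avg E [t + a]addrC addrK mulfK// gt_eqF.
Qed.

Lemma avg_sub_le u v t C : continuous u -> continuous v ->
  (forall x, `|u x - v x| <= C) -> `|avg a u t - avg a v t| <= C.
Proof.
move=> cu cv H; have := @mean_value_le _ (fun x => prim u x - prim v x) (fun x => u x - v x) t (t + a) C.
move=> /(_ (fun x _ => isd_sub (primP x cu) (primP x cv)) (fun x _ => H x)).
rewrite [t + a - t]addrC addKr [`|a|]gtr0_norm// -ler_pdivrMr//.
rewrite -[X in _ / X](gtr0_norm a0) -normf_div; congr (_ <= _); congr `|_|.
by rewrite /avg; ring.
Qed.

Lemma avg_lip u x y : continuous u -> (forall x y, `|u x - u y| <= `|x - y|) ->
  `|avg a u x - avg a u y| <= `|x - y|.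
Proof.
move=> cu H.
have := @mean_value_le _ (fun s => prim u (s + (x - y)) - prim u s)
  (fun s => u (s + (x - y)) - u s) y (y + a) `|x - y|.
have E : y + (x - y) = x by ring.
have E' : y + a + (x - y) = x + a by ring.
rewrite E E' => /(_ _ _).
have h1 t : seg y (y + a) t -> is_derive t 1 (fun s : R => prim u (s + (x - y)) - prim u s) (u (t + (x - y)) - u t).
  by move=> _; apply: isd_sub; [apply: isd_shift; exact: primP|exact: primP].
have h2 t : seg y (y + a) t -> `|u (t + (x - y)) - u t| <= `|x - y|.
  by move=> _; apply: le_trans (H _ _) _; rewrite [t + _]addrC addrK.
move=> /(_ h1 h2); rewrite [y + a - y]addrC addKr [`|a|]gtr0_norm// -ler_pdivrMr//.
rewrite -[X in _ / X](gtr0_norm a0) -normf_div; congr (_ <= _); congr `|_|.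
by rewrite /avg; ring.
Qed.

Lemma avg_near u t : continuous u -> (forall x y, `|u x - u y| <= `|x - y|) ->
  `|avg a u t - u t| <= a.
Proof.
move=> cu H; have [c /andP[c1 c2] ->] := avg_mean t cu.
by rewrite (le_trans (H _ _))// ger0_norm ?subr_ge0// lerBlDl.
Qed.

End Antiderivative.

Section StepFunction.
Variable R : realType.
Implicit Types (t x y C : R) (u v : R -> R).

Lemma lip_continuous (u : R -> R) : (forall x y, `|u x - u y| <= `|x - y|) -> continuous u.
Proof.
move=> H x; apply/cvgrPdist_le => e e0; near=> y.
apply: le_trans (H _ _) _; near: y.
by apply/nbhs_ballP; exists e => //= y /ltW.
Unshelve. all: by end_near. Qed.

Variables (rho : nat -> R).
Let a k := rho k - rho k.+1.
Hypothesis a0 : forall k, 0 < a k.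
Hypothesis rho0 : forall k, 0 <= rho k.
Hypothesis rhocvg : rho @ \oo --> (0 : R).

(* Iterated averages of the ramp over intervals of lengths [a j, a j.+1, ...].
   Their limit satisfies [wlim j = avg (a j) (wlim j.+1)], so that each
   derivative of [wlim 0] costs only a factor [2 / a j]. *)
Fixpoint iav (j n : nat) : R -> R :=
  if n is n'.+1 then avg (a j) (iav j.+1 n') else fun t => Num.max 0 (Num.min t 1).

Lemma iav_lip j n x y : `|iav j n x - iav j n y| <= `|x - y|.
Proof.
elim: n j x y => [|n IH] j x y /=; last first.
  by apply: avg_lip => //; exact: lip_continuous.
wlog xy : x y / x <= y => [H|].
  case/orP: (le_total x y) => [|yx]; first exact: H.
  by rewrite distrC [leRHS]distrC H.
rewrite distrC [leRHS]distrC [leRHS]ger0_norm ?subr_ge0//.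
rewrite ler_norml; case: (leP x 1) => ?; case: (leP y 1) => ?; rewrite ?maxEle;
 repeat case: ifPn; rewrite -?ltNge; lra.
Qed.

Lemma iav_cont j n : continuous (iav j n).
Proof. exact/lip_continuous/iav_lip. Qed.

Lemma iav_diff j n t : `|iav j n.+1 t - iav j n t| <= a (j + n)%N.
Proof.
elim: n j t => [|n IH] j t.
  by rewrite addn0; exact: (avg_near (a0 j) t (@iav_cont j 0%N) (@iav_lip j 0%N)).
change (`|avg (a j) (iav j.+1 n.+1) t - avg (a j) (iav j.+1 n) t| <= a (j + n.+1)%N).
apply: avg_sub_le => //; [exact: iav_cont|exact: iav_cont|move=> x].
by rewrite addnS -addSn; exact: IH.
Qed.

Lemma series_a j : series (fun n => a (j + n)%N) @ \oo --> rho j.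
Proof.
have -> : series (fun n => a (j + n)%N) = fun n => rho j - rho (j + n)%N.
  apply/funext; elim=> [|n IH]; first by rewrite /series/= big_geq// addn0 subrr.
  by rewrite seriesSr IH /a addnS; ring.
rewrite -[X in _ --> X]subr0; apply: cvgB; first exact: cvg_cst.
have -> : (fun n => rho (j + n)%N) = (fun n => rho (n + j)%N).
  by apply/funext => n; rewrite addnC.
by have := rhocvg; rewrite -(cvg_shiftn j rho).
Qed.

Definition wlim (j : nat) (t : R) : R := limn (fun n => iav j n t).

Lemma iav_bound j n p t : `|iav j (n + p) t - iav j n t| <= rho (j + n)%N.
Proof.
suff : `|iav j (n + p) t - iav j n t| <= rho (j + n)%N - rho (j + n + p)%N.
  by move/le_trans; apply; rewrite gerBl.
elim: p => [|p IH]; first by rewrite !addn0 !subrr normr0.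
have := iav_diff j (n + p) t; rewrite addnA => D.
rewrite addnS -[_ - _](subrKA (iav j (n + p) t)) (le_trans (ler_normD _ _))//.
by move: IH D; rewrite /a addnS; lra.
Qed.

Lemma wlim_cvg j t : (fun n => iav j n t) @ \oo --> wlim j t.
Proof.
have cs := @cvg_series_bound _ (fun n => iav j n.+1 t - iav j n t) (fun n => a (j + n)%N).
have [|cv _] := cs _ (iav_diff j ^~ t); first by apply/cvg_ex; exists (rho j); exact: series_a.
have E : (fun n => iav j n t) = fun n => iav j 0 t + series (fun n => iav j n.+1 t - iav j n t) n.
  apply/funext; elim=> [|n IH]; first by rewrite /series/= big_geq// addr0.
  by rewrite seriesSr addrA -IH; ring.
by rewrite /wlim E; apply: is_cvgD; [exact: is_cvg_cst|exact: cv].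
Qed.

Lemma wlim_near j n t : `|wlim j t - iav j n t| <= rho (j + n)%N.
Proof.
have C : (fun p => iav j (n + p) t - iav j n t) @ \oo --> wlim j t - iav j n t.
  apply: cvgB; last exact: cvg_cst.
  have -> : (fun p => iav j (n + p) t) = (fun p => iav j (p + n) t).
    by apply/funext => p; rewrite addnC.
  by have := @wlim_cvg j t; rewrite -(cvg_shiftn n).
by apply: (cvgn_norm_le C) => p; exact: iav_bound.
Qed.

Lemma wlim_lip j x y : `|wlim j x - wlim j y| <= `|x - y|.
Proof.
by apply: (cvgn_norm_le (cvgB (@wlim_cvg j x) (@wlim_cvg j y))) => n; exact: iav_lip.
Qed.

Lemma wlim_cont j : continuous (wlim j).
Proof. exact/lip_continuous/wlim_lip. Qed.

Lemma wlim_avg j : wlim j = avg (a j) (wlim j.+1).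
Proof.
apply/funext => t; apply: cvg_lim => //; apply/cvgrPdist_le => e e0.
have [N _ HN] := (cvgrPdist_le _ _).1 rhocvg e e0.
exists N.+1 => // n /=; case: n => // n; rewrite ltnS => Nn.
apply: (@le_trans _ _ (rho (j.+1 + n)%N)).
  by apply: avg_sub_le => //; [exact: wlim_cont|exact: iav_cont|exact: wlim_near].
have := HN (j.+1 + n)%N; rewrite /= sub0r normrN ger0_norm//; apply.
by rewrite (leq_trans Nn)// leq_addl.
Qed.

Lemma iav_01 j n t : 0 <= iav j n t <= 1.
Proof.
elim: n j t => [|n IH] j t /=; last by have [c _ ->] := avg_mean (a0 j) t (@iav_cont j.+1 n).
by rewrite le_max lexx/= ge_max ler01 ge_min lexx orbT.
Qed.

Lemma iav_0 j n t : t <= - rho j -> iav j n t = 0.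
Proof.
elim: n j t => [|n IH] j t tr /=.
  by apply/max_idPl; rewrite ge_min (le_trans tr)// oppr_le0.
have [c /andP[_ c2] ->] := avg_mean (a0 j) t (@iav_cont j.+1 n).
by rewrite IH// (le_trans c2)//; move: tr; rewrite /a; lra.
Qed.

Lemma iav_1 j n t : 1 <= t -> iav j n t = 1.
Proof.
elim: n j t => [|n IH] j t tr /=; first by rewrite (min_idPr tr) (max_idPr _).
have [c /andP[c1 _] ->] := avg_mean (a0 j) t (@iav_cont j.+1 n).
by rewrite IH// (le_trans tr).
Qed.

Lemma wlim_01 j t : 0 <= wlim j t <= 1.
Proof.
have c : cvgn (fun n => iav j n t) by apply/cvg_ex; exists (wlim j t); exact: wlim_cvg.
apply/andP; split; [apply: limr_ge => //|apply: limr_le => //];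
  by apply: nearW => n; have /andP[] := iav_01 j n t.
Qed.

Lemma wlim_0 j t : t <= - rho j -> wlim j t = 0.
Proof.
move=> tr; rewrite /wlim; under eq_fun do rewrite iav_0//; exact: lim_cst.
Qed.

Lemma wlim_1 j t : 1 <= t -> wlim j t = 1.
Proof.
move=> tr; rewrite /wlim; under eq_fun do rewrite iav_1//; exact: lim_cst.
Qed.

Fixpoint dq (k : nat) (u : R -> R) : R -> R :=
  if k is k'.+1 then dq k' (fun t => (u (t + a k') - u t) / a k') else u.

Lemma isd_dq k (u u' : R -> R) t : (forall s : R, is_derive s 1 u (u' s)) ->
  is_derive t 1 (dq k u) (dq k u' t).
Proof.
elim: k u u' => [|k IH] u u' H /=; first exact: H.
apply: IH => s; have D := isd_sub (isd_shift (H (s + a k))) (H s).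
by apply: isd_eq (isd_mul D (isd_cst (a k)^-1 s)) _; rewrite mulr0 addr0.
Qed.

Lemma dq_le k u t (C : R) : (forall s, `|u s| <= C) ->
  `|dq k u t| <= (\prod_(i < k) (2 / a i)) * C.
Proof.
elim: k u C => [|k IH] u C H /=; first by rewrite big_ord0 mul1r.
rewrite big_ord_recr /= -mulrA; apply: IH => s.
rewrite normrM normfV (gtr0_norm (a0 k)) mulrAC ler_pM2r ?invr_gt0//.
by rewrite (le_trans (ler_normB _ _))// mulrDl mul1r lerD.
Qed.

Definition wjet k t := dq k (wlim k) t.

Lemma wjet_jet : jet_on setT wjet.
Proof.
move=> k t _; rewrite /wjet [dq k.+1]/=; apply: isd_dq => s.
rewrite {1}wlim_avg; apply: isd_avg => //; exact: wlim_cont.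
Qed.

Lemma wjet_le k t : `|wjet k t| <= \prod_(i < k) (2 / a i).
Proof.
rewrite -[leRHS]mulr1; apply: dq_le => s.
by have /andP[h1 h2] := wlim_01 k s; rewrite ger0_norm.
Qed.

Lemma wjet_out k t : t < - rho 0%N \/ 1 < t -> wjet k.+1 t = 0.
Proof.
elim: k t => [|k IH] t H.
  have D : is_derive t 1 (wjet 0) 0.
    case: H => H; [apply: (@isd_near R (fun=> 0))|apply: (@isd_near R (fun=> 1))];
      try exact: isd_cst.
    - near=> s; rewrite /wjet/= wlim_0//; near: s.
      by apply: filterS (lt_nbhsl H) => x /ltW.
    - near=> s; rewrite /wjet/= wlim_1//; near: s.
      by apply: filterS (lt_nbhsr H) => x /ltW.
  exact: isd_uniq (wjet_jet 0%N I) D.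
have D : is_derive t 1 (wjet k.+1) 0.
  apply: (@isd_near R (fun=> 0)).
  near=> s; rewrite IH//; near: s.
  case: H => H.
  - by apply: filterS (lt_nbhsl H) => x; left.
  - by apply: filterS (lt_nbhsr H) => x; right.
exact: isd_uniq (wjet_jet k.+1 I) D.
Unshelve. all: by end_near. Qed.

End StepFunction.

Section Beurling.
Variable R : realType.
Implicit Types (t x y C : R) (u v : R -> R) (M : nat -> R).

Lemma bounded_prod (g : nat -> R) N : (forall i, 0 <= g i) ->
  (forall i, (N <= i)%N -> g i <= 1) ->
  exists2 C, 0 <= C & forall k, \prod_(i < k) g i <= C.
Proof.
elim: N g => [|N IH] g g0 H.
  exists 1 => // k; rewrite -[leRHS](@big1_eq _ _ *%R 'I_k (index_enum _) xpredT).
  by apply: ler_prod => i _; rewrite g0 H.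
have [||C C0 HC] := IH (fun i => g i.+1); [by move=> i; exact: g0| |].
  by move=> i Ni; exact: H.
exists (1 + g 0%N * C); first by rewrite addr_ge0// mulr_ge0.
case=> [|k]; first by rewrite big_ord0 lerDl mulr_ge0.
by rewrite big_ord_recl /= ler_wpDl// ler_wpM2l//; exact: HC.
Qed.

(* Every [rho] is allowed: this is what makes room for bumps on intervals
   shrinking to a point inside one curve of the Denjoy-Carleman class. *)
Definition beurling M (g : nat -> R -> R) :=
  forall rho : R, 0 < rho -> exists2 C, 0 <= C &
    forall k t, `|g k t| <= C * rho ^+ k * k`!%:R * M k.

Lemma beurling_step M : positive_seq M -> non_quasianalytic M ->
  exists P : nat -> R -> R,
   [/\ jet_on setT P, (forall t, 0 <= P 0%N t <= 1) /\ (forall t, t <= 0 -> P 0%N t = 0),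
       (forall t, 1 <= t -> P 0%N t = 1),
       (forall k t, t < 0 \/ 1 < t -> P k.+1 t = 0) & beurling M P].
Proof.
(* With [r i] the tails of the convergent series, the widths
   [sqrt (r i) - sqrt (r i.+1)] are summable but infinitely larger than [x i]. *)
move=> M0 nq; pose x j := M j / (j.+1%:R * M j.+1).
have x0 j : 0 < x j by rewrite divr_gt0// mulr_gt0.
pose L := limn (series x); pose r i := L - series x i.
have xr i : r i = r i.+1 + x i by rewrite /r seriesSr; ring.
have r0 i : 0 <= r i.
  rewrite subr_ge0; apply: nondecreasing_cvgn_le => //.
  by apply: nondecreasing_series => n _ _; exact: ltW.
have rcv : r @ \oo --> (0 : R).
  by rewrite -[X in _ --> X](subrr L); apply: cvgB; [exact: cvg_cst|exact: nq].
pose rho i := Num.sqrt (r i).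
have rho_ge0 i : 0 <= rho i by exact: sqrtr_ge0.
have rhocv : rho @ \oo --> (0 : R).
  apply/cvgrPdist_le => e e0.
  have [N _ HN] := (cvgrPdist_le _ _).1 rcv (e ^+ 2) (exprn_gt0 2 e0).
  exists N => // n /= Nn; have := HN n Nn; rewrite /= !sub0r !normrN.
  rewrite !ger0_norm// => h; rewrite -(@ler_pXn2r _ 2)// ?nnegrE ?(ltW e0)//.
  by rewrite sqr_sqrtr.
have a0 i : 0 < rho i - rho i.+1.
  have ri : 0 < r i by rewrite (xr i) ltr_wpDl.
  by rewrite subr_gt0 ltr_sqrt// (xr i) ltrDl.
have aE i : (rho i - rho i.+1) * (rho i + rho i.+1) = x i.
  by rewrite -subr_sqr !sqr_sqrtr// (xr i); ring.
have s0 i : 0 < rho i + rho i.+1.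
  by rewrite -(pmulr_rgt0 _ (a0 i)) aE.
pose b := 1 + rho 0%N; have b0 : 0 < b by rewrite ltr_wpDr.
exists (fun k t => b ^+ k * wjet rho k (b * t + - rho 0%N)); split.
- have := @jet_affine R setT _ b (- rho 0%N) (wjet_jet a0 rho_ge0 rhocv).
  by apply: jet_on_sub.
- split=> t; first by rewrite expr0 mul1r; exact: wlim_01.
  move=> t0; rewrite expr0 mul1r; apply: wlim_0 => //.
  by rewrite gerDr; rewrite pmulr_rle0.
- move=> t t1; rewrite expr0 mul1r; apply: wlim_1 => //.
  have : b * 1 <= b * t by rewrite ler_pM2l.
  by rewrite /b; lra.
- move=> k t H; rewrite wjet_out ?mulr0//; case: H => H; [left|right].
    by rewrite gtrDr pmulr_rlt0.
  have : b * 1 < b * t by rewrite ltr_pM2l.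
  by rewrite /b; lra.
- move=> e e0; pose g i := b * (2 * (rho i + rho i.+1)) / e.
  have g0 i : 0 <= g i by rewrite !mulr_ge0// ?invr_ge0 ?(ltW b0) ?(ltW e0)// ltW.
  have [N HN] : exists N, forall i, (N <= i)%N -> g i <= 1.
    have e'0 : 0 < e / b / 4 by rewrite !divr_gt0.
    have [N _ HN] := (cvgrPdist_le _ _).1 rhocv _ e'0.
    exists N => i Ni; rewrite /g ler_pdivrMr// mul1r -ler_pdivlMl// [leRHS]mulrC.
    have := HN i Ni; have := HN i.+1 (leqW Ni).
    by rewrite /= !sub0r !normrN !ger0_norm//; lra.
  have [C C0 HC] := bounded_prod g0 HN.
  exists (C / M 0%N); first by rewrite divr_ge0// ltW.
  move=> k t; rewrite normrM normrX (gtr0_norm b0).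
  have := wjet_le a0 rhocv k (b * t + - rho 0%N).
  move/(ler_wpM2l (exprn_ge0 k (ltW b0)))/le_trans; apply.
  have -> : b ^+ k * \prod_(i < k) (2 / (rho i - rho i.+1)) =
            (\prod_(i < k) g i) * (e ^+ k * \prod_(i < k) (x i)^-1).
    rewrite -[k in b ^+ k]card_ord -prodr_const -[k in e ^+ k]card_ord -prodr_const.
    rewrite -!big_split /=; apply: eq_bigr => i _.
    rewrite /g -aE invfM.
    have := lt0r_neq0 e0; have := lt0r_neq0 (a0 i); have := lt0r_neq0 (s0 i).
    by move=> h1 h2 h3; field; rewrite h1 h2 h3.
  have -> : \prod_(i < k) (x i)^-1 = k`!%:R * M k / M 0%N.
    elim: k => [|k IH]; first by rewrite big_ord0 fact0 mul1r divff// gt_eqF.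
    rewrite big_ord_recr /= IH /x factS natrM invf_div.
    have h1 : M k != 0 by rewrite gt_eqF.
    have h2 : M 0%N != 0 by rewrite gt_eqF.
    have h3 : k.+1%:R != 0 :> R by rewrite pnatr_eq0.
    by field; rewrite h1 h2.
  have -> : C / M 0%N * e ^+ k * k`!%:R * M k = C * (e ^+ k * (k`!%:R * M k / M 0%N)) by ring.
  apply: ler_wpM2r => //; apply: mulr_ge0; first by rewrite exprn_ge0// ltW.
  by rewrite divr_ge0 ?mulr_ge0 ?(ltW (M0 _)).
Qed.

Lemma log_convex_ratio M k : positive_seq M -> log_convex M ->
  M k <= M 0%N / M 1%N * M k.+1.
Proof.
move=> M0 lc; suff : M k / M k.+1 <= M 0%N / M 1%N by rewrite ler_pdivrMr.
elim: k => // k IH; apply: le_trans IH.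
by rewrite ler_pdivrMr// mulrAC ler_pdivlMr// -expr2.
Qed.

Definition mulX (g : nat -> R -> R) k t := t * g k t + k%:R * g k.-1 t.

Lemma jet_mulX g : jet_on setT g -> jet_on setT (mulX g).
Proof.
move=> J k t _.
have D : is_derive t 1 (fun t => k%:R * g k.-1 t) (k%:R * g k t).
  case: k => [|k]; last exact: (isd_scale k.+1%:R (J k t I)).
  rewrite mul0r; have -> : (fun t => 0%:R * g 0.-1%N t) = fun=> 0; last exact: isd_cst.
  by apply/funext => x; rewrite mul0r.
apply: isd_eq (isd_add (isd_mul (isd_id t) (J k t I)) D) _.
by rewrite /mulX /= mul1r mulrSr; ring.
Qed.

Lemma beurling_mulX M K g : positive_seq M -> log_convex M -> 0 <= K ->
  (forall k t, K < `|t| -> g k t = 0) -> beurling M g ->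
  beurling M (mulX g) /\ forall k t, K < `|t| -> mulX g k t = 0.
Proof.
move=> M0 lc K0 sg bg; split; last by move=> k t Kt; rewrite /mulX !sg// !mulr0 addr0.
move=> rho rho0; have [C C0 HC] := bg rho rho0.
have m0 : 0 <= M 0%N / M 1%N by rewrite divr_ge0// ltW.
exists (K * C + C * (M 0%N / M 1%N) / rho).
  by apply: addr_ge0; [exact: mulr_ge0|apply: divr_ge0; [exact: mulr_ge0|exact: ltW]].
move=> k t; rewrite /mulX (le_trans (ler_normD _ _))// !normrM.
have h1 : `|t| * `|g k t| <= K * C * rho ^+ k * k`!%:R * M k.
  have P : 0 <= C * rho ^+ k * k`!%:R * M k by exact: le_trans (HC k t).
  have [tK|Kt] := leP `|t| K; last first.
    by rewrite sg// normr0 mulr0 -!mulrA mulr_ge0// !mulrA.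
  by rewrite -!mulrA ler_pM// !mulrA.
have h2 : `|k%:R : R| * `|g k.-1 t| <= C * (M 0%N / M 1%N) / rho * rho ^+ k * k`!%:R * M k.
  rewrite normr_nat; case: k h1 => [|k] _ /=.
    by rewrite mul0r !mulr_ge0// ?invr_ge0 ?exprn_ge0// ltW.
  apply: (@le_trans _ _ (k.+1%:R * (C * rho ^+ k * k`!%:R * M k))).
    by rewrite ler_wpM2l.
  rewrite exprS factS natrM.
  have -> : C * (M 0%N / M 1%N) / rho * (rho * rho ^+ k) * (k.+1%:R * k`!%:R) * M k.+1 =
     k.+1%:R * (C * rho ^+ k * k`!%:R * (M 0%N / M 1%N * M k.+1)).
    have h : rho != 0 by rewrite gt_eqF.
    have h' : M 1%N != 0 by rewrite gt_eqF.
    by field; rewrite h h'.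
  rewrite ler_wpM2l// ler_wpM2l ?log_convex_ratio//.
  by rewrite !mulr_ge0// ?exprn_ge0// ltW.
by apply: le_trans (lerD h1 h2) _; rewrite -!mulrDl.
Qed.

Lemma beurling_affine M g a b : beurling M g -> positive_seq M ->
  beurling M (fun k t => a ^+ k * g k (a * t + b)).
Proof.
move=> bg M0 rho rho0; have a0 : 0 < `|a| + 1 by rewrite ltr_wpDl.
have [C C0 HC] := bg (rho / (`|a| + 1)) (divr_gt0 rho0 a0); exists C => // k t.
rewrite normrM normrX.
apply: (@le_trans _ _ ((`|a| + 1) ^+ k * (C * (rho / (`|a| + 1)) ^+ k * k`!%:R * M k))).
  by apply: ler_pM => //; rewrite lerXn2r ?nnegrE ?(ltW a0)// lerDl.
rewrite expr_div_n le_eqVlt; apply/orP; left; apply/eqP.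
have h : (`|a| + 1) ^+ k != 0 by rewrite gt_eqF// exprn_gt0.
by field.
Qed.

Lemma beurling_sub M g g' : beurling M g -> beurling M g' ->
  beurling M (fun k t => g k t - g' k t).
Proof.
move=> bg bg' rho rho0; have [C C0 HC] := bg rho rho0; have [C' C'0 HC'] := bg' rho rho0.
exists (C + C'); first exact: addr_ge0.
by move=> k t; rewrite (le_trans (ler_normB _ _))// !mulrDl lerD.
Qed.

Definition plateau (g : nat -> R -> R) :=
  [/\ jet_on setT g, (forall t, 0 <= g 0%N t <= 1),
     (forall t, `|t| <= 1 -> g 0%N t = 1) & (forall k t, 2 < `|t| -> g k t = 0)].

Lemma beurling_plateau M : positive_seq M -> non_quasianalytic M ->
  exists2 g, plateau g & beurling M g.
Proof.
move=> M0 nq; have [P [J [P01 P0] P1 Pout bP]] := beurling_step M0 nq.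
pose g k t := 1 ^+ k * P k (1 * t + 2) - 1 ^+ k * P k (1 * t + - 1).
have g0 t : g 0%N t = P 0%N (t + 2) - P 0%N (t - 1) by rewrite /g expr0 !mul1r.
exists g; last by apply: beurling_sub; exact: beurling_affine.
split.
- by apply: jet_sub; [apply: jet_on_sub (@jet_affine R setT _ 1 2 J)|apply: jet_on_sub (@jet_affine R setT _ 1 (- 1) J)].
- move=> t; rewrite g0; have := P01 (t + 2); have := P01 (t - 1).
  have [h|h] := leP t (- 1).
    by rewrite (P0 (t - 1)); lra.
  by rewrite (P1 (t + 2)); lra.
- by move=> t; rewrite ler_norml g0 => H; rewrite P1 ?P0 ?subr0//; lra.
- move=> k t H; rewrite /g expr1n !mul1r.
  have {}H : t < -2 \/ 2 < t.
    move: H; have [t0|/ltW t0] := leP 0 t; [rewrite ger0_norm//|rewrite ler0_norm//]; lra.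
  case: k => [|k].
    case: H => H; first by rewrite !P0 ?subr0//; lra.
    by rewrite !P1 ?subrr//; lra.
  by rewrite !Pout ?subr0//; case: H; lra.
Qed.

End Beurling.

(** * Smoothness from bounds on pure differences *)

Section Polarization.
Variables (R : realType) (V : normedModType R).
Implicit Types (f g : V -> R) (v w x y z : V) (vs : seq V).

Fixpoint pol vs (j : nat) (F : V -> V -> R) (a b : V) : R :=
  if vs is v :: vs' then
    pol vs' j.+1 F a b - pol vs' j.+1 F (a - j%:R^-1 *: v) (b + v)
  else F a b.

Fixpoint scl (k j : nat) vs : seq V :=
  if vs is v :: vs' then (1 - k%:R / j%:R) *: v :: scl k j.+1 vs' else [::].

Lemma pol_sum vs j n (c : nat -> R) (F : nat -> V -> V -> R) a b :
  pol vs j (fun a b => \sum_(k < n) c k * F k a b) a b =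
  \sum_(k < n) c k * pol vs j (F k) a b.
Proof.
elim: vs j a b => //= v vs IH j a b; rewrite !IH -sumrB.
by apply: eq_bigr => k _; rewrite mulrBr.
Qed.

Lemma pol_scl vs j k f a b :
  pol vs j (fun a b => f (b + a *+ k)) a b = (-1) ^+ size vs * mfd (scl k j vs) f (b + a *+ k).
Proof.
elim: vs j a b => [|v vs IH] j a b /=; first by rewrite expr0 mul1r.
rewrite !IH exprS mulN1r mulNr -mulrBr -mulrN opprB; congr (_ * (_ - mfd _ _ _)).
rewrite mulrnBl scalerBl scale1r scalerMnl -[j%:R^-1 *+ k]mulr_natl.
by rewrite -!addrA; congr (_ + _); rewrite addrCA.
Qed.

Lemma mfd_zero vs f z : 0 \in vs -> mfd vs f z = 0.
Proof.
elim: vs z => // v vs IH z; rewrite inE => /orP[/eqP <-|vs0] /=; first by rewrite addr0 subrr.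
by rewrite !IH// subrr.
Qed.

Lemma scl_zero k j vs : (0 < j)%N -> (j <= k < j + size vs)%N -> 0 \in scl k j vs.
Proof.
elim: vs j => [|v vs IH] j j0 /=; first by rewrite addn0; case: leqP.
move=> /andP[jk kj]; rewrite inE; have [->|jk'] := eqVneq j k.
  by rewrite divff ?subrr ?scale0r ?eqxx// pnatr_eq0 -lt0n (leq_trans j0 jk).
by rewrite IH ?orbT// addSnnS kj ltn_neqAle jk' jk.
Qed.

Lemma scl0 j vs : scl 0 j vs = vs.
Proof. by elim: vs j => //= v vs IH j; rewrite mul0r subr0 scale1r IH. Qed.

(* Djokovic's identity: a mixed difference of order m is an alternating sum of
   pure differences of order m; all terms f (b + k a) with 1 <= k <= m cancel
   since they are mixed differences with one zero increment. *)
Lemma mfd_pol vs f x :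
  mfd vs f x = pol vs 1 (fun a b => mfd (nseq (size vs) a) f b) 0 x.
Proof.
have -> : (fun a b => mfd (nseq (size vs) a) f b) =
  fun a b => \sum_(k < (size vs).+1) bcoef R (size vs) k * f (b + a *+ k).
  by apply/funext => a; apply/funext => b; rewrite mfd_nseq.
rewrite (pol_sum vs 1 _ (bcoef R (size vs)) (fun k a b => f (b + a *+ k))).
rewrite big_ord_recl big1 ?addr0 => [|k _].
  rewrite pol_scl mul0rn addr0 scl0 /bcoef subn0 bin0 mulr1 mulrA -exprD -signr_odd.
  by rewrite oddD addbb expr0 mul1r.
rewrite pol_scl mfd_zero ?mulr0//; apply: scl_zero => //=.
by rewrite /bump leq0n add1n ltnS ltn_ord.
Qed.

Lemma pol_le vs j F a b (rho C : R) : (0 < j)%N -> 0 <= rho ->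
  (forall v, v \in vs -> `|v| <= rho) ->
  (forall a' b', `|a' - a| <= rho *+ size vs -> `|b' - b| <= rho *+ size vs -> `|F a' b'| <= C) ->
  `|pol vs j F a b| <= 2 ^+ size vs * C.
Proof.
elim: vs j a b => [|v vs IH] j a b j0 rho0 H HF.
  by rewrite expr0 mul1r; apply: HF; rewrite subrr normr0.
have Hv : `|v| <= rho by apply: H; rewrite mem_head.
have Hvs w : w \in vs -> `|w| <= rho by move=> wv; apply: H; rewrite inE wv orbT.
rewrite /= exprS mulrDl mul1r mulrDl (le_trans (ler_normB _ _))// lerD//.
  apply: IH => // a' b' h1 h2; apply: HF.
    by rewrite (le_trans h1)// ler_wpMn2l//=.
  by rewrite (le_trans h2)// ler_wpMn2l//=.
apply: IH => // a' b' h1 h2; apply: HF; rewrite /= mulrS.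
  have -> : a' - a = (a' - (a - j%:R^-1 *: v)) - j%:R^-1 *: v.
    by rewrite opprB addrA addrAC addrK.
  rewrite (le_trans (ler_normB _ _))// addrC lerD//.
  rewrite normrZ (le_trans _ Hv)// ler_piMl//.
  by rewrite normfV normr_nat invf_le1 ?ltr0n// ler1n.
have -> : b' - b = (b' - (b + v)) + v by rewrite opprD addrA subrK.
by rewrite (le_trans (ler_normD _ _))// addrC lerD.
Qed.

Lemma polar_le vs f x (rho C : R) : 0 <= rho -> 0 <= C ->
  (forall v, v \in vs -> `|v| <= rho) ->
  (forall w y, `|w| <= rho *+ size vs -> `|y - x| <= rho *+ size vs ->
     `|mfd (nseq (size vs) w) f y| <= C * `|w| ^+ size vs) ->
  `|mfd vs f x| <= 2 ^+ size vs * (C * (rho *+ size vs) ^+ size vs).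
Proof.
move=> rho0 C0 H HF; rewrite mfd_pol; apply: (pol_le (rho := rho)) => //= a b.
rewrite subr0 => h1 h2; apply: le_trans (HF _ _ h1 h2) _.
by rewrite ler_wpM2l// lerXn2r ?nnegrE// mulrn_wge0.
Qed.

Lemma mfd_mulrn N v vs f z :
  mfd (v *+ N :: vs) f z = \sum_(i < N) mfd (v :: vs) f (z + v *+ i).
Proof.
elim: N => [|N IH]; first by rewrite big_ord0 /= mulr0n addr0 subrr.
by rewrite big_ord_recr /= -IH /= mulrSr addrA; ring.
Qed.

Lemma mfd_move v bs ss f z : mfd (v :: bs ++ ss) f z = mfd (bs ++ v :: ss) f z.
Proof.
elim: bs z => // b bs IH z; rewrite [LHS]mfd_swap.
change (mfd (v :: bs ++ ss) f (z + b) - mfd (v :: bs ++ ss) f z =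
  mfd (bs ++ v :: ss) f (z + b) - mfd (bs ++ v :: ss) f z).
by rewrite !IH.
Qed.

Definition nsum vs : R := \sum_(v <- vs) `|v|.
Definition nprod vs : R := \prod_(v <- vs) `|v|.

Lemma nsum_ge0 vs : 0 <= nsum vs. Proof. exact: sumr_ge0. Qed.
Lemma nprod_ge0 vs : 0 <= nprod vs. Proof. by apply: prodr_ge0. Qed.

Lemma mfd_subdivide f x0 (T K rho : R) m bs ss z : 0 < rho -> 0 <= K ->
  (forall ss z, size ss = m -> (forall s, s \in ss -> `|s| <= rho) ->
     `|z - x0| <= T -> `|mfd ss f z| <= K * rho ^+ m) ->
  (size bs + size ss)%N = m -> (forall s, s \in ss -> `|s| <= rho) ->
  `|z - x0| + nsum bs <= T ->
  `|mfd (bs ++ ss) f z| <= K * rho ^+ size ss * \prod_(b <- bs) (`|b| + rho).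
Proof.
move=> rho0 K0 H; elim: bs ss z => [|b bs IH] ss z /= sz Hss zT.
  by move: sz; rewrite add0n => sz; rewrite big_nil mulr1 sz; apply: H => //; move: zT; rewrite /nsum big_nil addr0.
have P0 : 0 <= \prod_(b <- bs) (`|b| + rho) by apply: prodr_ge0 => i _; rewrite addr_ge0// ltW.
pose N := (Num.truncn (`|b| / rho)).+1.
have /andP[N1 N2] : N.-1%:R <= `|b| / rho < N%:R by exact/truncn_itv/divr_ge0/ltW.
have N0 : 0 < N%:R :> R by rewrite ltr0n.
have bN : `|b| < N%:R * rho by rewrite -ltr_pdivrMr.
have Nb : N%:R * rho <= `|b| + rho.
  by rewrite mulrSr mulrDl mul1r lerD2r -ler_pdivlMr.
pose c := N%:R^-1 *: b.
have bc : b = c *+ N by rewrite /c -scaler_nat scalerA divff ?scale1r// gt_eqF.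
have cn : `|c| <= rho.
  by rewrite /c normrZ gtr0_norm ?invr_gt0// ler_pdivrMl// ltW.
have cN i : (i <= N)%N -> `|c *+ i| <= `|b|.
  move=> iN; rewrite bc -scaler_nat -[c *+ N]scaler_nat !normrZ ler_wpM2r//.
  by rewrite !normr_nat ler_nat.
have E : mfd (b :: bs ++ ss) f z = mfd (c *+ N :: bs ++ ss) f z by rewrite -bc.
change (`|mfd (b :: bs ++ ss) f z| <=
  K * rho ^+ size ss * \prod_(b0 <- b :: bs) (`|b0| + rho)).
rewrite E mfd_mulrn (le_trans (ler_norm_sum _ _ _))// big_cons.
apply: (@le_trans _ _ (\sum_(i < N) K * rho ^+ (size ss).+1 * \prod_(b <- bs) (`|b| + rho))).
  apply: ler_sum => i _; rewrite mfd_move; apply: (IH (c :: ss)).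
  - by rewrite /= addnS -addSn.
  - by move=> s; rewrite inE => /orP[/eqP -> //|]; exact: Hss.
  - apply: le_trans zT; rewrite /nsum big_cons addrA lerD2r.
    rewrite addrAC (le_trans (ler_normD _ _))// lerD2l cN//; exact: ltnW.
rewrite sumr_const card_ord -mulr_natl.
have -> : N%:R * (K * rho ^+ (size ss).+1 * \prod_(b0 <- bs) (`|b0| + rho)) =
  N%:R * rho * (K * rho ^+ (size ss) * \prod_(b0 <- bs) (`|b0| + rho)) by rewrite exprS; ring.
have -> : K * rho ^+ size ss * ((`|b| + rho) * \prod_(j <- bs) (`|j| + rho)) =
   (`|b| + rho) * (K * rho ^+ (size ss) * \prod_(b0 <- bs) (`|b0| + rho)) by ring.
by apply: ler_wpM2r => //; rewrite !mulr_ge0// exprn_ge0// ltW.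
Qed.

Lemma min_norm_gt0 vs (s : R) : 0 \notin vs -> 0 < s ->
  exists rho : R, [/\ 0 < rho, rho <= s & forall v, v \in vs -> rho <= `|v|].
Proof.
move=> + s0; elim: vs => [|v vs IH]; first by exists s.
rewrite inE negb_or => /andP[v0 vs0]; have [rho [h1 h2 h3]] := IH vs0.
exists (Num.min rho `|v|); split.
- by rewrite lt_min h1 normr_gt0 eq_sym.
- by rewrite ge_min h2.
- by move=> w; rewrite inE ge_min => /orP[/eqP ->|/h3 ->]//; rewrite lexx orbT.
Qed.

Definition pure_at f x0 m (r C : R) :=
  forall y w, `|y - x0| + `|w| *+ m < r -> `|mfd (nseq m w) f y| <= C * `|w| ^+ m.

Definition mixed_at f x0 m (r K : R) :=
  forall vs z, size vs = m -> `|z - x0| + nsum vs < r -> `|mfd vs f z| <= K * nprod vs.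

Definition polcst m (C : R) := 4 ^+ m * m%:R ^+ m * C.

Lemma pure_mixed f x0 m (r C : R) : 0 <= C ->
  pure_at f x0 m r C -> mixed_at f x0 m r (polcst m C).
Proof.
move=> C0 H vs z sz zr.
have [vs0|vs0] := boolP (0 \in vs).
  rewrite mfd_zero// normr0 mulr_ge0 ?nprod_ge0//.
  by rewrite /polcst !mulr_ge0// exprn_ge0.
pose s := (r - (`|z - x0| + nsum vs)) / (m.+1%:R ^+ 2 * 2).
have m0 : 0 < m.+1%:R ^+ 2 * 2 :> R by rewrite mulr_gt0// exprn_gt0// ltr0n.
have s0 : 0 < s by rewrite divr_gt0// subr_gt0.
have [rho [rho0 rhos rhovs]] := min_norm_gt0 vs0 s0.
pose T := `|z - x0| + nsum vs.
pose K := 2 ^+ m * (C * m%:R ^+ m).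
have K0 : 0 <= K by rewrite !mulr_ge0// exprn_ge0.
have small ss y : size ss = m -> (forall s, s \in ss -> `|s| <= rho) ->
     `|y - x0| <= T -> `|mfd ss f y| <= K * rho ^+ m.
  move=> sm Hs yT; have := @polar_le ss f y rho C (ltW rho0) C0 Hs.
  rewrite sm => /(_ _)/le_trans; apply.
    move=> w y' wr yr; apply: H.
    have h1 : `|y' - x0| <= rho *+ m + T.
      by rewrite -[y' - x0](subrKA y) (le_trans (ler_normD _ _))// lerD.
    have h2 : `|w| *+ m <= rho *+ m *+ m by rewrite lerMn2r wr orbT.
    apply: le_lt_trans (lerD h1 h2) _.
    have h3 : rho *+ m + rho *+ m *+ m <= rho * m.+1%:R ^+ 2.
      rewrite -[rho *+ m *+ m]mulr_natr -[rho *+ m]mulr_natr -mulrA -mulrDr ler_pM2l// -natr1.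
      have : 0 <= m%:R :> R by [].
      by move: (m%:R : R) => q q0; nra.
    have h4 : rho * m.+1%:R ^+ 2 < r - T.
      have : rho * (m.+1%:R ^+ 2 * 2) <= r - T by rewrite -ler_pdivlMr.
      rewrite mulrA => h; apply: lt_le_trans h.
      by rewrite ltr_pMr ?ltr1n// mulr_gt0// exprn_gt0// ltr0n.
    by move: h3 h4; lra.
  by rewrite /K -[rho *+ m]mulr_natr exprMn le_eqVlt; apply/orP; left; apply/eqP; ring.
have := @mfd_subdivide f x0 T K rho m vs [::] z rho0 K0 small.
rewrite /= addn0 cats0 expr0 mulr1 => /(_ sz (fun _ h => match notF h with end) (lexx _)).
move/le_trans; apply.
have : \prod_(b <- vs) (`|b| + rho) <= 2 ^+ m * nprod vs.
  rewrite -sz /nprod; elim: vs rhovs {vs0 sz zr T small s s0 rhos} => [|v vs IH] rv; first by rewrite !big_nil expr0 mulr1.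
  rewrite !big_cons /= exprS mulrACA; apply: ler_pM.
  - by rewrite addr_ge0// ltW.
  - by apply: prodr_ge0 => i _; rewrite addr_ge0// ltW.
  - by rewrite mulrDl mul1r lerD2l rv// mem_head.
  - by apply: IH => w wv; apply: rv; rewrite inE wv orbT.
move/(ler_wpM2l K0)/le_trans; apply.
rewrite /K /polcst le_eqVlt; apply/orP; left; apply/eqP.
have -> : (4 : R) ^+ m = 2 ^+ m * 2 ^+ m by rewrite -exprMn -natrM.
ring.
Qed.

End Polarization.

Section SmoothFromDifferences.
Variables (R : realType).

Lemma geometric_half_cvg (C : R) :
  series (fun n => C * 2^-1 ^+ n) @ \oo --> C * 2.
Proof.
have := @cvg_geometric_series R C 2^-1; rewrite gtr0_norm ?invr_gt0// invf_lt1//.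
rewrite ltr1n => /(_ isT); have -> : (1 - 2^-1 : R)^-1 = 2 by rewrite -[1 - _]/(_ : R); field.
by [].
Qed.

Lemma geom_cvg (q : nat -> R) (C : R) : (forall n, `|q n.+1 - q n| <= C * 2^-1 ^+ n) ->
  q @ \oo --> limn q /\ `|limn q - q 0%N| <= C * 2.
Proof.
move=> H; have gc := @geometric_half_cvg C.
have [|cv bd] := @cvg_series_bound R (fun n => q n.+1 - q n) (fun n => C * 2^-1 ^+ n) _ H.
  by apply/cvg_ex; exists (C * 2).
rewrite (cvg_lim _ gc)// in bd.
have E : q = fun n => q 0%N + series (fun n => q n.+1 - q n) n.
  apply/funext; elim=> [|n IH]; first by rewrite /series/= big_geq// addr0.
  by rewrite seriesSr addrA -IH; ring.
have C1 : q @ \oo --> q 0%N + limn (series (fun n => q n.+1 - q n)).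
  by rewrite {1}E; apply: cvgD; [exact: cvg_cst|exact: cv].
have L : limn q = q 0%N + limn (series (fun n => q n.+1 - q n)) by exact: cvg_lim.
by rewrite L; split=> //; rewrite addrC addKr.
Qed.

Lemma half_pow_lt (a e : R) : 0 < e -> exists N, forall n, (N <= n)%N -> a * 2^-1 ^+ n < e.
Proof.
move=> e0; have : (fun n => a * 2^-1 ^+ n) @ \oo --> a * 0.
  apply: cvgM; first exact: cvg_cst.
  by apply: cvg_expr; rewrite gtr0_norm ?invr_gt0// invf_lt1// ltr1n.
rewrite mulr0 => /cvgrPdist_lt /(_ e e0)[N _ HN]; exists N => n Nn.
by have := HN n Nn; rewrite /= sub0r normrN; apply: le_lt_trans; exact: ler_norm.
Qed.

Lemma additive_bounded_linear (V : normedModType R) (l : V -> R) (K : R) :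
  (forall v w, l (v + w) = l v + l w) -> (forall v, `|l v| <= K * `|v|) ->
  forall c v, l (c *: v) = c * l v.
Proof.
move=> lD lB c v.
have l0 : l 0 = 0 by have := lD 0 0; rewrite addr0; lra.
have ln n w : l (w *+ n) = l w *+ n.
  by elim: n => [|n IH]; [rewrite !mulr0n|rewrite !mulrS lD IH].
have lN w : l (- w) = - l w by have := lD w (- w); rewrite subrr l0; lra.
pose g c := l (c *: v) - c * l v.
have gD a b : g (a + b) = g a + g b by rewrite /g scalerDl lD; ring.
have gn n a : g (a *+ n) = g a *+ n.
  by rewrite /g -scalerMnl ln mulrnAl -mulrnBl.
have g1 n : g n%:R = 0 by rewrite gn /g scale1r mul1r subrr mul0rn.
have gN a : g (- a) = - g a by rewrite /g scaleNr lN; ring.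
have K0 : 0 <= K * `|v| by exact: le_trans (lB v).
have gb a : `|g a| <= 2 * (K * `|v|).
  have [n [b [ab b1]]] : exists n, exists b : R, (`|a| = n%:R + b) /\ 0 <= b <= 1.
    exists (Num.truncn `|a|), (`|a| - (Num.truncn `|a|)%:R); split; first by rewrite addrC subrK.
    by have /andP[h1 h2] := truncn_itv (normr_ge0 a); move: h1 h2; rewrite -natr1; lra.
  have -> : `|g a| = `|g `|a| |.
    by have [a0|a0] := leP 0 a; [rewrite [`|a| ]ger0_norm//|rewrite [`|a| ]ltr0_norm// gN normrN].
  rewrite ab gD g1 add0r /g (le_trans (ler_normB _ _))// mulrDl mul1r.
  have [b0 b1'] := andP b1.
  apply: lerD.
    rewrite (le_trans (lB _))// normrZ (ger0_norm b0) mulrCA -[leRHS]mul1r ler_wpM2r//.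
  by rewrite normrM (ger0_norm b0) (le_trans _ (lB v))// -[leRHS]mul1r ler_wpM2r.
apply/eqP; rewrite -subr_eq0 -normr_le0 -/(g c); apply/ler_addgt0Pl => e e0; rewrite addr0.
pose N := (Num.truncn (2 * (K * `|v|) / e)).+1.
have N1 : 2 * (K * `|v|) / e < N%:R.
  by have /andP[] := truncn_itv (divr_ge0 (mulr_ge0 (ler0n R 2) K0) (ltW e0)).
have N0 : 0 < N%:R :> R by rewrite ltr0n.
have := gb (c *+ N); rewrite gn normrMn => h.
rewrite ltr_pdivrMr// in N1.
have {}h : `|g c| * N%:R <= e * N%:R by rewrite mulr_natr (le_trans h)// [leRHS]mulrC ltW.
by rewrite ler_pM2r in h.
Qed.

Section Differential.
Variables (V : normedModType R).
Implicit Types (f g : V -> R) (v w x y z : V) (vs : seq V).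

Definition dquot f z v (n : nat) : R := 2 ^+ n * (f (z + 2^-1 ^+ n *: v) - f z).

(* [l v] is the limit of the dyadic difference quotients: bounds on second
   differences make them Cauchy and additive in [v] in the limit. *)
Lemma mixed_diff f x (r K1 K2 : R) : 0 < r ->
  mixed_at f x 1 r K1 -> mixed_at f x 2 r K2 ->
  exists l : {linear V -> R}, [/\ forall v, `|l v| <= K1 * `|v|,
    forall v, `|v| < r -> `|f (x + v) - f x - l v| <= K2 * `|v| ^+ 2 &
    forall v, dquot f x v @ \oo --> l v].
Proof.
move=> r0 H1 H2.
have h1 z v : `|z - x| + `|v| < r -> `|f (z + v) - f z| <= K1 * `|v|.
  move=> h; have := H1 [:: v] z erefl.
  by rewrite /nsum /nprod !big_cons !big_nil addr0 mulr1; apply.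
have h2 z v w : `|z - x| + `|v| + `|w| < r ->
    `|f (z + v + w) - f (z + v) - (f (z + w) - f z)| <= K2 * (`|v| * `|w|).
  move=> h; have := H2 [:: v; w] z erefl.
  by rewrite /nsum /nprod !big_cons !big_nil addr0 mulr1 addrA; apply.
have pn n : (0 : R) < 2^-1 ^+ n by rewrite exprn_gt0// invr_gt0.
have p2 n : (0 : R) < 2 ^+ n by rewrite exprn_gt0.
have p22 n : (2 : R) ^+ n * 2^-1 ^+ n = 1 by rewrite -exprMn divff ?expr1n.
have nrm n v : `|2^-1 ^+ n *: v| = `|v| * 2^-1 ^+ n.
  by rewrite normrZ (gtr0_norm (pn n)) mulrC.
have step v n : `|v| * 2^-1 ^+ n < r ->
    `|dquot f x v n.+1 - dquot f x v n| <= K2 * `|v| ^+ 2 * 2^-1 * 2^-1 ^+ n * 2^-1.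
  move=> vr; set u := 2^-1 ^+ n.+1 *: v.
  have uu : 2^-1 ^+ n *: v = u + u.
    by rewrite -scalerDl exprS -mulrDl; congr (_ *: _); field.
  have -> : dquot f x v n.+1 - dquot f x v n =
     - 2 ^+ n * (f (x + u + u) - f (x + u) - (f (x + u) - f x)).
    by rewrite /dquot -/u uu addrA exprS; ring.
  rewrite normrM normrN (gtr0_norm (p2 n)).
  have nu : `|u| = `|v| * 2^-1 ^+ n * 2^-1 by rewrite nrm exprSr mulrA.
  have := h2 x u u; rewrite subrr normr0 add0r => /(_ _)/(ler_wpM2l (ltW (p2 n)))/le_trans.
  apply; first by rewrite nu; move: vr; lra.
  rewrite nu le_eqVlt; apply/orP; left; apply/eqP.
  by have := p22 n; move: (2 ^+ n) (2^-1 ^+ n) => p q pq; ring: pq.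
have cvq v : dquot f x v @ \oo --> limn (dquot f x v).
  have [N HN] := half_pow_lt `|v| r0.
  have [|cv _] := @geom_cvg (fun n => dquot f x v (n + N)) (K2 * `|v| ^+ 2 * 2^-1 * 2^-1 ^+ N * 2^-1).
    move=> n; rewrite addSn; apply: le_trans (step v (n + N)%N _) _.
      by apply: HN; rewrite leq_addl.
    by rewrite exprD le_eqVlt; apply/orP; left; apply/eqP; ring.
  have {}cv : dquot f x v @ \oo --> limn (fun n => dquot f x v (n + N)) by rewrite -(cvg_shiftn N).
  exact: (cvgP _ cv).
pose l v := limn (dquot f x v).
have lB v : `|l v| <= K1 * `|v|.
  have [N HN] := half_pow_lt `|v| r0.
  have := cvq v; rewrite -(cvg_shiftn N) => /cvgn_norm_le; apply => n.
  rewrite /= /dquot normrM (gtr0_norm (p2 _)).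
  have := h1 x (2^-1 ^+ (n + N) *: v); rewrite subrr normr0 add0r nrm => /(_ _).
  move/(_ (HN _ (leq_addl _ _)))/(ler_wpM2l (ltW (p2 (n + N)%N)))/le_trans; apply.
  rewrite le_eqVlt; apply/orP; left; apply/eqP.
  by have := p22 (n + N)%N; move: (2 ^+ _) (2^-1 ^+ _) => p q pq; ring: pq.
have lD v w : l (v + w) = l v + l w.
  apply/eqP; rewrite -subr_eq0 -normr_le0.
  have C : (fun n => dquot f x (v + w) n - (dquot f x v n + dquot f x w n)) @ \oo -->
     l (v + w) - (l v + l w) by apply: cvgB; [exact: cvq|apply: cvgD; exact: cvq].
  apply/ler_addgt0Pl => e e0; rewrite addr0.
  have [N1 HN1] := half_pow_lt (`|v| + `|w|) r0.
  have [N2 HN2] := half_pow_lt (K2 * (`|v| * `|w|)) e0.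
  move: C; rewrite -(cvg_shiftn (N1 + N2)) => /cvgn_norm_le; apply => n.
  rewrite /=; set k := (n + (N1 + N2))%N.
  have -> : dquot f x (v + w) k - (dquot f x v k + dquot f x w k) = 2 ^+ k *
     (f (x + 2^-1 ^+ k *: v + 2^-1 ^+ k *: w) - f (x + 2^-1 ^+ k *: v) -
       (f (x + 2^-1 ^+ k *: w) - f x)).
    by rewrite /dquot scalerDr addrA; ring.
  rewrite normrM (gtr0_norm (p2 _)).
  have := h2 x (2^-1 ^+ k *: v) (2^-1 ^+ k *: w); rewrite subrr normr0 add0r !nrm -mulrDl => /(_ _).
  have kN1 : (N1 <= k)%N by rewrite /k addnCA leq_addr.
  have kN2 : (N2 <= k)%N by rewrite /k addnA leq_addl.
  move/(_ (HN1 _ kN1))/(ler_wpM2l (ltW (p2 k)))/le_trans; apply.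
  apply: le_trans (ltW (HN2 k kN2)).
  rewrite le_eqVlt; apply/orP; left; apply/eqP.
  by have := p22 k; move: (2 ^+ _) (2^-1 ^+ _) => p q pq; ring: pq.
have lZ := additive_bounded_linear lD lB.
have lin : linear (l : V -> R^o) by move=> c v w; rewrite lD lZ.
pose L : {linear V -> R} := HB.pack (l : V -> R^o) (GRing.isLinear.Build R V R^o _ _ lin).
exists L; split => // v vr.
have [|_] := @geom_cvg (dquot f x v) (K2 * `|v| ^+ 2 * 2^-1).
  move=> n; apply: le_trans (step v n _) _.
    by rewrite (le_lt_trans _ vr)// ler_piMr// exprn_ile1// ?invr_ge0// invf_le1// ler1n.
  have P : 0 <= K2 * `|v| ^+ 2 * 2^-1 * 2^-1 ^+ n.
    apply: mulr_ge0; last exact: ltW.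
    apply: mulr_ge0; last by rewrite invr_ge0.
    have [->|v0] := eqVneq v 0; first by rewrite normr0 expr0n/= mulr0.
    rewrite mulr_ge0// ?exprn_ge0//.
    have [N HN] := half_pow_lt `|v| (divr_gt0 r0 (ltr0Sn R 1)).
    have := h2 x (2^-1 ^+ N *: v) (2^-1 ^+ N *: v); rewrite subrr normr0 add0r nrm.
    have HNN := HN N (leqnn N) => /(_ _).
    have hh : `|v| * 2^-1 ^+ N + `|v| * 2^-1 ^+ N < r by move: HNN; lra.
    move/(_ hh)/(le_trans (normr_ge0 _)); rewrite pmulr_lge0//.
    by rewrite mulr_gt0// mulr_gt0 ?normr_gt0.
  by move: P; lra.
rewrite {2}/dquot !expr0 scale1r mul1r -[limn _]/(l v) distrC => /le_trans; apply.
by rewrite -mulrA mulVf ?mulr1.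
Qed.

End Differential.
End SmoothFromDifferences.

Section MixedClass.
Variables (R : realType) (V : normedModType R).
Implicit Types (f g : V -> R) (v w x y z : V) (vs : seq V) (U : set V).

Lemma quad_differentiable f x (l : {linear V -> R}) (r K1 K2 : R) : 0 < r ->
  (forall v, `|l v| <= K1 * `|v|) ->
  (forall v, `|v| < r -> `|f (x + v) - f x - l v| <= K2 * `|v| ^+ 2) ->
  differentiable f x /\ forall v, 'D_v f x = l v.
Proof.
move=> r0 H1 H2.
have cl : continuous l.
  move=> v; apply/cvgrPdist_lt => e e0; near=> w.
  rewrite -linearB (le_lt_trans (H1 _))//.
  have K0 : 0 < `|K1| + 1 by rewrite ltr_wpDl.
  apply: (@le_lt_trans _ _ ((`|K1| + 1) * `|v - w|)).
    by rewrite ler_wpM2r// (le_trans (ler_norm _))// lerDl.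
  rewrite -ltr_pdivlMl// mulrC; near: w.
  apply/nbhs_ballP; exists (e / (`|K1| + 1)); first by rewrite /= divr_gt0.
  by move=> w; rewrite -ball_normE.
have o : f \o shift x = cst (f x) + l +o_ 0 id.
  apply/eqaddoP => e e0; near=> v.
  have vr : `|v| < r by near: v; exact: nbhs0_lt.
  have -> : (f \o shift x - (cst (f x) + l)) v = f (x + v) - f x - l v.
    by rewrite /= /cst /shift !fctE opprD addrA addrC [v + x]addrC [- l v + _]addrC.
  rewrite (le_trans (H2 v vr))// expr2 mulrA ler_wpM2r//.
  have K0 : 0 < `|K2| + 1 by rewrite ltr_wpDl.
  apply: (@le_trans _ _ ((`|K2| + 1) * `|v|)).
    by rewrite ler_wpM2r// (le_trans (ler_norm _))// lerDl.
  rewrite -ler_pdivlMl// mulrC; near: v; apply: nbhs0_le; exact: divr_gt0.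
have E : 'd f x = l :> (V -> R) by exact: diff_unique.
have df : differentiable f x by apply/diff_locallyP; rewrite E.
by split=> // v; rewrite deriveE// E.
Unshelve. all: by end_near. Qed.

Definition mixed_loc U f := forall x, U x -> forall m, exists r K,
  0 < r /\ mixed_at f x m r K.

Lemma mixed_at_le f x m (r r' K : R) : r' <= r -> mixed_at f x m r K -> mixed_at f x m r' K.
Proof. by move=> rr H vs z sz h; apply: H => //; exact: lt_le_trans rr. Qed.

Lemma mixed_loc_diff U f x : mixed_loc U f -> U x ->
  differentiable f x /\ forall v, dquot f x v @ \oo --> 'D_v f x.
Proof.
move=> H Ux; have [r1 [K1 [r10 h1]]] := H x Ux 1%N; have [r2 [K2 [r20 h2]]] := H x Ux 2%N.
have r0 : 0 < Num.min r1 r2 by rewrite lt_min r10.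
have le1 : Num.min r1 r2 <= r1 by rewrite ge_min lexx.
have le2 : Num.min r1 r2 <= r2 by rewrite ge_min lexx orbT.
have [l [b1 b2 b3]] := mixed_diff r0 (mixed_at_le le1 h1) (mixed_at_le le2 h2).
have [df E] := quad_differentiable r0 b1 b2.
by split=> // v; rewrite E.
Qed.

Lemma mfd_cvg vs (g_ : nat -> V -> R) g z :
  (forall y, `|y - z| <= nsum vs -> (fun n => g_ n y) @ \oo --> g y) ->
  (fun n => mfd vs (g_ n) z) @ \oo --> mfd vs g z.
Proof.
elim: vs z => [|v vs IH] z H /=; first by apply: H; rewrite subrr normr0 nsum_ge0.
apply: cvgB; apply: IH => y h; apply: H; rewrite /nsum big_cons.
  have -> : y - z = v + (y - (z + v)) by rewrite [RHS]addrC opprD addrA subrK.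
  by rewrite (le_trans (ler_normD _ _))// lerD2l.
by rewrite (le_trans h)// lerDr.
Qed.

Lemma mixed_at_derive U f v x m (r K : R) : open U -> mixed_loc U f -> U x -> 0 < r ->
  mixed_at f x m.+1 r K ->
  exists2 r', 0 < r' & mixed_at ('D_v f) x m r' (K * `|v|).
Proof.
move=> oU H Ux r0 Hm.
have /nbhs_ballP[s /= s0 sU] : nbhs x U by exact: open_nbhs_nbhs.
exists (Num.min r s); first by rewrite lt_min r0.
move=> vs z sz; rewrite lt_min => /andP[zr zs].
have C : (fun n => mfd vs (fun y => dquot f y v n) z) @ \oo --> mfd vs ('D_v f) z.
  apply: mfd_cvg => y yz; apply: (mixed_loc_diff H _).2; apply: sU.
  rewrite -ball_normE /= distrC -[y - x](subrKA z) (le_lt_trans (ler_normD _ _))//.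
  by rewrite (le_lt_trans _ zs)// addrC lerD2l.
have [N HN] : exists N, forall n, (N <= n)%N -> `|v| * 2^-1 ^+ n < r - (`|z - x| + nsum vs).
  by apply: half_pow_lt; rewrite subr_gt0.
move: C; rewrite -(cvg_shiftn N) => /cvgn_norm_le; apply => n /=.
set k := (n + N)%N.
have -> : mfd vs (fun y => dquot f y v k) z = 2 ^+ k * mfd (2^-1 ^+ k *: v :: vs) f z.
  by rewrite /dquot mfd_scale mfd_rcons.
have pk : (0 : R) < 2 ^+ k by rewrite exprn_gt0.
have qk : (0 : R) < 2^-1 ^+ k by rewrite exprn_gt0// invr_gt0.
rewrite normrM (gtr0_norm pk).
have := Hm (2^-1 ^+ k *: v :: vs) z; rewrite /= sz => /(_ erefl).
rewrite /nsum /nprod !big_cons normrZ (gtr0_norm qk) -/(nsum vs) -/(nprod vs).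
have := HN k (leq_addl _ _) => h /(_ _)/(ler_wpM2l (ltW pk))/le_trans; apply.
  by rewrite [2^-1 ^+ k * _]mulrC; move: h; lra.
rewrite le_eqVlt; apply/orP; left; apply/eqP.
have := divff (lt0r_neq0 pk); rewrite -exprVn; move: (2 ^+ k) (2^-1 ^+ k) => p q pq.
by ring: pq.
Qed.

Lemma mixed_loc_derive U f v : open U -> mixed_loc U f -> mixed_loc U ('D_v f).
Proof.
move=> oU H x Ux m; have [r [K [r0 h]]] := H x Ux m.+1.
have [r' r'0 h'] := mixed_at_derive v oU H Ux r0 h.
by exists r', (K * `|v|).
Qed.

Definition derivs vs f : V -> R := foldr (fun v g => 'D_v g) f vs.

Lemma mixed_loc_derivs U f vs : open U -> mixed_loc U f -> mixed_loc U (derivs vs f).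
Proof. by move=> oU H; elim: vs => //= v vs IH; exact: mixed_loc_derive. Qed.

Lemma derivs_le U f x vs (r K : R) : open U -> mixed_loc U f -> U x -> 0 < r ->
  mixed_at f x (size vs) r K -> `|derivs vs f x| <= K * nprod vs.
Proof.
move=> oU H Ux r0; rewrite -[size vs]addn0 => hm.
suff [r' r'0 h'] : exists2 r', 0 < r' & mixed_at (derivs vs f) x 0 r' (K * nprod vs).
  have := h' [::] x erefl; rewrite /nsum /nprod !big_nil mulr1 subrr normr0 addr0; exact.
elim: vs 0%N hm => [|v vs IH] m hm.
  by exists r => //; rewrite /nprod big_nil mulr1.
rewrite /= addSnnS in hm; have [r1 r10 h1] := IH _ hm.
have [r2 r20 h2] := mixed_at_derive v oU (mixed_loc_derivs vs oU H) Ux r10 h1.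
by exists r2 => //; rewrite /nprod big_cons [`|v| * _]mulrC mulrA.
Qed.

Lemma is_derive_line g y v (t l : R) : is_derive (y + t *: v) v g l ->
  is_derive t 1 (fun s => g (y + s *: v)) l.
Proof.
have E : (fun h : R => h^-1 *: (((fun s => g (y + s *: v)) \o shift t) (h *: 1) - g (y + t *: v))) =
   (fun h : R => h^-1 *: ((g \o shift (y + t *: v)) (h *: v) - g (y + t *: v))).
  by apply/funext => h; rewrite /= /shift [h *: 1]mulr1 scalerDl addrCA.
by move=> [h1 h2]; split; rewrite /derivable /derive /= E.
Qed.

Lemma derivs_line U f vs y v (t : R) : open U -> mixed_loc U f -> U (y + t *: v) ->
  is_derive t 1 (fun s => derivs vs f (y + s *: v)) (derivs (v :: vs) f (y + t *: v)).
Proof.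
move=> oU H Ut; apply: is_derive_line.
have [df _] := mixed_loc_diff (mixed_loc_derivs vs oU H) Ut.
by apply: DeriveDef => //; exact: diff_derivable.
Qed.

End MixedClass.

Lemma mixed_loc_smooth (R : realType) (d : nat) (U : set 'rV[R]_d) f :
  open U -> mixed_loc U f -> smooth_on U f.
Proof.
move=> oU H k; elim: k f H => [|k IH] f H /=.
  by move=> x Ux; apply: differentiable_continuous; have [] := mixed_loc_diff H Ux.
split; first by move=> x Ux; have [] := mixed_loc_diff H Ux.
by move=> i; apply: IH; exact: mixed_loc_derive.
Qed.

(** * Curves of class M *)

Section Curves.
Variables (R : realType) (d : nat).
Implicit Types (x y v w : 'rV[R]_d) (t s : R).

Lemma coord_le_norm x i : `|x 0 i| <= `|x|.
Proof.
by rewrite [leRHS]/Num.Def.normr/= mx_normrE; exact: (le_bigmax _ (fun i => `|x i.1 i.2|) (0, i)).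
Qed.

Lemma norm_le_coord x (C : R) : 0 <= C -> (forall i, `|x 0 i| <= C) -> `|x| <= C.
Proof.
move=> C0 H; rewrite [leLHS]/Num.Def.normr/= mx_normrE; apply: bigmax_le => //= -[i j] _ /=.
by rewrite ord1.
Qed.

Lemma sum_sqr_le (I : Type) (r : seq I) (a : I -> R) : (forall i, 0 <= a i) ->
  \sum_(i <- r) a i ^+ 2 <= (\sum_(i <- r) a i) ^+ 2.
Proof.
move=> a0; elim: r => [|i r IH]; first by rewrite !big_nil expr0n.
rewrite !big_cons; have S0 : 0 <= \sum_(j <- r) a j by exact: sumr_ge0.
rewrite sqrrD; have := mulr_ge0 (a0 i) S0; move: IH; lra.
Qed.

Lemma enorm_le_sum x : enorm x <= \sum_(i < d) `|x 0 i|.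
Proof.
have S0 : 0 <= \sum_(i < d) `|x 0 i| by exact: sumr_ge0.
rewrite /enorm -(ger0_norm S0) -sqrtr_sqr ler_sqrt ?sqr_ge0//.
have -> : \sum_(i < d) x 0 i ^+ 2 = \sum_(i < d) `|x 0 i| ^+ 2.
  by apply: eq_bigr => i _; rewrite real_normK// num_real.
exact: sum_sqr_le.
Qed.

Lemma derive1n_row (G : 'I_d -> nat -> R -> R) (c : R -> 'rV[R]_d) :
  (forall i, jet_on setT (G i)) -> (forall t i, c t 0 i = G i 0%N t) ->
  smooth_curve c /\ forall k t, derive1n k c t = \row_i G i k t.
Proof.
move=> J c0.
have E k : derive1n k c = fun t => \row_i G i k t.
  elim: k => [|k IH].
    by apply/funext => t; apply/rowP => i; rewrite mxE -c0.
  rewrite derive1nS IH; apply/funext => t.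
  have D : derivable (fun t => \row_i G i k t) t 1.
    apply/derivable_mxP => i j; have [D _] := J j k t I.
    by under eq_fun do rewrite mxE.
  rewrite derive1E derive_mx//; apply/matrixP => i j; rewrite !mxE.
  have [_ <-] := J j k t I; congr ('D_1 _ t).
  by apply/funext => s; rewrite mxE.
split; last by move=> k t; rewrite E.
move=> k t; rewrite E; apply/derivable_mxP => i j; have [D _] := J j k t I.
by under eq_fun do rewrite mxE.
Qed.

Lemma DC_of_coord (M : nat -> R) (G : 'I_d -> nat -> R -> R) (c : R -> 'rV[R]_d) (C : R) :
  positive_seq M ->
  (forall i, jet_on setT (G i)) -> (forall t i, c t 0 i = G i 0%N t) ->
  (forall i k t, `|G i k t| <= C * k`!%:R * M k) -> DC_curve M c.
Proof.
move=> M0 J c0 H; have [sc E] := derive1n_row J c0; split=> // K _.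
exists (d%:R * `|C| + 1), 1; split; first by rewrite ltr_wpDl// mulr_ge0.
split=> // k t _; rewrite E expr1n mulr1 (le_trans (enorm_le_sum _))//.
have P : 0 <= k`!%:R * M k by rewrite mulr_ge0// ltW.
apply: (@le_trans _ _ (\sum_(i < d) `|C| * (k`!%:R * M k))).
  apply: ler_sum => i _; rewrite mxE (le_trans (H i k t))// -mulrA ler_wpM2r//.
  exact: ler_norm.
rewrite sumr_const card_ord -[_ *+ d]mulr_natl.
have -> : (d%:R * `|C| + 1) * k`!%:R * M k = d%:R * (`|C| * (k`!%:R * M k)) + k`!%:R * M k by ring.
by rewrite lerDl.
Qed.

Lemma bump_curve (M : nat -> R) (X : set 'rV[R]_d) f (p q : nat -> R -> R) y v w :
  positive_seq M -> AinfM M X f -> jet_on setT p -> jet_on setT q ->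
  beurling M p -> beurling M q ->
  (forall t, X (y + p 0%N t *: v + q 0%N t *: w)) ->
  smooth_curve (fun t => f (y + p 0%N t *: v + q 0%N t *: w)).
Proof.
move=> M0 fA Jp Jq bp bq HX.
apply: (fA (fun t => y + p 0%N t *: v + q 0%N t *: w)); split=> //.
have [Cp Cp0 Hp] := bp 1 ltr01; have [Cq Cq0 Hq] := bq 1 ltr01.
pose G i k t := (if k is 0%N then y 0 i else 0) + v 0 i * p k t + w 0 i * q k t.
have L k t : `|p k t| <= Cp * (k`!%:R * M k) by have := Hp k t; rewrite expr1n mulr1 mulrA.
have L' k t : `|q k t| <= Cq * (k`!%:R * M k) by have := Hq k t; rewrite expr1n mulr1 mulrA.
apply: (@DC_of_coord M G _ (`|y| / M 0%N + `|v| * Cp + `|w| * Cq)) => //.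
- move=> i; apply: jet_add; last exact: jet_scale.
  by apply: jet_add; [exact: jet_cst|exact: jet_scale].
- by move=> t i; rewrite !mxE /G mulrC [q _ _ * _]mulrC.
- move=> i k t; rewrite /G (le_trans (ler_normD _ _))// -mulrA !mulrDl.
  have P : 0 <= k`!%:R * M k by rewrite mulr_ge0// ltW.
  apply: lerD; last by rewrite normrM -mulrA ler_pM// coord_le_norm.
  rewrite (le_trans (ler_normD _ _))// lerD//; last by rewrite normrM -mulrA ler_pM// coord_le_norm.
  case: k P => [|k] P; last by rewrite normr0 !mulr_ge0// ?invr_ge0 ltW.
  by rewrite fact0 mul1r divfK ?gt_eqF// coord_le_norm.
Qed.

Lemma rescale_jet (F : R -> R) (a b t0 : R) : smooth_curve F ->
  jet_on [set s | `|s| < a] (fun k s => b ^+ k * derive1n k F (b * s + t0)).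
Proof.
move=> sF; apply: jet_on_sub (@jet_affine R setT _ b t0 (smooth_jet sF)).
by [].
Qed.

Lemma open_absball (a : R) : open [set s : R | `|s| < a].
Proof.
have -> : [set s : R | `|s| < a] = ball (0 : R) a.
  by apply/funext => s; rewrite -ball_normE /ball_/= sub0r normrN.
exact: ball_open.
Qed.

Lemma rescale_derive1n (F g : R -> R) (a b t0 : R) k : 0 < a -> smooth_curve F ->
  (forall s, `|s| < a -> F (b * s + t0) = g s) ->
  derive1n k g 0 = b ^+ k * derive1n k F t0.
Proof.
move=> a0 sF H; have J := @rescale_jet F a b t0 sF.
rewrite (jet_derive1n (@open_absball a) J)/= ?normr0//.
  by rewrite mulr0 add0r.
by move=> t /= ta; rewrite expr0 mul1r H.
Qed.

Fixpoint powX (j : nat) (g : nat -> R -> R) := if j is j'.+1 then mulX (powX j' g) else g.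

Lemma powX0 j g t : powX j g 0%N t = t ^+ j * g 0%N t.
Proof. by elim: j => [|j IH] /=; rewrite ?expr0 ?mul1r// /mulX mul0r addr0 IH exprS mulrA. Qed.

Lemma powX_beurling M K g j : positive_seq M -> log_convex M -> 0 <= K ->
  jet_on setT g -> (forall k t, K < `|t| -> g k t = 0) -> beurling M g ->
  [/\ jet_on setT (powX j g), (forall k t, K < `|t| -> powX j g k t = 0) & beurling M (powX j g)].
Proof.
move=> M0 lc K0 Jg sg bg; elim: j => [|j [J s b]] //=.
have [b' s'] := beurling_mulX M0 lc K0 s b.
by split => //; exact: jet_mulX.
Qed.

End Curves.

Section CurveLemma.
Variables (R : realType) (d : nat).
Implicit Types (x y v w : 'rV[R]_d) (t s : R).

Lemma lim_series_single (u : nat -> R) n : (forall m, m != n -> u m = 0) ->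
  limn (series u) = u n.
Proof.
move=> H; apply: cvg_lim => //; apply: cvg_near_cst; exists n.+1 => // N /= nN.
rewrite /series/= big_mkord (bigD1 (Ordinal nN))//= big1 ?addr0// => i.
by rewrite -val_eqE /=; exact: H.
Qed.

Lemma lim_series0 (u : nat -> R) : (forall m, u m = 0) -> limn (series u) = 0.
Proof. by move=> H; rewrite (@lim_series_single u 0%N)// => m _; exact: H. Qed.

Definition tau (tn ln : nat -> R) n t := (ln n)^-1 * t + - ((ln n)^-1 * tn n).

Lemma series_curve M x0 (p1 p2 p3 : nat -> R -> R) (tn ln : nat -> R) (A B D : nat -> 'rV[R]_d) :
  positive_seq M -> jet_on setT p1 -> jet_on setT p2 -> jet_on setT p3 ->
  (forall n, 0 < ln n) ->
  (forall n k t, `|A n| * `|p1 k t| <= 2^-1 ^+ n * (ln n) ^+ k * k`!%:R * M k) ->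
  (forall n k t, `|B n| * `|p2 k t| <= 2^-1 ^+ n * (ln n) ^+ k * k`!%:R * M k) ->
  (forall n k t, `|D n| * `|p3 k t| <= 2^-1 ^+ n * (ln n) ^+ k * k`!%:R * M k) ->
  DC_curve M (fun t => \row_i (x0 0 i + limn (series (fun n =>
     A n 0 i * p1 0%N (tau tn ln n t) + B n 0 i * p2 0%N (tau tn ln n t) +
     D n 0 i * p3 0%N (tau tn ln n t))))).
Proof.
move=> M0 J1 J2 J3 l0 HA HB HD.
pose Q n i k t := A n 0 i * p1 k t + B n 0 i * p2 k t + D n 0 i * p3 k t.
pose U i n k t := (ln n)^-1 ^+ k * Q n i k ((ln n)^-1 * t + - ((ln n)^-1 * tn n)).
have JU i n : jet_on setT (U i n).
  apply: jet_on_sub (@jet_affine R setT _ (ln n)^-1 (- ((ln n)^-1 * tn n)) _); first by [].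
  by apply: jet_add; [apply: jet_add|]; exact: jet_scale.
have UB i n k t : `|U i n k t| <= (3 * (k`!%:R * M k)) * 2^-1 ^+ n.
  have lk : 0 < ln n ^+ k by rewrite exprn_gt0.
  rewrite /U normrM exprVn normfV (gtr0_norm lk) ler_pdivrMl//.
  set s := _ + _.
  have -> : ln n ^+ k * (3 * (k`!%:R * M k) * 2^-1 ^+ n) =
     (2^-1 ^+ n * (ln n) ^+ k * k`!%:R * M k) + (2^-1 ^+ n * (ln n) ^+ k * k`!%:R * M k) +
     (2^-1 ^+ n * (ln n) ^+ k * k`!%:R * M k) by ring.
  rewrite /Q (le_trans (ler_normD _ _))// lerD//.
    rewrite (le_trans (ler_normD _ _))// lerD// normrM.
      by apply: le_trans (HA n k s); rewrite ler_wpM2r// coord_le_norm.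
    by apply: le_trans (HB n k s); rewrite ler_wpM2r// coord_le_norm.
  by rewrite normrM; apply: le_trans (HD n k s); rewrite ler_wpM2r// coord_le_norm.
have cvg3 k : cvgn (series (fun n => (3 * (k`!%:R * M k)) * 2^-1 ^+ n)).
  by apply/cvg_ex; eexists; exact: geometric_half_cvg.
pose G i k t := (if k is 0%N then x0 0 i else 0) + limn (series (fun n => U i n k t)).
apply: (@DC_of_coord R d M G _ (`|x0| / M 0%N + 6)) => //.
- move=> i; apply: jet_add; first exact: jet_cst.
  apply: (jet_series (a := fun k n => (3 * (k`!%:R * M k)) * 2^-1 ^+ n)) => //; exact: openT.
- move=> t i; rewrite mxE /G; congr (_ + limn (series _)).
  by apply/funext => n; rewrite /U expr0 mul1r.
- move=> i k t; rewrite /G (le_trans (ler_normD _ _))// !mulrDl; apply: lerD.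
    case: k => [|k]; last by rewrite normr0 !mulr_ge0// ?invr_ge0 ltW.
    by rewrite fact0 mulr1 divfK ?gt_eqF// coord_le_norm.
  have [_] := cvg_series_bound (cvg3 k) (fun n => UB i n k t).
  rewrite (cvg_lim _ (@geometric_half_cvg _ _))// => /le_trans; apply.
  by rewrite le_eqVlt; apply/orP; left; apply/eqP; ring.
Qed.

Definition cusp_cond (X : set 'rV[R]_d) x0 e p (kap h eps : R) :=
  forall y w (q : R), X y -> `|y - x0| < eps -> 0 <= q <= h -> `|w| <= kap * q ^+ p ->
    X (y + q *: e + w).

(* A curve leaving [y] inside the cusp; [s ^+ 2] makes it two-sided. *)
Definition gcurve (f : 'rV[R]_d -> R) e p y v : R -> R :=
  fun s => f (y + s ^+ 2 *: e + s ^+ (2 * p) *: v).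

Section Profiles.
Variables (M : nat -> R) (M0 : positive_seq M) (lc : log_convex M) (nq : non_quasianalytic M).
Variables (X : set 'rV[R]_d) (f : 'rV[R]_d -> R) (fA : AinfM M X f).

Lemma profiles p : exists e1 e2 e3 : nat -> R -> R, [/\
  [/\ jet_on setT e1, jet_on setT e2 & jet_on setT e3],
  [/\ beurling M e1, beurling M e2 & beurling M e3],
  [/\ forall t, 0 <= e1 0%N t <= 1, forall t, `|t| <= 1 -> e1 0%N t = 1 &
      forall t, 2 < `|t| -> e1 0%N t = 0],
  [/\ forall t, 0 <= e2 0%N t <= 16, forall t, `|t| <= 2 -> e2 0%N t = t ^+ 2 &
      forall t, 4 < `|t| -> e2 0%N t = 0] &
  forall t, e3 0%N t = t ^+ p * e1 0%N t].
Proof.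
have [g [Jg g01 g1 g0] bg] := beurling_plateau M0 nq.
pose g' k t := (2^-1 : R) ^+ k * g k (2^-1 * t + 0).
have g'0 t : g' 0%N t = g 0%N (t / 2) by rewrite /g' expr0 mul1r addr0 mulrC.
have bg' : beurling M g' by exact: beurling_affine.
have Jg' : jet_on setT g' by apply: jet_on_sub (@jet_affine R setT _ 2^-1 0 Jg).
have sg' k t : 4 < `|t| -> g' k t = 0.
  move=> t4; rewrite /g' g0 ?mulr0// addr0 normrM gtr0_norm ?invr_gt0//.
  by rewrite ltr_pdivlMl// -natrM.
have [J2 s2 b2] := @powX_beurling R M 4 g' 2 M0 lc (ler0n _ 4) Jg' sg' bg'.
have [J3 s3 b3] := @powX_beurling R M 2 g p M0 lc (ler0n _ 2) Jg g0 bg.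
exists g, (powX 2 g'), (powX p g); split => //.
- by split=> // t; exact: g0.
- split=> [t|t t2|t]; last exact: s2.
  + have [t4|] := leP `|t| 4; last by move/s2 => ->; rewrite lexx ler0n.
    rewrite powX0 g'0; have /andP[h1 h2] := g01 (t / 2).
    have t16 : t ^+ 2 <= 16.
      rewrite -real_normK ?num_real//.
      have -> : (16 : R) = 4 ^+ 2 by rewrite -natrX.
      by rewrite lerXn2r ?nnegrE.
    rewrite mulr_ge0 ?sqr_ge0//= -[leRHS]mulr1 ler_pM ?sqr_ge0//.
  + by rewrite powX0 g'0 g1 ?mulr1// normrM normfV normr_nat ler_pdivrMr// mul1r.
- by move=> t; rewrite powX0.
Qed.

Lemma amplitude (e1 e2 e3 : nat -> R -> R) (l e : R) :
  beurling M e1 -> beurling M e2 -> beurling M e3 -> 0 < l -> 0 < e ->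
  exists2 b, 0 < b & forall k t (a : R), 0 <= a <= b -> [/\
    a * `|e1 k t| <= e * l ^+ k * k`!%:R * M k,
    a * `|e2 k t| <= e * l ^+ k * k`!%:R * M k &
    a * `|e3 k t| <= e * l ^+ k * k`!%:R * M k].
Proof.
move=> b1 b2 b3 l0 e0.
have [C1 C10 H1] := b1 l l0; have [C2 C20 H2] := b2 l l0; have [C3 C30 H3] := b3 l l0.
have C0 : 0 < C1 + C2 + C3 + 1 by rewrite ltr_wpDl// !addr_ge0.
exists (e / (C1 + C2 + C3 + 1)); first by rewrite divr_gt0.
move=> k t a /andP[a0 ab].
have P : 0 <= l ^+ k * k`!%:R * M k by rewrite !mulr_ge0// ?exprn_ge0// ltW.
have key (C g : R) : 0 <= C -> C <= C1 + C2 + C3 + 1 ->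
    `|g| <= C * l ^+ k * k`!%:R * M k -> a * `|g| <= e * l ^+ k * k`!%:R * M k.
  move=> CC Cle H; apply: (le_trans (ler_wpM2l a0 H)).
  have -> : a * (C * l ^+ k * k`!%:R * M k) = (a * C) * (l ^+ k * k`!%:R * M k) by ring.
  have -> : e * l ^+ k * k`!%:R * M k = e * (l ^+ k * k`!%:R * M k) by ring.
  apply: ler_wpM2r => //.
  rewrite ler_pdivlMr// in ab; apply: le_trans ab; exact: ler_wpM2l.
by split; [apply: (key C1 _ C10)|apply: (key C2 _ C20)|apply: (key C3 _ C30)] => //; lra.
Qed.

Lemma gcurve_jet x0 e p (kap h eps : R) : 0 < h -> 0 < kap ->
  cusp_cond X x0 e p kap h eps ->
  exists2 a, 0 < a & forall y v, X y -> `|y - x0| < eps -> `|v| <= kap ->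
  exists2 G, jet_on [set s | `|s| < a] G &
    forall s, `|s| < a -> G 0%N s = gcurve f e p y v s.
Proof.
move=> h0 k0 S.
have [e1 [e2 [e3 [[J1 J2 J3] [b1 b2 b3] [e101 e11 e12] [e201 e22 e24] e3E]]]] := profiles (2 * p).
pose a := Num.min 1 (h / 16).
have a0 : 0 < a by rewrite lt_min ltr01 divr_gt0.
have a1 : a <= 1 by rewrite ge_min lexx.
have ah : a ^+ 2 * 16 <= h.
  rewrite -ler_pdivlMr// expr2; apply: (@le_trans _ _ (1 * a)); first by rewrite ler_pM2r.
  by rewrite mul1r ge_min lexx orbT.
exists a => // y v Xy yx vk.
have HX t : X (y + e2 0%N t *: (a ^+ 2 *: e) + e3 0%N t *: (a ^+ (2 * p) *: v)).
  rewrite !scalerA; have /andP[h1 h2] := e201 t; apply: S => //.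
    rewrite mulr_ge0 ?sqr_ge0//=; apply: le_trans ah.
    by rewrite mulrC ler_wpM2l// sqr_ge0.
  have /andP[h3 h4] := e101 t.
  rewrite e3E; have [t2|t2] := leP `|t| 2; last first.
    rewrite e12// mulr0 mul0r scale0r normr0; apply: mulr_ge0; first exact: ltW.
    by apply: exprn_ge0; rewrite mulr_ge0 ?sqr_ge0.
  rewrite e22// normrZ mulrC; apply: ler_pM => //.
  rewrite !normrM !normrX [`|e1 0%N t|]ger0_norm// (gtr0_norm a0).
  rewrite mulrAC -exprMn exprM exprMn real_normK ?num_real// ler_piMr//.
  by rewrite exprn_ge0// mulr_ge0// sqr_ge0.
have sF := bump_curve M0 fA J2 J3 b2 b3 HX.
have E s : `|s| < a -> f (y + e2 0%N (a^-1 * s + 0) *: (a ^+ 2 *: e) +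
    e3 0%N (a^-1 * s + 0) *: (a ^+ (2 * p) *: v)) = gcurve f e p y v s.
  move=> sa; have s1 : `|a^-1 * s| < 1 by rewrite normrM gtr0_norm ?invr_gt0// ltr_pdivrMl// mulr1.
  rewrite addr0 e3E e22 ?(le_trans (ltW s1)) ?ler1n// e11 ?(ltW s1)// mulr1 /gcurve !scalerA.
  by rewrite -!exprMn mulrAC mulVf ?mul1r// gt_eqF.
exists (fun k s => a^-1 ^+ k * derive1n k (fun t => f (y + e2 0%N t *: (a ^+ 2 *: e) + e3 0%N t *: (a ^+ (2 * p) *: v))) (a^-1 * s + 0)).
  exact: rescale_jet sF.
by move=> s sa; rewrite expr0 mul1r /= E.
Qed.

Lemma line_jet y v (h : R) : 0 < h -> (forall w, `|w| <= h -> X (y + w)) ->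
  exists2 a, 0 < a & exists2 G, jet_on [set s | `|s| < a] G &
    forall s, `|s| < a -> G 0%N s = f (y + s *: v).
Proof.
move=> h0 S.
have [e1 [e2 [e3 [[J1 J2 J3] [b1 b2 b3] [e101 e11 e12] [e201 e22 e24] e3E]]]] := profiles 1.
have v0 : 0 < 2 * (`|v| + 1) by rewrite mulr_gt0// ltr_wpDl.
have [a a0 ah] : exists2 a, 0 < a & a * (2 * (`|v| + 1)) = h.
  by exists (h / (2 * (`|v| + 1))); [rewrite divr_gt0|rewrite divfK// gt_eqF].
have HX t : X (y + e2 0%N t *: 0 + e3 0%N t *: (a *: v)).
  rewrite scaler0 addr0 scalerA; apply: S.
  have /andP[h3 h4] := e101 t.
  rewrite e3E expr1; have [t2|t2] := leP `|t| 2; last by rewrite e12// mulr0 mul0r scale0r normr0 ltW.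
  rewrite normrZ !normrM (ger0_norm h3) (gtr0_norm a0).
  apply: (@le_trans _ _ (2 * 1 * a * (`|v| + 1))).
    apply: ler_pM => //; last by rewrite lerDl.
      by rewrite !mulr_ge0// ltW.
    by rewrite ler_wpM2r ?(ltW a0)//; apply: ler_pM.
  by rewrite -ah le_eqVlt; apply/orP; left; apply/eqP; ring.
have sF := bump_curve M0 fA J2 J3 b2 b3 HX.
exists a => //.
have E s : `|s| < a -> f (y + e2 0%N (a^-1 * s + 0) *: 0 +
    e3 0%N (a^-1 * s + 0) *: (a *: v)) = f (y + s *: v).
  move=> sa; have s1 : `|a^-1 * s| < 1 by rewrite normrM gtr0_norm ?invr_gt0// ltr_pdivrMl// mulr1.
  rewrite addr0 e3E scaler0 addr0 e11 ?(ltW s1)// mulr1 expr1 !scalerA.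
  by rewrite mulrAC mulVf ?mul1r// gt_eqF.
exists (fun k s => a^-1 ^+ k * derive1n k (fun t => f (y + e2 0%N t *: 0 + e3 0%N t *: (a *: v))) (a^-1 * s + 0)).
  exact: rescale_jet sF.
by move=> s sa; rewrite expr0 mul1r /= E.
Qed.

End Profiles.
End CurveLemma.

Section CurveContradiction.
Variables (R : realType) (d : nat).
Implicit Types (x y v w : 'rV[R]_d) (t s : R).
Variables (M : nat -> R) (M0 : positive_seq M) (lc : log_convex M) (nq : non_quasianalytic M).
Variables (X : set 'rV[R]_d) (f : 'rV[R]_d -> R) (fA : AinfM M X f).

Let tn (n : nat) : R := 2^-1 ^+ n.
Let ln (n : nat) : R := 2^-1 ^+ n / 16.

Lemma tn_gt0 n : 0 < tn n. Proof. by rewrite exprn_gt0// invr_gt0. Qed.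
Lemma ln_gt0 n : 0 < ln n. Proof. by rewrite divr_gt0// tn_gt0. Qed.

Lemma tauE n t : tau tn ln n t = (t - tn n) / ln n.
Proof. by rewrite /tau -mulrBr mulrC. Qed.

Lemma tau_near n t : `|tau tn ln n t| <= 4 -> 3 / 4 * tn n <= t <= 5 / 4 * tn n.
Proof.
rewrite tauE normrM normfV (gtr0_norm (ln_gt0 n)) ler_pdivrMr ?ln_gt0//.
rewrite ler_norml /ln -/(tn n); lra.
Qed.

Lemma tau_disjoint k n t : k != n -> `|tau tn ln n t| <= 4 -> 4 < `|tau tn ln k t|.
Proof.
move=> kn; wlog ltkn : k n kn / (k < n)%N => [H|].
  have [kn'|nk|kn'] := ltngtP k n; last by rewrite kn' eqxx in kn.
    exact: H.
  move=> h; rewrite ltNge; apply/negP => h'.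
  have := H n k; rewrite ltn_eqF// => /(_ isT nk h'); rewrite ltNge => /negP; exact.
move=> /tau_near h; rewrite ltNge; apply/negP => /tau_near h'.
have tk := tn_gt0 k.
have : tn n <= 2^-1 * tn k.
  by rewrite -exprS ler_wiXn2l// ?invr_ge0// invf_le1// ler1n.
move: h h'; lra.
Qed.

(* If the derivatives were unbounded near [x0], pick fast converging
   counterexamples [y_ n] and run through them by one curve: on the n-th bump it
   rises from [x0] in direction [e], moves above [y_ n], comes down to [y_ n]
   along [gcurve], and goes back. *)
Lemma gcurve_bound x0 e p (kap h eps : R) m : X x0 -> 0 < h -> 0 < kap -> 0 < eps -> (0 < p)%N ->
  cusp_cond X x0 e p kap h eps ->
  exists eps' C, 0 < eps' /\ forall y v, X y -> `|y - x0| < eps' -> `|v| <= kap / 2 ->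
    `|derive1n m (gcurve f e p y v) 0| <= C.
Proof.
move=> Xx0 h0 k0 eps0 p0 S; apply: contrapT => N.
have bad (r C : R) : 0 < r -> exists yv : 'rV[R]_d * 'rV[R]_d,
    [/\ X yv.1, `|yv.1 - x0| < r, `|yv.2| <= kap / 2 &
        C < `|derive1n m (gcurve f e p yv.1 yv.2) 0|].
  move=> r0; apply: contrapT => N'; apply: N; exists r, C; split=> // y v Xy yr vk.
  by rewrite leNgt; apply/negP => hC; apply: N'; exists (y, v).
have [e1 [e2 [e3 [[J1 J2 J3] [b1 b2 b3] [e101 e11 e12] [e201 e22 e24] e3E]]]] :=
  profiles M0 lc nq (2 * p).
have data n : exists yva : 'rV[R]_d * 'rV[R]_d * R, let: (y, v, a) := yva in
   [/\ 0 < a, a ^+ 2 * 16 <= h, [/\ X y, `|y - x0| < eps & `|v| <= kap / 2],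
    `|y - x0| <= kap / 2 * (a ^+ 2) ^+ p &
    (forall k t, [/\ `|y - x0| * `|e1 k t| <= 2^-1 ^+ n * ln n ^+ k * k`!%:R * M k,
      `|a ^+ 2 *: e| * `|e2 k t| <= 2^-1 ^+ n * ln n ^+ k * k`!%:R * M k &
      `|a ^+ (2 * p) *: v| * `|e3 k t| <= 2^-1 ^+ n * ln n ^+ k * k`!%:R * M k]) /\
    n%:R * (ln n / a) ^+ m < `|derive1n m (gcurve f e p y v) 0| ].
  have [b b0 Hb] := amplitude M0 b1 b2 b3 (ln_gt0 n) (tn_gt0 n).
  have c0 : 0 < `|e| + kap + 1 by rewrite ltr_wpDl// addr_ge0// ltW.
  pose a := Num.min (Num.min 1 (h / 16)) (b / (`|e| + kap + 1)).
  have a0 : 0 < a by rewrite !lt_min ltr01 !divr_gt0.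
  have a1 : a <= 1 by rewrite !ge_min lexx.
  have a2a : a ^+ 2 <= a by rewrite expr2 -[leRHS]mulr1 ler_pM2l.
  have ah : a ^+ 2 * 16 <= h.
    by rewrite -ler_pdivlMr// (le_trans a2a)// !ge_min lexx !orbT.
  have ab : a * (`|e| + kap + 1) <= b by rewrite -ler_pdivlMr// !ge_min lexx !orbT.
  have r0 : 0 < Num.min (Num.min b eps) (kap / 2 * (a ^+ 2) ^+ p).
    by rewrite !lt_min b0 eps0 mulr_gt0// ?divr_gt0// !exprn_gt0.
  have [[y v] /= [Xy yr vk Hd]] := bad _ (n%:R * (ln n / a) ^+ m) r0.
  rewrite !lt_min in yr; have /andP[/andP[yb ye] yk] := yr.
  exists (y, v, a).
  split => //; first exact: ltW.
  split=> // k t; split.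
  - by have [] := Hb k t `|y - x0|; rewrite ?normr_ge0 ?(ltW yb).
  - have [] // := Hb k t `|a ^+ 2 *: e|; rewrite normr_ge0/= normrZ ger0_norm ?sqr_ge0//.
    apply: le_trans ab; apply: ler_pM => //; first by rewrite sqr_ge0.
    by rewrite -addrA lerDl addr_ge0// ltW.
  - have [] // := Hb k t `|a ^+ (2 * p) *: v|; rewrite normr_ge0/= normrZ ger0_norm ?exprn_ge0 ?(ltW a0)//.
    apply: le_trans ab; apply: ler_pM => //; first by rewrite exprn_ge0// ltW.
      have : a ^+ (2 * p) <= a ^+ 1 by rewrite ler_wiXn2l ?(ltW a0)// muln_gt0.
      by rewrite expr1.
    by rewrite (le_trans vk)//; have := normr_ge0 e; move: k0; lra.
have {data} [F HF] := choice data.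
pose y_ n := (F n).1.1; pose v_ n := (F n).1.2; pose a_ n := (F n).2.
have {}HF n : [/\ 0 < a_ n, a_ n ^+ 2 * 16 <= h, [/\ X (y_ n), `|y_ n - x0| < eps & `|v_ n| <= kap / 2],
    `|y_ n - x0| <= kap / 2 * (a_ n ^+ 2) ^+ p &
    (forall k t, [/\ `|y_ n - x0| * `|e1 k t| <= 2^-1 ^+ n * ln n ^+ k * k`!%:R * M k,
      `|a_ n ^+ 2 *: e| * `|e2 k t| <= 2^-1 ^+ n * ln n ^+ k * k`!%:R * M k &
      `|a_ n ^+ (2 * p) *: v_ n| * `|e3 k t| <= 2^-1 ^+ n * ln n ^+ k * k`!%:R * M k]) /\
    n%:R * (ln n / a_ n) ^+ m < `|derive1n m (gcurve f e p (y_ n) (v_ n)) 0| ].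
  by have := HF n; rewrite /y_ /v_ /a_; case: (F n) => [[y v] a].
pose A n := y_ n - x0; pose B n := a_ n ^+ 2 *: e; pose D n := a_ n ^+ (2 * p) *: v_ n.
have := @series_curve R d M x0 e1 e2 e3 tn ln A B D M0 J1 J2 J3 ln_gt0.
set c := (fun t => \row_i _) => DC.
have {}DC : DC_curve M c.
  by apply: DC => n k t; have [_ _ _ _ [+ _]] := HF n; move=> /(_ k t)[].
have cE n t : `|tau tn ln n t| <= 4 ->
   c t = x0 + e1 0%N (tau tn ln n t) *: A n + e2 0%N (tau tn ln n t) *: B n +
         e3 0%N (tau tn ln n t) *: D n.
  move=> tn4; apply/rowP => i; rewrite /c !mxE (@lim_series_single _ _ n).
    by rewrite !mxE; ring.
  move=> k kn; have t4 := tau_disjoint kn tn4.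
  have t2 : 2 < `|tau tn ln k t| by apply: lt_trans t4; rewrite ltr_nat.
  by rewrite e3E e12// e24// !mulr0 !addr0.
have cX t : X (c t).
  have [[n hn]|hn] := pselect (exists n, `|tau tn ln n t| <= 4); last first.
    suff -> : c t = x0 by [].
    apply/rowP => i; rewrite /c mxE lim_series0 ?addr0// => k.
    have t4 : 4 < `|tau tn ln k t| by rewrite ltNge; apply/negP => h4; apply: hn; exists k.
    have t2 : 2 < `|tau tn ln k t| by apply: lt_trans t4; rewrite ltr_nat.
    by rewrite e3E e12// e24// !mulr0 !addr0.
  rewrite (cE n)//; move: (tau tn ln n t) => u.
  have [a0 ah [Xy ye vk] yk _] := HF n; rewrite /A /B /D !scalerA.
  have /andP[q1 q2] := e201 u; have /andP[u1 u2] := e101 u.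
  have q0 : 0 <= e2 0%N u * a_ n ^+ 2 by rewrite mulr_ge0// sqr_ge0.
  have qh : 0 <= e2 0%N u * a_ n ^+ 2 <= h.
    by rewrite q0/=; apply: le_trans ah; rewrite mulrC ler_wpM2l// sqr_ge0.
  have k20 : 0 <= kap / 2 by rewrite divr_ge0// ltW.
  have Vb : `|u| <= 2 -> `|(e3 0%N u * a_ n ^+ (2 * p)) *: v_ n| <= kap / 2 * (e2 0%N u * a_ n ^+ 2) ^+ p.
    move=> uu; rewrite e3E e22// normrZ mulrC; apply: ler_pM => //.
    rewrite !normrM !normrX [`|e1 0%N u|]ger0_norm// (gtr0_norm a0).
    rewrite mulrAC -exprMn exprM exprMn real_normK ?num_real// ler_piMr//.
    by rewrite exprn_ge0// mulr_ge0// sqr_ge0.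
  have [u_1|u_1] := leP `|u| 1.
    rewrite e11// scale1r [x0 + _]addrC subrK; apply: S => //.
    rewrite (le_trans (Vb _))//; first by rewrite (le_trans u_1)// ler1n.
    by rewrite ler_wpM2r ?exprn_ge0//; move: k0; lra.
  rewrite (addrAC x0) -[x0 + _ + _ + _]addrA.
  apply: S => //; first by rewrite subrr normr0.
  have [u_2|u_2] := leP `|u| 2; last first.
    by rewrite e3E e12// mulr0 mul0r !scale0r addr0 normr0 mulr_ge0 ?exprn_ge0// ltW.
  have Q : (a_ n ^+ 2) ^+ p <= (e2 0%N u * a_ n ^+ 2) ^+ p.
    rewrite lerXn2r ?nnegrE ?sqr_ge0// ler_peMl ?sqr_ge0// e22//.
    by rewrite -real_normK ?num_real// expr_ge1// ltW.
  rewrite (le_trans (ler_normD _ _))//.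
  apply: (@le_trans _ _ (kap / 2 * (e2 0%N u * a_ n ^+ 2) ^+ p + kap / 2 * (e2 0%N u * a_ n ^+ 2) ^+ p)).
    apply: lerD; last exact: Vb.
    rewrite normrZ ger0_norm// (le_trans (ler_piMl _ u2))//.
    by rewrite (le_trans yk)// ler_wpM2l.
  by rewrite -mulrDl ler_wpM2r ?exprn_ge0//; lra.
have sm : smooth_curve (f \o c) by apply: fA; split.
have [dl dl0 Hdl] := isd_locbd (smooth_jet sm m (t := 0) I).
set Bd := `|_| + _ + 1 in Hdl.
have [N1 HN1] := half_pow_lt 1 dl0.
pose n := maxn N1 (Num.truncn `|Bd|).+1.
have nB : Bd < n%:R.
  apply: le_lt_trans (ler_norm _) _.
  have /andP[_ h2] := truncn_itv (normr_ge0 Bd).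
  by apply: lt_le_trans h2 _; rewrite ler_nat leq_maxr.
have tnd : `|tn n| < dl.
  by rewrite (gtr0_norm (tn_gt0 n)) -[tn n]mul1r HN1// leq_maxl.
have := Hdl _ tnd; rewrite add0r => DB.
have [a0 ah [Xy ye vk] yk [_ bigD]] := HF n.
have la : 0 < ln n / a_ n by rewrite divr_gt0// ln_gt0.
have E s : `|s| < a_ n -> (f \o c) (ln n / a_ n * s + tn n) = gcurve f e p (y_ n) (v_ n) s.
  move=> sa; have tE : tau tn ln n (ln n / a_ n * s + tn n) = s / a_ n.
    have := ln_gt0 n; move=> /lt0r_neq0 l1; have a1 := lt0r_neq0 a0.
    by rewrite tauE addrK; field; rewrite l1 a1.
  have s1 : `|s / a_ n| < 1 by rewrite normrM normfV (gtr0_norm a0) ltr_pdivrMr// mul1r.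
  rewrite /= (cE n) tE; last by rewrite (le_trans (ltW s1))// ler1n.
  rewrite e3E e22 ?(le_trans (ltW s1)) ?ler1n// e11 ?(ltW s1)// mulr1 scale1r /A [x0 + _]addrC subrK.
  by rewrite /B /D /gcurve !scalerA -!exprMn divfK// gt_eqF.
rewrite (rescale_derive1n m a0 sm E) normrM normrX (gtr0_norm la) mulrC in bigD.
rewrite ltr_pM2l ?exprn_gt0// in bigD.
by have := lt_trans nB bigD; rewrite ltNge DB.
Qed.

End CurveContradiction.

(** * Bounds on the derivatives of arc-smooth functions *)

Section PureBounds.
Variables (R : realType) (V : normedModType R).
Implicit Types (f : V -> R) (v w x y z : V).

Lemma pure_of_line f y0 m (r kap C : R) : 0 < kap ->
  (forall y v, `|y - y0| < r -> `|v| <= kap -> exists2 a, 0 < a & exists G,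
     [/\ jet_on [set s : R | `|s| < a] G, (forall s, `|s| < a -> G 0%N s = f (y + s *: v)) &
         `|G m 0| <= C]) ->
  pure_at f y0 m r (C / kap ^+ m).
Proof.
move=> k0 H y w yw.
have [w0|w0] := eqVneq w 0.
  have yr : `|y - y0| < r by apply: le_lt_trans yw; rewrite w0 normr0 mul0rn addr0.
  case: m H {yw} => [|m] H; last first.
    by rewrite w0 mfd_zero ?mem_head// normr0 normr0 expr0n/= mulr0.
  have z0 : `|0 : V| <= kap by rewrite normr0 ltW.
  have [a a0 [G [_ G0 GC]]] := H y 0 yr z0.
  by rewrite /= !expr0 divr1 mulr1 -[y]addr0 -(scale0r (0 : V)) -G0// normr0.
have wn : 0 < `|w| by rewrite normr_gt0.
pose v := (kap / `|w|) *: w; pose h := `|w| / kap.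
have h0 : 0 < h by rewrite divr_gt0.
have vk : `|v| <= kap by rewrite /v normrZ gtr0_norm ?divr_gt0// divfK// gt_eqF.
have wE : w = h *: v.
  have k1 := lt0r_neq0 k0; have w1 := lt0r_neq0 wn.
  rewrite /v /h scalerA (_ : _ * _ = 1) ?scale1r//.
  by move: w1 k1; move: `|w| => q q0 kk0; field; rewrite kk0 q0.
pose phi (s : R) := f (y + s *: v).
have loc t : `|y + t *: v - y0| < r ->
    (forall k, is_derive t 1 (derive1n k phi) (derive1n k.+1 phi t)) /\ `|derive1n m phi t| <= C.
  move=> tr; have [a a0 [G [JG G0 GC]]] := H _ v tr vk.
  have oO : open [set s : R | `|s - t| < a].
    have -> : [set s : R | `|s - t| < a] = ball t a.
      by apply/funext => s; rewrite -ball_normE /ball_/= distrC.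
    exact: ball_open.
  have J : jet_on [set s : R | `|s - t| < a] (fun k s => G k (s - t)).
    by move=> j s /= sa; apply: isd_shift; exact: JG.
  have E s : [set s : R | `|s - t| < a] s -> phi s = G 0%N (s - t).
    move=> /= sa; rewrite G0// /phi -addrA -scalerDl; congr (f (_ + _ *: _)).
    by rewrite addrC subrK.
  have ta : [set s : R | `|s - t| < a] t by rewrite /= subrr normr0.
  split=> [k|]; last by rewrite (jet_derive1n oO J E) //= subrr.
  split; first exact: (jet_derivable oO J E).
  by rewrite derive1nS derive1E.
have sg t : seg 0 (0 + h *+ m) t -> `|y + t *: v - y0| < r.
  move/(seg_ge _ _ (mulrn_wge0 m (ltW h0))); rewrite add0r => /andP[t0 th].
  rewrite addrAC (le_lt_trans (ler_normD _ _))// (le_lt_trans _ yw)// lerD2l normrZ ger0_norm//.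
  apply: (@le_trans _ _ (h *+ m * kap)); first by apply: ler_pM.
  by rewrite mulrnAl divfK// gt_eqF.
have := @fdn_jet_le R m h (fun k => derive1n k phi) 0 0 C.
rewrite mul0r subr0 (gtr0_norm h0) wE fdn_line0 -/phi => /(_ _ _).
have j1 : jet_on (seg 0 (0 + h *+ m)) (fun k => derive1n k phi).
  by move=> k t /sg /loc[].
have j2 s : seg 0 (0 + h *+ m) s -> `|derive1n m phi s - 0| <= C.
  by move=> /sg /loc[_]; rewrite subr0.
move=> /(_ j1 j2)/le_trans; apply.
rewrite -wE /h expr_div_n le_eqVlt; apply/orP; left; apply/eqP; ring.
Qed.

End PureBounds.

Section HolderBounds.
Variables (R : realType) (d : nat).
Implicit Types (x y v w z : 'rV[R]_d) (t s : R).
Variables (M : nat -> R) (M0 : positive_seq M) (lc : log_convex M) (nq : non_quasianalytic M).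
Variables (X : set 'rV[R]_d) (f : 'rV[R]_d -> R) (fA : AinfM M X f).

Lemma cusp_cond_move x0 x1 e p (kap h eps eps' : R) : eps' + `|x1 - x0| <= eps ->
  cusp_cond X x0 e p kap h eps -> cusp_cond X x1 e p kap h eps'.
Proof.
move=> ee S y w q Xy yx; apply: S => //; apply: lt_le_trans ee.
by rewrite -[y - x0](subrKA x1) (le_lt_trans (ler_normD _ _))// ltrD2r.
Qed.

Lemma gcurve_bound_compact x0 e p (kap h eps : R) m : closed X -> 0 < h -> 0 < kap -> 0 < eps ->
  (0 < p)%N -> cusp_cond X x0 e p kap h eps ->
  exists C, forall y v, X y -> `|y - x0| <= eps / 2 -> `|v| <= kap / 2 ->
    `|derive1n m (gcurve f e p y v) 0| <= C.
Proof.
move=> cX h0 k0 eps0 p0 S.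
pose K := X `&` [set y | `|y - x0| <= eps / 2].
have cK : compact K.
  apply: bounded_closed_compact; last first.
    apply: closedI => //.
    have -> : [set y | `|y - x0| <= eps / 2] = closed_ball x0 (eps / 2).
      rewrite closed_ballE ?divr_gt0//.
      by apply/funext => y; rewrite /closed_ball_/= distrC.
    exact: closed_ball_closed.
  exists (`|x0| + eps / 2); split; first exact: num_real.
  move=> B xB y [_ /= yx]; rewrite ltW// (le_lt_trans _ xB)//.
  by rewrite -[y](subrK x0) (le_trans (ler_normD _ _))// addrC lerD2l.
pose P (C : R) y := X y -> forall v, `|v| <= kap / 2 -> `|derive1n m (gcurve f e p y v) 0| <= C.
have := (compact_near_coveringP K).1 cK R (pinfty_nbhs R) P _.
case=> [x1 [Xx1 /= x1x0]|A [_ HA]].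
  have S' : cusp_cond X x1 e p kap h (eps / 2).
    by apply: cusp_cond_move S; rewrite [leRHS]splitr lerD2l.
  have [eps' [C [e0 HC]]] := gcurve_bound M0 lc nq fA m Xx1 h0 k0 (divr_gt0 eps0 (ltr0Sn R 1)) p0 S'.
  exists (ball x1 eps', [set C' | C < C']); first split => /=.
  - exact: nbhsx_ballx.
  - by exists C; split; [exact: num_real|].
  - move=> [y C'] /= [yx CC'] Xy v vk; apply: le_trans (ltW CC'); apply: HC => //.
    by rewrite distrC -ball_normE in yx *.
exists (A + 1) => y v Xy yx vk; apply: (HA (A + 1)) => //; first by rewrite ltrDl.
Qed.

(* An l-th difference in direction [v] of the curves [gcurve _ _ _ y u] isolates
   the l-th derivative in direction [v] as a Taylor coefficient of order [2 p l]. *)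
Lemma extract_bound x0 e p l (kap h eps C : R) y v (c : R) :
  0 < h -> 0 < kap -> cusp_cond X x0 e p kap h eps ->
  X y -> `|y - x0| < eps -> `|v| <= kap / 2 ->
  (forall u, `|u| <= kap / 2 -> `|derive1n (2 * p * l) (gcurve f e p y u) 0| <= C) ->
  (forall dl, 0 < dl -> exists2 s0, 0 < s0 & forall s, 0 < s < s0 ->
     `|mfd (nseq l ((s ^+ (2 * p) / l%:R) *: v)) f (y + s ^+ 2 *: e) -
       c * (s ^+ (2 * p) / l%:R) ^+ l| <= dl * (s ^+ (2 * p) / l%:R) ^+ l) ->
  `|c| <= l%:R ^+ l * 2 ^+ l * C.
Proof.
move=> h0 k0 S Xy yx vk HC Hc.
have C0 : 0 <= C by apply: le_trans (HC 0 _) => //; rewrite normr0 divr_ge0// ltW.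
have [a a0 HG] := gcurve_jet M0 lc nq fA h0 k0 S.
have jk (j : 'I_l.+1) : `|(j%:R / l%:R) *: v| <= kap / 2.
  rewrite normrZ (le_trans _ vk)// ler_piMl// normrM normfV !normr_nat.
  have [l0|l0] := posnP l.
    by have -> : l%:R = 0 :> R; [rewrite l0|rewrite invr0 mulr0].
  by rewrite ler_pdivrMr ?ltr0n// mul1r ler_nat -ltnS.
have k2 : kap / 2 <= kap by rewrite ler_pdivrMr// ler_pMr// ler1n.
have /choice[G HGj] (j : 'I_l.+1) : exists G, jet_on [set s : R | `|s| < a] G /\
    forall s, `|s| < a -> G 0%N s = gcurve f e p y ((j%:R / l%:R) *: v) s.
  have [G ? ?] := HG y ((j%:R / l%:R) *: v) Xy yx (le_trans (jk j) k2).
  by exists G.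
pose H k s := \sum_(j < l.+1) bcoef R l j * G j k s.
have JH : jet_on [set s : R | `|s| < a] H.
  by apply: jet_sum => j _; apply: jet_scale; have [] := HGj j.
have ll : l%:R ^+ l != 0 :> R.
  have [->|l0] := posnP l; first by rewrite expr0 oner_neq0.
  by rewrite expf_neq0// pnatr_eq0 -lt0n.
have llp : 0 < l%:R ^+ l :> R by rewrite lt0r ll exprn_ge0.
have H0 s : `|s| < a -> H 0%N s = mfd (nseq l ((s ^+ (2 * p) / l%:R) *: v)) f (y + s ^+ 2 *: e).
  move=> sa; rewrite mfd_nseq; apply: eq_bigr => j _; congr (_ * _).
  rewrite (HGj j).2// /gcurve; congr (f (_ + _)).
  rewrite scalerA scalerMnl; congr (_ *: _).
  by rewrite -[_ *+ j]mulr_natr; ring.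
have E := @jet_coef R a H (2 * p * l) (c / l%:R ^+ l) a0 JH.
have {}E : H (2 * p * l)%N 0 = c / l%:R ^+ l * (2 * p * l)`!%:R.
  apply: E => dl dl0; have [s0 s00 Hs] := Hc _ (mulr_gt0 dl0 llp).
  exists (Num.min a s0); first by rewrite lt_min a0.
  move=> s; rewrite lt_min => /andP[sp /andP[sa ss0]].
  have := Hs s; rewrite sp ss0 => /(_ isT).
  rewrite H0; last by rewrite gtr0_norm.
  rewrite expr_div_n -exprM.
  have -> : c * (s ^+ (2 * p * l) / l%:R ^+ l) = c / l%:R ^+ l * s ^+ (2 * p * l) by ring.
  move/le_trans; apply; rewrite le_eqVlt; apply/orP; left; apply/eqP.
  by field.
have HB : `|H (2 * p * l)%N 0| <= 2 ^+ l * C.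
  rewrite -bcoef_norm_sum mulr_suml (le_trans (ler_norm_sum _ _ _))//.
  apply: ler_sum => j _; rewrite normrM ler_wpM2l//.
  have [J G0] := HGj j.
  rewrite -(jet_derive1n (@open_absball R a) J (g := gcurve f e p y ((j%:R / l%:R) *: v))) /= ?normr0//.
    exact: HC.
  by move=> t ta; rewrite G0.
rewrite E !normrM normfV [`|l%:R ^+ l|]gtr0_norm// normr_nat in HB.
rewrite -mulrA -ler_pdivrMl// mulrC; apply: le_trans HB.
by rewrite ler_peMr// ?ler1n ?fact_gt0// divr_ge0// ltW.
Qed.

Lemma fdn_jet_lim l (G : nat -> R -> R) (a : R) : 0 < a -> jet_on [set s : R | `|s| < a] G ->
  forall dl, 0 < dl -> exists2 h0, 0 < h0 & forall h, 0 <= h < h0 ->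
    `|fdn l h (G 0%N) 0 - G l 0 * h ^+ l| <= dl * h ^+ l.
Proof.
move=> a0 J dl dl0; have O0 : [set s : R | `|s| < a] 0 by rewrite /= normr0.
have /cvgrPdist_le/(_ dl dl0)/nbhs_ballP[r /= r0 Hr] := is_derive_cont (J l 0 O0).
have l0 : 0 < l%:R + 1 :> R by rewrite ltr_wpDl.
exists (Num.min a r / (l%:R + 1)); first by rewrite divr_gt0// lt_min a0.
move=> h /andP[h0]; rewrite ltr_pdivlMr// lt_min => /andP[ha hr].
rewrite -{3}(ger0_norm h0).
have sg s : seg 0 (0 + h *+ l) s -> 0 <= s <= h * l%:R.
  by move/(seg_ge _ _ (mulrn_wge0 l h0)); rewrite add0r mulr_natr.
have hl : h * l%:R <= h * (l%:R + 1) by rewrite ler_wpM2l// lerDl.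
apply: fdn_jet_le => [|s /sg /andP[s0 sh]].
  move=> k s /sg /andP[s0 sh]; apply: J; rewrite /= ger0_norm//.
  by rewrite (le_lt_trans _ ha)// (le_trans sh).
rewrite distrC; apply: Hr; rewrite -ball_normE /= sub0r normrN ger0_norm//.
by rewrite (le_lt_trans _ hr)// (le_trans sh).
Qed.

Lemma interior_mixed : mixed_loc (interior X) f.
Proof.
move=> y0 Xy0 m.
have /nbhs_ballP[r3 /= r30 Hr3] : nbhs y0 X by [].
pose r := r3 / 3.
have r0 : 0 < r by rewrite divr_gt0.
have inX y w : `|y - y0| < r -> `|w| <= r -> X (y + w).
  move=> yr wr; apply: Hr3; rewrite -ball_normE /= distrC addrAC (le_lt_trans (ler_normD _ _))//.
  by move: yr wr; rewrite /r; lra.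
have S : cusp_cond X y0 0 1 1 r r.
  by move=> y w q Xy yr /andP[q0 qr]; rewrite expr1 mul1r scaler0 addr0 => wq; apply: inX => //; exact: le_trans qr.
have [eps' [C [e0 HC]]] := gcurve_bound M0 lc nq fA (2 * 1 * m) (nbhs_singleton Xy0) r0 ltr01 r0 (ltn0Sn 0) S.
pose B := m%:R ^+ m * 2 ^+ m * C.
have Hp : pure_at f y0 m (Num.min eps' r) (B / 2^-1 ^+ m).
  apply: pure_of_line; first by rewrite invr_gt0.
  move=> y v; rewrite lt_min => /andP[ye yr] v2.
  have Xy : X y by rewrite -[y]addr0; apply: inX => //; rewrite normr0 ltW.
  have [a a0 [G JG G0]] := line_jet M0 lc nq fA v r0 (fun w => inX y w yr).
  exists a => //; exists G; split => //.
  apply: (@extract_bound y0 0 1 m 1 r r C y v (G m 0)) => //; first by rewrite mul1r.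
    by move=> u u2; apply: HC => //; rewrite mul1r in u2 *.
  move=> dl dl0; have [h0 h00 Hh] := fdn_jet_lim m a0 JG dl0.
  pose s0 := Num.min 1 (Num.min h0 (a / (m%:R + 1))).
  have m1 : 0 < m%:R + 1 :> R by rewrite ltr_wpDl.
  exists s0; first by rewrite !lt_min ltr01 h00 divr_gt0.
  move=> s; rewrite !lt_min => /andP[sp /andP[s1 /andP[sh sa]]].
  have s2s : s ^+ 2 <= s by rewrite expr2 -[leRHS]mulr1 ler_pM2l// ltW.
  have hm : 0 <= s ^+ (2 * 1) / m%:R <= s.
    rewrite divr_ge0 ?exprn_ge0 ?(ltW sp)//=.
    have [->|m0] := posnP m; first by rewrite invr0 mulr0 ltW.
    rewrite ler_pdivrMr ?ltr0n// (le_trans s2s)// ler_peMr ?(ltW sp)// ler1n//.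
  have /andP[hm0 hms] := hm.
  rewrite scaler0 addr0 fdn_line0.
  have -> : fdn m (s ^+ (2 * 1) / m%:R) (fun s1 : R => f (y + s1 *: v)) 0 =
            fdn m (s ^+ (2 * 1) / m%:R) (G 0%N) 0.
    rewrite !fdn_sum; apply: eq_bigr => j _; congr (_ * _); rewrite G0//.
    rewrite add0r ger0_norm ?mulrn_wge0//.
    rewrite ltr_pdivlMr// in sa; apply: le_lt_trans sa; rewrite -[_ *+ j]mulr_natr.
    by apply: ler_pM => //; rewrite natr1 ler_nat ltnW.
  by apply: Hh; rewrite hm0 (le_lt_trans hms).
have C0 : 0 <= C.
  apply: le_trans (HC y0 0 (nbhs_singleton Xy0) _ _); first by [].
    by rewrite subrr normr0.
  by rewrite normr0 divr_ge0.
have B0 : 0 <= B / 2^-1 ^+ m by rewrite /B !mulr_ge0// ?invr_ge0 ?exprn_ge0.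
exists (Num.min eps' r), (polcst m (B / 2^-1 ^+ m)); split; first by rewrite lt_min e0.
exact: pure_mixed.
Qed.

End HolderBounds.

Section BoundaryBounds.
Variables (R : realType) (d : nat).
Implicit Types (x y v w z : 'rV[R]_d) (t s : R).
Variables (M : nat -> R) (M0 : positive_seq M) (lc : log_convex M) (nq : non_quasianalytic M).
Variables (X : set 'rV[R]_d) (f : 'rV[R]_d -> R) (fA : AinfM M X f).

Let U := interior X.
Let oU : open U. Proof. exact: open_interior. Qed.
Let Hm : mixed_loc U f. Proof. exact: interior_mixed fA. Qed.

Lemma derivs_nseq_jet v z (O : set R) : (forall t, O t -> U (z + t *: v)) ->
  jet_on O (fun k t => derivs (nseq k v) f (z + t *: v)).
Proof. by move=> H k t /H Ut; exact: (derivs_line (nseq k v) oU Hm Ut). Qed.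

Lemma boundary_derivs x0 e p (kap h eps : R) m : closed X -> 0 < h -> 0 < kap -> 0 < eps ->
  (0 < p)%N -> cusp_cond X x0 e p kap h eps ->
  exists2 K, 0 <= K & forall vs y, size vs = m -> U y -> `|y - x0| < eps / 2 ->
    `|derivs vs f y| <= K * nprod vs.
Proof.
move=> cX h0 k0 eps0 p0 S.
have [C' HC'] := gcurve_bound_compact M0 lc nq fA (2 * p * m) cX h0 k0 eps0 p0 S.
pose C := `|C'|.
have C0 : 0 <= C by exact: normr_ge0.
have HC y v : X y -> `|y - x0| <= eps / 2 -> `|v| <= kap / 2 ->
    `|derive1n (2 * p * m) (gcurve f e p y v) 0| <= C.
  by move=> h1 h2 h3; apply: le_trans (HC' y v h1 h2 h3) (ler_norm _).
pose B := m%:R ^+ m * 2 ^+ m * C.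
have B0 : 0 <= B by rewrite !mulr_ge0// exprn_ge0.
have e2 : eps / 2 < eps by rewrite ltr_pdivrMr// ltr_pMr// ltr1n.
have pureD y v : U y -> `|y - x0| < eps / 2 -> `|v| <= kap / 2 -> `|derivs (nseq m v) f y| <= B.
  move=> Uy yx vk.
  apply: (@extract_bound R d M M0 lc nq X f fA x0 e p m kap h eps C y v) => //.
  - exact: interior_subset.
  - exact: lt_trans yx e2.
  - by move=> u uk; apply: HC => //; [exact: interior_subset|exact: ltW].
  move=> dl dl0.
  have cg : {for y, continuous (derivs (nseq m v) f)}.
    apply: differentiable_continuous.
    by have [] := mixed_loc_diff (mixed_loc_derivs (nseq m v) oU Hm) Uy.
  have /nbhs_ballP[r1 /= r10 Hr1] : nbhs y U by exact: open_nbhs_nbhs.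
  have /cvgrPdist_le/(_ dl dl0)/nbhs_ballP[r2 /= r20 Hr2] := cg.
  pose r := Num.min r1 r2; have r0 : 0 < r by rewrite lt_min r10.
  have ev0 : 0 < `|e| + `|v| + 1 by rewrite ltr_wpDl// addr_ge0.
  exists (Num.min 1 (r / (`|e| + `|v| + 1))); first by rewrite lt_min ltr01 divr_gt0.
  move=> s; rewrite lt_min => /andP[sp /andP[s1 sr]].
  rewrite ltr_pdivlMr// in sr.
  have s2s : s ^+ 2 <= s by rewrite expr2 -[leRHS]mulr1 ler_pM2l// ltW.
  have sps : s ^+ (2 * p) <= s.
    have : s ^+ (2 * p) <= s ^+ 1 by rewrite ler_wiXn2l ?(ltW sp) ?(ltW s1)// muln_gt0.
    by rewrite expr1.
  pose q := s ^+ (2 * p) / m%:R.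
  have q0 : 0 <= q by rewrite divr_ge0// exprn_ge0// ltW.
  have qm : q *+ m <= s.
    rewrite /q -[_ *+ m]mulr_natr; have [->|m0] := posnP m; first by rewrite mulr0 ltW.
    by rewrite divfK// pnatr_eq0 -lt0n.
  rewrite -/q fdn_line0 -{3}(ger0_norm q0).
  have near t : seg 0 (0 + q *+ m) t -> `|y + s ^+ 2 *: e + t *: v - y| < r.
    move/(seg_ge _ _ (mulrn_wge0 m q0)); rewrite add0r => /andP[t0 tq].
    rewrite -[y + _ + _]addrA [_ - y]addrC addKr (le_lt_trans (ler_normD _ _))//.
    have -> : `|s ^+ 2 *: e| = s ^+ 2 * `|e| by rewrite normrZ ger0_norm// sqr_ge0.
    have -> : `|t *: v| = t * `|v| by rewrite normrZ ger0_norm.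
    apply: le_lt_trans sr; rewrite !mulrDr mulr1.
    have h1 : s ^+ 2 * `|e| <= s * `|e| by rewrite ler_wpM2r.
    have h2 : t * `|v| <= s * `|v| by rewrite ler_wpM2r// (le_trans tq).
    by move: h1 h2 sp; lra.
  apply: (@fdn_jet_le R m q (fun k t => derivs (nseq k v) f (y + s ^+ 2 *: e + t *: v)) 0).
    apply: derivs_nseq_jet => t /near; rewrite lt_min => /andP[h1 _].
    by apply: Hr1; rewrite -ball_normE /= distrC.
  move=> t /near; rewrite lt_min => /andP[_ h2]; rewrite distrC.
  by apply: Hr2; rewrite -ball_normE /= distrC.
have k20 : 0 < kap / 2 by rewrite divr_gt0.
exists (polcst m (B / (kap / 2) ^+ m)).
  by rewrite /polcst !mulr_ge0// ?exprn_ge0// ?invr_ge0 ?exprn_ge0// ltW.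
move=> vs y sz Uy yx.
have /nbhs_ballP[r1 /= r10 Hr1] : nbhs y U by exact: open_nbhs_nbhs.
pose r := Num.min r1 (eps / 2 - `|y - x0|).
have r0 : 0 < r by rewrite lt_min r10 subr_gt0.
have inU z : `|z - y| < r -> U z /\ `|z - x0| < eps / 2.
  rewrite lt_min => /andP[h1 h2]; split; first by apply: Hr1; rewrite -ball_normE /= distrC.
  by rewrite -[z - x0](subrKA y) (le_lt_trans (ler_normD _ _))// -ltrBrDr.
have Hp : pure_at f y m r (B / (kap / 2) ^+ m).
  apply: pure_of_line => // z v zy vk.
  have v0 : 0 < `|v| + 1 by rewrite ltr_wpDl.
  exists ((r - `|z - y|) / (`|v| + 1)); first by rewrite divr_gt0// subr_gt0.
  exists (fun k t => derivs (nseq k v) f (z + t *: v)); split=> //.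
    apply: derivs_nseq_jet => t /=; rewrite ltr_pdivlMr// => tr; apply: (inU _ _).1.
    rewrite addrAC (le_lt_trans (ler_normD _ _))// [ltLHS]addrC -ltrBrDr normrZ.
    by apply: le_lt_trans tr; rewrite ler_wpM2l// lerDl.
  rewrite scale0r addr0; have [Uz zx] := inU z zy; exact: pureD.
have B'0 : 0 <= B / (kap / 2) ^+ m by rewrite divr_ge0// exprn_ge0// ltW.
apply: (derivs_le oU Hm Uy r0); rewrite sz; exact: pure_mixed.
Qed.

End BoundaryBounds.

Section CuspGeometry.
Variables (R : realType) (n : nat).
Implicit Types (x y v w z : 'rV[R]_n.+1).

Lemma uniform_cusp_cond (X : set 'rV[R]_n.+1) (alpha : R) x0 :
  alpha_set alpha X -> X x0 -> ~ (interior X) x0 ->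
  exists e p (kap h eps : R), [/\ 0 < kap, 0 < h, 0 < eps, (0 < p)%N &
    forall y w (q : R), X y -> `|y - x0| < eps -> 0 < q <= h -> `|w| <= kap * q ^+ p ->
      (interior X) (y + q *: e + w)].
Proof.
move=> [a0 [a1 [[cX [fX _]] uc]]] Xx0 nX.
have clX : closure (interior X) = X by rewrite -fX.
have [|eps [r [h [A [eps0 r0 h0 oA H]]]]] := uc x0; first by split; rewrite ?clX.
pose p := (Num.truncn alpha^-1).+1.
have pa : 1 <= p%:R * alpha.
  have : alpha^-1 < p%:R by have /andP[] := truncn_itv (ltW (eq_ind_r _ a0 (invr_gt0 alpha))).
  by rewrite -[alpha^-1]div1r ltr_pdivrMr// => /ltW.
pose L := \sum_(i < n.+1) \sum_(j < n.+1) `|A i j| + 1.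
have L1 : 1 <= L by rewrite lerDr; apply: sumr_ge0 => i _; exact: sumr_ge0.
have L0 : 0 < L by exact: lt_le_trans ltr01 L1.
have wA w i : `|(w *m A^T) 0 i| <= L * `|w|.
  rewrite mxE (le_trans (ler_norm_sum _ _ _))//.
  apply: (@le_trans _ _ (\sum_(j < n.+1) `|A i j| * `|w|)).
    apply: ler_sum => j _; rewrite normrM mulrC mxE ler_wpM2l//; exact: coord_le_norm.
  rewrite -mulr_suml ler_wpM2r//; apply: (@le_trans _ _ (L - 1)); last by rewrite gerBl.
  rewrite /L addrK [leRHS](bigD1 i)//= lerDl.
  by apply: sumr_ge0 => k _; exact: sumr_ge0.
pose mu := Num.min (Num.min 2^-1 (r / 2)) (r * (1 / (4 * h)) `^ alpha^-1).
have mu0 : 0 < mu by rewrite !lt_min invr_gt0 ltr0n divr_gt0//= mulr_gt0// powR_gt0// divr_gt0// mulr_gt0.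
have mu12 : mu <= 2^-1 by rewrite !ge_min lexx.
have mur : mu <= r / 2 by rewrite !ge_min lexx !orbT.
have muh : h * (mu / r) `^ alpha <= 1 / 4.
  have : (mu / r) `^ alpha <= 1 / (4 * h).
    have -> : 1 / (4 * h) = ((1 / (4 * h)) `^ alpha^-1) `^ alpha.
      by rewrite -powRrM mulVf ?gt_eqF// powRr1// divr_ge0// mulr_ge0// ltW.
    apply: ge0_ler_powR; rewrite ?nnegrE ?powR_ge0 ?(ltW a0) ?divr_ge0 ?(ltW mu0) ?(ltW r0)//.
    by rewrite ler_pdivrMr// mulrC !ge_min lexx !orbT.
  move/(ler_wpM2l (ltW h0))/le_trans; apply.
  by rewrite le_eqVlt; apply/orP; left; apply/eqP; field; rewrite gt_eqF.
have N0 : 0 < n.+1%:R * L by rewrite mulr_gt0.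
exists (delta_mx 0 ord_max *m A), p, (mu / (n.+1%:R * L)), (Num.min 1 (h / 2)), (eps / n.+1%:R).
split; [exact: divr_gt0|by rewrite lt_min ltr01 divr_gt0|by rewrite divr_gt0|by []|].
move=> y w q Xy yx /andP[q0]; rewrite le_min => /andP[q1 qh] wq.
have AA : A^T *m A = 1%:M by exact: mulmx1C.
pose z := q *: delta_mx 0 ord_max + w *m A^T : 'rV[R]_n.+1.
have -> : y + q *: (delta_mx 0 ord_max *m A) + w = y + z *m A.
  by rewrite /z mulmxDl -scalemxAl -mulmxA AA mulmx1 addrA.
have en v : enorm v <= n.+1%:R * `|v|.
  rewrite (le_trans (enorm_le_sum _))//.
  apply: (@le_trans _ _ (\sum_(i < n.+1) `|v|)); first by apply: ler_sum => i _; exact: coord_le_norm.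
  by rewrite sumr_const card_ord mulr_natl.
have qpq : q ^+ p <= q.
  have : q ^+ p <= q ^+ 1 by rewrite ler_wiXn2l// ltW.
  by rewrite expr1.
have qp0 : 0 < q ^+ p by rewrite exprn_gt0.
have Lw : n.+1%:R * L * `|w| <= mu * q ^+ p.
  by rewrite mulrC; move: wq; rewrite mulrAC ler_pdivlMr.
have wl : L * `|w| <= mu * q ^+ p.
  by apply: le_trans Lw; rewrite -mulrA ler_peMl ?ler1n ?mulr_ge0 ?(ltW L0).
have muq : mu * q ^+ p <= mu * q by rewrite ler_pM2l.
have muq2 : mu * q <= 2^-1 * q by rewrite ler_pM2r.
have zl : xlast z = q + (w *m A^T) 0 ord_max.
  by rewrite /xlast /z !mxE !eqxx mulr1.
have zl1 : q / 2 <= xlast z <= 3 / 2 * q.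
  have := wA w ord_max; rewrite zl ler_norml; move: wl muq muq2.
  by lra.
have zi i : z 0 (widen_ord (leqnSn n) i) = (w *m A^T) 0 (widen_ord (leqnSn n) i).
  have E0 : (q *: (delta_mx 0 ord_max : 'rV[R]_n.+1)) 0 (widen_ord (leqnSn n) i) = 0.
    have ne : (widen_ord (leqnSn n) i == ord_max) = false.
      by apply/negbTE; rewrite -val_eqE /= ltn_eqF.
    by rewrite !mxE ne andbF mulr0.
  by rewrite /z [LHS]mxE E0 add0r.
have zp : xprime_norm z <= mu * q ^+ p.
  have S0 : 0 <= \sum_(i < n) `|(w *m A^T) 0 (widen_ord (leqnSn n) i)| by exact: sumr_ge0.
  apply: (@le_trans _ _ (\sum_(i < n) `|(w *m A^T) 0 (widen_ord (leqnSn n) i)|)).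
    rewrite /xprime_norm -(ger0_norm S0) -sqrtr_sqr ler_sqrt ?sqr_ge0//.
    apply: (@le_trans _ _ (\sum_(i < n) `|(w *m A^T) 0 (widen_ord (leqnSn n) i)| ^+ 2)); last exact: sum_sqr_le.
    by apply: ler_sum => i _; rewrite real_normK ?num_real// zi.
  apply: le_trans Lw.
  apply: (@le_trans _ _ (\sum_(i < n) L * `|w|)); first by apply: ler_sum => i _; exact: wA.
  rewrite sumr_const card_ord -[_ *+ n]mulr_natl -[leRHS]mulrA ler_wpM2r ?mulr_ge0 ?(ltW L0)//.
  by rewrite ler_nat.
have zp0 : 0 <= xprime_norm z by exact: sqrtr_ge0.
apply: H.
- by rewrite clX.
- by rewrite (le_lt_trans (en _))// mulrC -ltr_pdivlMr.
- split; last split.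
  + by apply: (le_lt_trans zp); move: muq mur q1 r0; nra.
  + apply: (@lt_le_trans _ _ (q / 2)); last by have /andP[] := zl1.
    apply: (@le_lt_trans _ _ (h * ((mu / r) `^ alpha * q))).
      rewrite ler_pM2l//.
      apply: (@le_trans _ _ ((mu / r * q ^+ p) `^ alpha)).
        apply: ge0_ler_powR; rewrite ?nnegrE ?(ltW a0)//.
        * by rewrite divr_ge0// ltW.
        * by rewrite !mulr_ge0// ?invr_ge0 ltW.
        * by rewrite mulrAC ler_pM2r ?invr_gt0.
      rewrite powRM ?divr_ge0 ?(ltW mu0) ?(ltW r0) ?(ltW qp0)// ler_wpM2l ?powR_ge0//.
      rewrite -powR_mulrn ?(ltW q0)// -powRrM.
      have := @ger_powR R q; rewrite q0 q1 => /(_ isT 1 (p%:R * alpha) pa).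
      by rewrite powRr1// ltW.
    rewrite mulrA; apply: (@le_lt_trans _ _ (1 / 4 * q)); first by rewrite ler_pM2r.
    by move: q0; lra.
  + have /andP[_ h2] := zl1; apply: (le_lt_trans h2); move: qh q0 h0; lra.
Qed.

End CuspGeometry.

(** * Extension across the boundary *)

Section Cutoff.
Variables (R : realType).
Implicit Types (t s : R).

Lemma leib_eq0r k (u v : nat -> R -> R) t : (forall i, v i t = 0) -> leib k u v t = 0.
Proof.
elim: k u v => [|k IH] u v H /=; first by rewrite H mulr0.
by rewrite !IH// addr0.
Qed.

Fixpoint prodjet (us : seq (nat -> R -> R)) : nat -> R -> R :=
  if us is u :: us' then fun k => leib k u (prodjet us')
  else fun k _ => if k is 0%N then 1 else 0.

Lemma prodjet_jet O us : (forall u, List.In u us -> jet_on O u) -> jet_on O (prodjet us).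
Proof.
elim: us => [|u us IH] H /=; first exact: jet_cst.
by apply: jet_leib; [apply: H; left|apply: IH => w wu; apply: H; right].
Qed.

Lemma prodjet0 us t : prodjet us 0%N t = \prod_(u <- us) u 0%N t.
Proof. by elim: us => [|u us IH] /=; [rewrite big_nil|rewrite big_cons IH]. Qed.

Lemma prodjet_eq0 us k t u : List.In u us -> (forall i, u i t = 0) -> prodjet us k t = 0.
Proof.
move=> uus H; elim: us k uus => //= w us IH k [->|wus]; first exact: leib_eq0.
by apply: leib_eq0r => i; exact: IH.
Qed.

Fixpoint prodbnd (Th : nat -> R) n k := if n is n'.+1 then Th k * prodbnd Th n' k * 2 ^+ k else 1.

Lemma prodbnd_mono Th n k l : (forall i, 0 <= Th i) -> (forall i j, (i <= j)%N -> Th i <= Th j) ->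
  (k <= l)%N -> 0 <= prodbnd Th n k <= prodbnd Th n l.
Proof.
move=> T0 Tm kl; elim: n => [|n /andP[IH1 IH2]] /=; first by rewrite ler01 lexx.
rewrite !mulr_ge0// ?exprn_ge0//=; apply: ler_pM; rewrite ?mulr_ge0 ?exprn_ge0//.
  by apply: ler_pM => //; exact: Tm.
by rewrite ler_eXn2l// ltr1n.
Qed.

Lemma prodjet_le us k t (D : R) (Th : nat -> R) : 0 <= D -> (forall i, 0 <= Th i) ->
  (forall i j, (i <= j)%N -> Th i <= Th j) ->
  (forall u, List.In u us -> forall i, `|u i t| <= Th i * D ^+ i) ->
  `|prodjet us k t| <= prodbnd Th (size us) k * D ^+ k.
Proof.
move=> D0 T0 Tm; elim: us k => [|u us IH] k H /=.
  by case: k => [|k]; [rewrite normr1 expr0 mulr1|rewrite normr0 mul1r exprn_ge0].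
have -> : Th k * prodbnd Th (size us) k * 2 ^+ k * D ^+ k =
  Th k * prodbnd Th (size us) k * (2 * D) ^+ k by rewrite exprMn mulrA.
apply: leib_le => // i ik.
  by apply: (le_trans (H u _ i)); [left|rewrite ler_wpM2r ?exprn_ge0// Tm].
apply: (le_trans (IH i _)); first by move=> w wu; apply: H; right.
by rewrite ler_wpM2r ?exprn_ge0//; have /andP[] := prodbnd_mono (size us) T0 Tm ik.
Qed.

Lemma telescope_window (g : R -> R) s N :
  \sum_(q < N) (g (s - q%:R + 1) - g (s - q%:R)) = g (s + 1) - g (s - N%:R + 1).
Proof.
elim: N => [|N IH]; first by rewrite big_ord0 subr0 subrr.
rewrite big_ord_recr /= IH.
have -> : s - N.+1%:R + 1 = s - N%:R by rewrite -natr1; ring.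
by ring.
Qed.

Variables (d : nat).
Implicit Types (x y v w z : 'rV[R]_d).

Lemma cutoff (M : nat -> R) (X : set 'rV[R]_d) x0 : positive_seq M -> non_quasianalytic M ->
  exists2 A : nat -> R, (forall m, 0 <= A m) /\ (forall i j, (i <= j)%N -> A i <= A j) &
  forall dl : R, 0 < dl <= 1 -> exists (chi : 'rV[R]_d -> R) (J : 'rV[R]_d -> 'rV[R]_d -> nat -> R -> R),
  [/\ forall y, X y -> `|y - x0| <= 1 -> chi y = 1,
      forall y v, jet_on setT (J y v),
      forall y v t, J y v 0%N t = chi (y + t *: v),
      forall y v m t, `|v| <= 1 -> `|J y v m t| <= A m * dl^-1 ^+ (m + d) &
      forall y v m t, (forall z, X z -> 2 * dl < `|y + t *: v - z|) -> J y v m t = 0].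
Proof.
move=> M0 nq; have [P [JP [P01 P0] P1 Pout bP]] := beurling_step M0 nq.
have [C C0 HC] := bP 1 ltr01.
pose th k t := P k (t + 1) - P k t.
have Jth : jet_on setT th.
  apply: jet_sub => // k t _; apply: isd_shift; exact: JP.
have thout k t : 1 < `|t| -> th k t = 0.
  move=> H; rewrite /th; have {}H : t < -1 \/ 1 < t.
    move: H; have [t0|/ltW t0] := leP 0 t; [rewrite ger0_norm//|rewrite ler0_norm//]; lra.
  case: k => [|k].
    case: H => H; first by rewrite !P0 ?subr0//; lra.
    by rewrite !P1 ?subrr//; lra.
  by rewrite !Pout ?subr0//; case: H; lra.
pose Th k := \sum_(i < k.+1) 2 * (C * i`!%:R * M i).
have Ti i : 0 <= 2 * (C * i`!%:R * M i) by rewrite !mulr_ge0// ltW.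
have Th0 i : 0 <= Th i by apply: sumr_ge0 => j _.
have Thm i j : (i <= j)%N -> Th i <= Th j.
  move=> ij; rewrite /Th -!(big_mkord xpredT (fun i => 2 * (C * i`!%:R * M i))).
  have ij1 : (i.+1 <= j.+1)%N by [].
  by rewrite (big_cat_nat (leq0n i.+1) ij1)/= lerDl; apply: sumr_ge0.
have thb k t : `|th k t| <= Th k.
  have b s : `|P k s| <= C * k`!%:R * M k by have := HC k s; rewrite expr1n mulr1.
  rewrite /Th big_ord_recr /= (le_trans (ler_normB _ _))// ler_wpDl ?sumr_ge0//.
  by rewrite mulrDl mul1r lerD.
exists (fun m => 6 ^+ d * prodbnd Th d m).
  split=> [m|i j ij].
    by rewrite mulr_ge0 ?exprn_ge0//; have /andP[] := prodbnd_mono d Th0 Thm (leqnn m).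
  by rewrite ler_wpM2l ?exprn_ge0//; have /andP[] := prodbnd_mono d Th0 Thm ij.
move=> dl /andP[dl0 dl1].
pose N := (Num.truncn dl^-1).+2.
have di : 1 <= dl^-1 by rewrite invf_ge1.
have /andP[N1 N2] : (N.-2)%:R <= dl^-1 < (N.-1)%:R by apply: truncn_itv; rewrite (le_trans ler01).
pose pt (q : 'I_(N + N)) : R := q%:R - N%:R.
pose near (Q : {ffun 'I_d -> 'I_(N + N)}) := `[< exists2 z, X z &
   forall i, `|dl^-1 * (z 0 i - x0 0 i) - pt (Q i)| <= 1 >].
pose fac y v (Q : {ffun 'I_d -> 'I_(N + N)}) (i : 'I_d) k t :=
  (dl^-1 * v 0 i) ^+ k * th k ((dl^-1 * v 0 i) * t + (dl^-1 * (y 0 i - x0 0 i) - pt (Q i))).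
pose us y v Q := [seq fac y v Q i | i <- enum 'I_d].
pose T y v Q := prodjet (us y v Q).
pose J y v k t := \sum_(Q | near Q) T y v Q k t.
pose chi y := \sum_(Q | near Q) \prod_(i < d) th 0%N (dl^-1 * (y 0 i - x0 0 i) - pt (Q i)).
have inus y v Q u : List.In u (us y v Q) -> exists i, u = fac y v Q i.
  rewrite /us; elim: (enum 'I_d) => //= i r IH [<-|/IH//]; by exists i.
have usin y v Q i : List.In (fac y v Q i) (us y v Q).
  rewrite /us; have : i \in enum 'I_d by rewrite mem_enum.
  elim: (enum 'I_d) => //= j r IH; rewrite inE => /orP[/eqP <-|/IH]; by [left|right].
have Jfac y v Q i : jet_on setT (fac y v Q i).
  by apply: jet_on_sub (@jet_affine R setT th (dl^-1 * v 0 i) (dl^-1 * (y 0 i - x0 0 i) - pt (Q i)) Jth).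
have argE y v Q i t : (dl^-1 * v 0 i) * t + (dl^-1 * (y 0 i - x0 0 i) - pt (Q i)) =
    dl^-1 * ((y + t *: v) 0 i - x0 0 i) - pt (Q i) by rewrite !mxE; ring.
exists chi, J; split.
- move=> y Xy yx.
  have -> : chi y = \sum_(Q : {ffun 'I_d -> 'I_(N + N)}) \prod_(i < d) th 0%N (dl^-1 * (y 0 i - x0 0 i) - pt (Q i)).
    rewrite /chi big_mkcond; apply: eq_bigr => Q _; case: ifPn => // /asboolPn nQ.
    apply/esym/eqP/prodf_eq0.
    have [i hi] : exists i, 1 < `|dl^-1 * (y 0 i - x0 0 i) - pt (Q i)|.
      apply: contrapT => H; apply: nQ; exists y => // i.
      by rewrite leNgt; apply/negP => hi; apply: H; exists i.
    by exists i => //; rewrite thout.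
  rewrite -(bigA_distr_bigA (fun i (q : 'I_(N + N)) => th 0%N (dl^-1 * (y 0 i - x0 0 i) - pt q))).
  apply: big1 => i _; pose s := dl^-1 * (y 0 i - x0 0 i) + N%:R.
  have sb : `|dl^-1 * (y 0 i - x0 0 i)| < N.-1%:R.
    apply: le_lt_trans N2; rewrite normrM gtr0_norm ?invr_gt0// ler_piMr ?invr_ge0 ?(ltW dl0)//.
    by apply: le_trans yx; have := coord_le_norm (y - x0) i; rewrite !mxE.
  have Nn : N%:R = N.-1%:R + 1 :> R by rewrite natr1.
  rewrite (eq_bigr (fun q : 'I_(N + N) => P 0%N (s - q%:R + 1) - P 0%N (s - q%:R))); last first.
    by move=> q _; rewrite /th /pt /s; congr (P 0%N _ - P 0%N _); ring.
  rewrite telescope_window natrD P1 ?P0 ?subr0//; move: sb; rewrite ltr_norml /s Nn; lra.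
- move=> y v; apply: jet_sum => Q _; apply: prodjet_jet => u /inus[i ->]; exact: Jfac.
- move=> y v t; apply: eq_bigr => Q _; rewrite /T prodjet0 big_map big_enum /=.
  by apply: eq_bigr => i _; rewrite /fac expr0 mul1r argE.
- move=> y v m t v1.
  have TB Q : `|T y v Q m t| <= prodbnd Th d m * dl^-1 ^+ m.
    have := @prodjet_le (us y v Q) m t dl^-1 Th (le_trans ler01 di) Th0 Thm.
    rewrite size_map size_enum_ord; apply => u /inus[i ->] k.
    rewrite /fac normrM normrX mulrC; apply: ler_pM; [by []|by rewrite exprn_ge0|exact: thb|].
    rewrite lerXn2r ?nnegrE ?invr_ge0 ?(ltW dl0)// normrM [`|dl^-1|]gtr0_norm ?invr_gt0//.
    rewrite ler_piMr ?invr_ge0 ?(ltW dl0)//.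
    by apply: le_trans v1; exact: coord_le_norm.
  have B0 : 0 <= prodbnd Th d m * dl^-1 ^+ m.
    by rewrite mulr_ge0 ?exprn_ge0 ?invr_ge0 ?(ltW dl0)//; have /andP[] := prodbnd_mono d Th0 Thm (leqnn m).
  rewrite /J (le_trans (ler_norm_sum _ _ _))//.
  apply: (@le_trans _ _ (\sum_(Q : {ffun 'I_d -> 'I_(N + N)}) prodbnd Th d m * dl^-1 ^+ m)).
    by rewrite big_mkcond /=; apply: ler_sum => Q _; case: ifP.
  rewrite sumr_const card_ffun !card_ord -[_ *+ _]mulr_natl natrX exprD.
  have -> : 6 ^+ d * prodbnd Th d m * (dl^-1 ^+ m * dl^-1 ^+ d) =
    (6 * dl^-1) ^+ d * (prodbnd Th d m * dl^-1 ^+ m) by rewrite exprMn; ring.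
  rewrite ler_wpM2r// lerXn2r ?nnegrE ?mulr_ge0 ?invr_ge0 ?(ltW dl0)//.
  have Nn : N%:R = N.-2%:R + 1 + 1 :> R by rewrite !natr1.
  by rewrite natrD Nn; move: N1 di; lra.
- move=> y v m t H; apply: big1 => Q /asboolP[z Xz nz].
  have [i hi] : exists i, 1 < `|dl^-1 * ((y + t *: v) 0 i - x0 0 i) - pt (Q i)|.
    apply: contrapT => H'.
    have := H z Xz; rewrite ltNge => /negP; apply.
    apply: norm_le_coord; first by rewrite mulr_ge0// ltW.
    move=> i; have h1 : `|dl^-1 * ((y + t *: v) 0 i - x0 0 i) - pt (Q i)| <= 1.
      by rewrite leNgt; apply/negP => hi; apply: H'; exists i.
    have h2 := nz i.
    have -> : (y + t *: v - z) 0 i = dl * ((dl^-1 * ((y + t *: v) 0 i - x0 0 i) - pt (Q i)) -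
        (dl^-1 * (z 0 i - x0 0 i) - pt (Q i))).
      rewrite [(_ - z) 0 i]mxE [(- z) 0 i]mxE; move: ((y + t *: v) 0 i) => q.
      by field; rewrite gt_eqF.
    rewrite normrM gtr0_norm// mulrC ler_pM2r// (le_trans (ler_normB _ _))//.
    by move: h1 h2; lra.
  apply: (@prodjet_eq0 _ _ _ (fac y v Q i)); first exact: usin.
  by move=> k; rewrite /fac argE thout// mulr0.
Qed.

End Cutoff.

Section Extrapolation.
Variable R : realType.
Implicit Types (u : nat -> R -> R) (t s : R).

Definition pcoef (N j : nat) : R := - ((-1) ^+ N * bcoef R N j).

(* The value at 0 predicted by the values at [e, 2 e, ..., N e]; exact for
   polynomials of degree less than [N]. *)
Definition extrap (N : nat) (e : R) (g : R -> R) : R :=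
  \sum_(j < N) pcoef N j.+1 * g (e *+ j.+1).

Lemma extrap_fdn N e g : extrap N e g = g 0 - (-1) ^+ N * fdn N e g 0.
Proof.
rewrite fdn_sum big_ord_recl /= mulr0n addr0 mulrDr /bcoef subn0 bin0 mulr1.
have s1 : (-1) ^+ N * (-1) ^+ N = 1 :> R by rewrite -expr2 sqrr_sign.
rewrite opprD mulrA s1 mul1r addrA subrr add0r mulr_sumr -sumrN.
by apply: eq_bigr => j _; rewrite /bump leq0n add1n add0r /pcoef /bcoef; ring.
Qed.

Lemma pcoef_norm_sum N : \sum_(j < N) `|pcoef N j.+1| <= 2 ^+ N.
Proof.
rewrite -bcoef_norm_sum [leRHS]big_ord_recl /= ler_wpDl//.
by apply: ler_sum => j _; rewrite /pcoef normrN normrM normrX normrN1 expr1n mul1r.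
Qed.

Lemma extrap_le N e (g : R -> R) (C : R) : 0 <= C ->
  (forall j, (j < N)%N -> `|g (e *+ j.+1)| <= C) -> `|extrap N e g| <= 2 ^+ N * C.
Proof.
move=> C0 H; rewrite /extrap (le_trans (ler_norm_sum _ _ _))//.
apply: le_trans (ler_wpM2r C0 (pcoef_norm_sum N)); rewrite mulr_suml.
by apply: ler_sum => j _; rewrite normrM ler_wpM2l// H.
Qed.

Lemma extrap_sub N e (g g' : R -> R) :
  extrap N e (fun s => g s - g' s) = extrap N e g - extrap N e g'.
Proof. by rewrite -sumrB; apply: eq_bigr => j _; rewrite mulrBr. Qed.

Lemma taylor_jet N u (a : R) :
  jet_on setT (fun k => taylor (N - k) (fun i => u (i + k)%N) a).
Proof.
move=> k t _; have [kN|Nk] := ltnP k N.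
  rewrite -(subnSK kN); have := isd_taylorS (N - k.+1) (fun i => u (i + k)%N) a t.
  have -> : (fun i => u (i.+1 + k)%N) = (fun i => u (i + k.+1)%N) by apply/funext => i; rewrite addSnnS.
  by [].
have -> : (N - k = 0)%N by apply/eqP; rewrite subn_eq0.
have -> : (N - k.+1 = 0)%N by apply/eqP; rewrite subn_eq0 ltnW.
exact: isd_cst.
Qed.

Lemma extrap_taylor N N' e u (a : R) : (N <= N')%N -> extrap N' e (taylor N u a) = taylor N u a 0.
Proof.
move=> NN; rewrite extrap_fdn.
have := @fdn_jet_le R N' e (fun k => taylor (N - k) (fun i => u (i + k)%N) a) 0 0 0.
rewrite mul0r subr0 mul0r subn0 => /(_ _ _).
have j1 : jet_on (seg 0 (0 + e *+ N')) (fun k => taylor (N - k) (fun i => u (i + k)%N) a).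
  by apply: jet_on_sub (@taylor_jet N u a).
have j2 s : seg 0 (0 + e *+ N') s -> `|taylor (N - N') (fun i => u (i + N')%N) a s - 0| <= 0.
  by move=> _; rewrite (eqP (_ : (N - N' == 0)%N)) ?subn_eq0//= subr0 normr0.
move=> /(_ j1 j2); rewrite normr_le0.
have -> : (fun i => u (i + 0)%N) = u by apply/funext => i; rewrite addn0.
by move=> /eqP ->; rewrite mulr0 subr0.
Qed.

Lemma extrap_cst N e (c : R) : (0 < N)%N -> extrap N e (fun=> c) = c.
Proof.
move=> N0; rewrite extrap_fdn; case: N N0 => // N _.
suff E t : fdn N.+1 e (fun=> c) t = 0 by rewrite E mulr0 subr0.
elim: N t => [|N IH] t; first by rewrite /= subrr.
by change (fdn N.+1 e (fun=> c) (t + e) - fdn N.+1 e (fun=> c) t = 0); rewrite !IH subr0.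
Qed.

Lemma extrap_err N N' e u (a b K : R) : (N <= N')%N -> 0 < a <= e -> e *+ N' <= b -> a <= b ->
  jet_on [set s | a <= s <= b] u -> (forall s, a <= s <= b -> `|u N s| <= K) ->
  `|extrap N' e (u 0%N) - taylor N u a 0| <= 2 ^+ N' * (K * (e *+ N') ^+ N).
Proof.
move=> NN /andP[a0 ae] eb ab J H.
have e0 : 0 < e by exact: lt_le_trans ae.
have K0 : 0 <= K by apply: le_trans (H a _) => //; rewrite lexx.
rewrite -(extrap_taylor e u a NN) -extrap_sub; apply: extrap_le.
  by rewrite mulr_ge0// exprn_ge0// mulrn_wge0// ltW.
move=> j jN; set s := e *+ j.+1.
have es : e <= s by rewrite /s mulrS lerDl mulrn_wge0// ltW.
have sN : s <= e *+ N' by rewrite ler_wpMn2l// ltW.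
have as_ : a <= s by exact: le_trans es.
have sg x : seg a s x -> a <= x <= b.
  rewrite -[s](subrK a) [_ + a]addrC => /seg_ge; rewrite subr_ge0 => /(_ as_).
  by rewrite [a + _]addrC subrK => /andP[-> h] /=; rewrite (le_trans h)// (le_trans sN).
have := @taylor_le R N u a s K; move=> /(_ _ _)/le_trans; apply.
- by move=> k x /sg; exact: J.
- by move=> x /sg; exact: H.
- rewrite ler_wpM2l// lerXn2r ?nnegrE ?mulrn_wge0 ?(ltW e0)//.
  by rewrite ger0_norm ?subr_ge0// (le_trans _ sN)// gerBl ltW.
Qed.

Fixpoint lastb (P : nat -> bool) n := if n is n'.+1 then (if P n then n else lastb P n') else 0%N.

Lemma lastb_le P n : (lastb P n <= n)%N.
Proof. by elim: n => //= n IH; case: ifP => // _; exact: leqW. Qed.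

Lemma lastbP P n : (0 < lastb P n)%N -> P (lastb P n).
Proof. by elim: n => //= n IH; case: ifP. Qed.

Lemma lastb_ge (P : nat -> bool) n i : (i <= n)%N -> P i -> (i <= lastb P n)%N.
Proof.
elim: n => [|n IH]; first by rewrite leqn0 => /eqP ->.
by rewrite leq_eqVlt => /orP[/eqP -> Pn|/IH H Pi] /=; [rewrite Pn|case: ifP => // _; [rewrite (leq_trans (H Pi))// leqW// lastb_le|exact: H]].
Qed.

Lemma slow_sequence (K : nat -> R) : exists Ns : nat -> nat,
  [/\ forall k, (Ns k <= k)%N, forall k, (0 < Ns k)%N -> K (Ns k) <= 2 ^+ k &
      forall i, exists k0, forall k, (k0 <= k)%N -> (i <= Ns k)%N].
Proof.
exists (fun k => lastb (fun i => K i <= 2 ^+ k) k); split.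
- by move=> k; exact: lastb_le.
- by move=> k /lastbP.
- move=> i; pose q := (Num.truncn `|K i|).+1.
  exists (maxn i q) => k; rewrite geq_max => /andP[ik qk]; apply: lastb_ge => //.
  have /andP[_ h] := truncn_itv (normr_ge0 (K i)).
  rewrite (le_trans (ler_norm _))// (le_trans (ltW h))// -natrX ler_nat.
  by rewrite (leq_trans qk)// ltnW// ltn_expl.
Qed.

End Extrapolation.

Section Extension.
Variables (R : realType) (d : nat).
Implicit Types (x y v w z : 'rV[R]_d) (t s : R) (vs : seq 'rV[R]_d).
Variables (X U : set 'rV[R]_d) (f : 'rV[R]_d -> R) (x0 e : 'rV[R]_d) (p : nat) (kap h eps : R).
Hypotheses (kap0 : 0 < kap) (h0 : 0 < h) (eps0 : 0 < eps).
Hypotheses (oU : open U) (Hm : mixed_loc U f).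
Hypothesis cuspI : forall y w (q : R), X y -> `|y - x0| < eps -> 0 < q <= h ->
  `|w| <= kap * q ^+ p -> U (y + q *: e + w).
Variable Kb : nat -> R.
Hypothesis Kb0 : forall m, 0 <= Kb m.
Hypothesis HKb : forall vs y, U y -> `|y - x0| < eps / 2 ->
  `|derivs vs f y| <= Kb (size vs) * nprod vs.
Hypothesis rad : forall y, X y -> `|y - x0| < eps -> forall eta : R, 0 < eta ->
  exists2 s0, 0 < s0 & forall s, 0 < s < s0 -> `|f (y + s *: e) - f y| <= eta.
Variable A : nat -> R.
Hypotheses (A0 : forall m, 0 <= A m) (Amono : forall i j, (i <= j)%N -> A i <= A j).
Let E : R := `|e| + 1.
Let E0 : 0 < E. Proof. by rewrite ltr_wpDl. Qed.
Let c0 : R := Num.min (Num.min 4^-1 h) (eps / (8 * E)).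
Let c00 : 0 < c0. Proof. by rewrite !lt_min h0 invr_gt0 ltr0n divr_gt0// mulr_gt0. Qed.
Let c04 : c0 <= 4^-1. Proof. by rewrite !ge_min lexx. Qed.
Let c0h : c0 <= h. Proof. by rewrite !ge_min lexx !orbT. Qed.
Let c0e : c0 * E <= eps / 8.
Proof.
have : c0 <= eps / (8 * E) by rewrite !ge_min lexx !orbT.
by rewrite ler_pdivlMr ?mulr_gt0// mulrCA => h1; rewrite ler_pdivlMr// mulrC.
Qed.
Let r (k : nat) : R := 2^-1 ^+ k.
Let r0 k : 0 < r k. Proof. by rewrite exprn_gt0// invr_gt0. Qed.
Let r1 k : r k <= 1. Proof. by rewrite exprn_ile1// ?invr_ge0// invf_le1// ler1n. Qed.
Let rS k : r k.+1 = r k / 2. Proof. by rewrite /r exprSr. Qed.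
Let rk k : k.+1%:R * r k <= 1.
Proof.
rewrite /r exprVn ler_pdivrMr ?exprn_gt0// mul1r -natrX ler_nat; exact: ltn_expl.
Qed.
Let eg k : R := c0 * r k ^+ 3.
Let eg0 k : 0 < eg k. Proof. by rewrite mulr_gt0// exprn_gt0. Qed.
Let egS k : eg k.+1 <= eg k.
Proof.
rewrite ler_pM2l// lerXn2r ?nnegrE ?(ltW (r0 _))// rS ler_pdivrMr//.
by rewrite ler_peMr ?(ltW (r0 _))// ler1n.
Qed.
Let egn k n : (n <= k.+1)%N -> eg k *+ n <= c0 * r k ^+ 2.
Proof.
move=> nk; apply: (@le_trans _ _ (eg k * k.+1%:R)).
  by rewrite -[eg k *+ n]mulr_natr ler_pM2l// ler_nat.
rewrite /eg -mulrA ler_pM2l// exprSr -mulrA ler_piMr ?sqr_ge0// mulrC; exact: rk.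
Qed.
Let egc k n : (n <= k.+1)%N -> eg k *+ n <= c0.
Proof.
move=> nk; apply: (le_trans (egn nk)); rewrite ler_piMr ?(ltW c00)//.
by rewrite exprn_ile1 ?(ltW (r0 _)).
Qed.

Let eg_le1 k : eg k <= 1.
Proof. by have := @egc k 1 isT; rewrite mulr1n; move: c04; lra. Qed.

Let mu : R := Num.min (Num.min (kap / 3) 1) (eps / 8).
Let mu0 : 0 < mu. Proof. by rewrite !lt_min ltr01 !divr_gt0. Qed.
Let dl k : R := mu * eg k ^+ p.
Let dl0 k : 0 < dl k. Proof. by rewrite mulr_gt0// exprn_gt0. Qed.
Let dlmu k : dl k <= mu.
Proof. by rewrite ler_piMr ?(ltW mu0)// exprn_ile1// ltW. Qed.
Let dl1 k : dl k <= 1.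
Proof. by rewrite (le_trans (dlmu k))// !ge_min lexx !orbT. Qed.
Let rho : R := Num.min 1 (eps / 8).
Let rho0 : 0 < rho. Proof. by rewrite lt_min ltr01 divr_gt0. Qed.

Let inU k y z s : X z -> `|y - z| <= 3 * dl k -> `|y - x0| < rho -> eg k <= s <= c0 ->
  U (y + s *: e) /\ `|y + s *: e - x0| < eps / 2.
Proof.
move=> Xz yz yx /andP[s1 s2]; have s0 : 0 < s by exact: lt_le_trans s1.
have yx8 : `|y - x0| < eps / 8 by apply: lt_le_trans yx _; rewrite ge_min lexx orbT.
have mu8 : mu <= eps / 8 by rewrite ge_min lexx orbT.
have muk : mu <= kap / 3 by rewrite !ge_min lexx.
split.
  have -> : y + s *: e = z + s *: e + (y - z) by rewrite [RHS]addrAC [z + _]addrC subrK.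
  apply: cuspI => //.
  - rewrite -[z - x0](subrKA y) (le_lt_trans (ler_normD _ _))// distrC.
    by have := dlmu k; move: yz yx8 mu8 eps0; lra.
  - by rewrite s0 (le_trans s2).
  - apply: (le_trans yz); rewrite /dl mulrA; apply: ler_pM.
    + by rewrite mulr_ge0// ltW.
    + by rewrite exprn_ge0// ltW.
    + by move: muk; lra.
    + by rewrite lerXn2r ?nnegrE// ltW.
rewrite addrAC (le_lt_trans (ler_normD _ _))// normrZ gtr0_norm//.
have : s * `|e| <= eps / 8.
  apply: le_trans c0e; apply: ler_pM => //; first exact: ltW.
  by rewrite lerDl.
by move: yx8 eps0; lra.
Qed.

Definition Kbar N := (\sum_(j < (N + N).+1) Kb j) * E ^+ N.

Variable Ns : nat -> nat.
Hypotheses (Ns_le : forall k, (Ns k <= k)%N)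
  (Ns_K : forall k, (0 < Ns k)%N -> Kbar (Ns k) <= 2 ^+ k)
  (Ns_inf : forall i, exists k0, forall k, (k0 <= k)%N -> (i <= Ns k)%N).

Let Pop k (g : 'rV[R]_d -> R) y : R := extrap (Ns k) (eg k) (fun s => g (y + s *: e)).
Let gj k y v m t : R :=
  Pop k.+1 (derivs (nseq m v) f) (y + t *: v) - Pop k (derivs (nseq m v) f) (y + t *: v).

Let nprod_nseq N m v : `|v| <= 1 -> nprod (nseq N e ++ nseq m v) <= E ^+ N.
Proof.
move=> v1; rewrite /nprod big_cat /= -[leRHS]mulr1; apply: ler_pM; rewrite ?prodr_ge0//.
  elim: N => [|N IH]; first by rewrite big_nil expr0.
  by rewrite big_cons exprS; apply: ler_pM => //; [exact: prodr_ge0|rewrite lerDl].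
by elim: m => [|m IH]; [rewrite big_nil|rewrite big_cons mulr_ile1// prodr_ge0].
Qed.

Let gj_le k y v m t z N : X z -> `|y + t *: v - z| <= 3 * dl k.+1 -> `|y + t *: v - x0| < rho ->
  `|v| <= 1 -> (N <= Ns k)%N -> (N <= Ns k.+1)%N ->
  `|gj k y v m t| <= 2 ^+ k.+2 * (Kb (N + m) * E ^+ N * r k ^+ N).
Proof.
move=> Xz yz yx v1 N1 N2; rewrite /gj /Pop; set Y := y + t *: v in yz yx *.
pose u i s := derivs (nseq i e ++ nseq m v) f (Y + s *: e).
have Hin s : eg k.+1 <= s <= c0 -> U (Y + s *: e) /\ `|Y + s *: e - x0| < eps / 2.
  exact: inU Xz yz yx.
have Ju : jet_on [set s | eg k.+1 <= s <= c0] u.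
  by move=> i s /Hin[Us _]; exact: (derivs_line (nseq i e ++ nseq m v) oU Hm Us).
pose K := Kb (N + m) * E ^+ N.
have K0 : 0 <= K by rewrite mulr_ge0// exprn_ge0// ltW.
have uK s : eg k.+1 <= s <= c0 -> `|u N s| <= K.
  move=> /Hin[Us sx]; apply: (le_trans (HKb _ Us sx)).
  by rewrite size_cat !size_nseq ler_wpM2l// nprod_nseq.
have cc : eg k.+1 <= c0 by have := @egc k.+1 1 isT; rewrite mulr1n.
have e1 := @extrap_err R N (Ns k.+1) (eg k.+1) u (eg k.+1) c0 K N2 _ (egc (leqW (Ns_le k.+1))) cc Ju uK.
have e2 := @extrap_err R N (Ns k) (eg k) u (eg k.+1) c0 K N1 _ (egc (leqW (Ns_le k))) cc Ju uK.
rewrite eg0 lexx in e1; rewrite eg0 egS in e2; have {}e1 := e1 isT; have {}e2 := e2 isT.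
set P1 := extrap _ _ _ in e1; set P2 := extrap _ _ _ in e2.
change (`|P1 - P2| <= 2 ^+ k.+2 * (K * r k ^+ N)).
have two n : (n <= k.+1)%N -> (2 : R) ^+ n <= 2 ^+ k.+1.
  by move=> nk; rewrite ler_eXn2l// ltr1n.
have small q : 0 <= q -> q <= c0 * r k ^+ 2 -> q ^+ N <= r k ^+ N.
  move=> q0 qc; rewrite lerXn2r ?nnegrE ?(ltW (r0 k))// (le_trans qc)//.
  rewrite expr2 mulrA ler_piMl ?(ltW (r0 k))// mulr_ile1 ?(ltW c00) ?(ltW (r0 k)) ?r1//.
  by move: c04; lra.
have -> : P1 - P2 = (P1 - taylor N u (eg k.+1) 0) - (P2 - taylor N u (eg k.+1) 0) by ring.
rewrite (le_trans (ler_normB _ _))//.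
have -> : 2 ^+ k.+2 * (K * r k ^+ N) = 2 ^+ k.+1 * (K * r k ^+ N) + 2 ^+ k.+1 * (K * r k ^+ N).
  by rewrite exprS; ring.
apply: lerD; [apply: (le_trans e1)|apply: (le_trans e2)]; apply: ler_pM;
  rewrite ?exprn_ge0// ?mulr_ge0// ?exprn_ge0 ?mulrn_wge0 ?(ltW (eg0 _)) ?(ltW E0)//.
- by apply: two.
- rewrite ler_wpM2l//; apply: small; first by rewrite mulrn_wge0 ?(ltW (eg0 _)).
  apply: (le_trans (egn (leqW (Ns_le k.+1)))); rewrite ler_pM2l// lerXn2r ?nnegrE ?(ltW (r0 _))//.
  by rewrite rS; have := r0 k; lra.
- by apply: two; exact: leqW.
- rewrite ler_wpM2l//; apply: small; first by rewrite mulrn_wge0 ?(ltW (eg0 _)).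
  exact: (egn (leqW (Ns_le k))).
Qed.

Variables (chi : nat -> 'rV[R]_d -> R) (J : nat -> 'rV[R]_d -> 'rV[R]_d -> nat -> R -> R).
Hypothesis HJ : forall k,
  [/\ forall y, X y -> `|y - x0| <= 1 -> chi k y = 1,
      forall y v, jet_on setT (J k y v),
      forall y v t, J k y v 0%N t = chi k (y + t *: v),
      forall y v m t, `|v| <= 1 -> `|J k y v m t| <= A m * (mu * (c0 * (2^-1 ^+ k.+1) ^+ 3) ^+ p)^-1 ^+ (m + d) &
      forall y v m t, (forall z, X z -> 2 * (mu * (c0 * (2^-1 ^+ k.+1) ^+ 3) ^+ p) < `|y + t *: v - z|) -> J k y v m t = 0].

Let Tj k y v m t := leib m (J k y v) (gj k y v) t.

Let gj_jet k y v t z : X z -> `|y + t *: v - z| <= 3 * dl k.+1 -> `|y + t *: v - x0| < rho ->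
  jet_on [set t] (gj k y v).
Proof.
move=> Xz yz yx m _ ->.
have one n' : (eg k.+1 <= eg n') -> (Ns n' <= n'.+1)%N ->
   is_derive t 1 (fun t => Pop n' (derivs (nseq m v) f) (y + t *: v)) (Pop n' (derivs (nseq m.+1 v) f) (y + t *: v)).
  move=> en nn; apply: isd_sum => j _; apply: isd_scale.
  have -> : (fun t => derivs (nseq m v) f (y + t *: v + (eg n' *+ j.+1) *: e)) =
            (fun t => derivs (nseq m v) f ((y + (eg n' *+ j.+1) *: e) + t *: v)).
    by apply/funext => s; rewrite addrAC.
  rewrite addrAC; apply: (derivs_line (nseq m v) oU Hm); rewrite addrAC.
  apply: (inU Xz yz yx _).1; apply/andP; split.
    by apply: (le_trans en); rewrite mulrS lerDl mulrn_wge0// ltW.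
  by apply: egc; exact: leq_trans nn.
exact: (isd_sub (one k.+1 (lexx _) (leqW (Ns_le _))) (one k (egS k) (leqW (Ns_le _)))).
Qed.

Let Tj_jet k y v : jet_on [set t | `|y + t *: v - x0| < rho] (Tj k y v).
Proof.
have [_ JJ _ _ J0] := HJ k.
move=> m t /= yx; have [[z Xz yz]|far] := pselect (exists2 z, X z & `|y + t *: v - z| <= 3 * dl k.+1).
  by apply: (@jet_leib R [set t]) => //; [exact: jet_on_sub (JJ y v)|exact: gj_jet yz yx].
have far' z : X z -> 3 * dl k.+1 < `|y + t *: v - z|.
  by move=> Xz; rewrite ltNge; apply/negP => hh; apply: far; exists z.
have dk := dl0 k.+1.
have J0' i s : `|s - t| * (`|v| + 1) < dl k.+1 -> J k y v i s = 0.
  move=> st; apply: J0 => z Xz; rewrite -/(dl k.+1).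
  have := far' z Xz.
  have -> : y + t *: v - z = (y + s *: v - z) - (s - t) *: v.
    rewrite scalerBl opprB -!addrA; congr (_ + _).
    by rewrite [in RHS]addrCA [s *: v + _]addrC subrK addrC.
  move=> hh; have := lt_le_trans hh (ler_normB _ _); rewrite normrZ.
  have : `|s - t| * `|v| <= `|s - t| * (`|v| + 1) by rewrite ler_wpM2l// lerDl.
  by move: st; lra.
rewrite [Tj k y v m.+1 t](_ : _ = 0); last first.
  by apply: leib_eq0 => i; apply: J0'; rewrite subrr normr0 mul0r.
apply: (@isd_near R (fun=> 0)).
have v0 : 0 < `|v| + 1 by rewrite ltr_wpDl.
apply/nbhs_ballP; exists (dl k.+1 / (`|v| + 1)); first by rewrite /= divr_gt0.
move=> s; rewrite -ball_normE /= distrC ltr_pdivlMr// => st.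
by apply/esym/leib_eq0 => i; exact: J0'.
Qed.

Let KS n := \sum_(j < n.+1) Kb j.
Let KS_ge j n : (j <= n)%N -> Kb j <= KS n.
Proof.
move=> jn; rewrite /KS (bigD1 (Ordinal (jn : (j < n.+1)%N)))//= lerDl.
by apply: sumr_ge0.
Qed.
Let KS0 n : 0 <= KS n. Proof. exact: sumr_ge0. Qed.
Let KS_mono i j : (i <= j)%N -> KS i <= KS j.
Proof.
move=> ij; have ij1 : (i.+1 <= j.+1)%N by [].
rewrite /KS -!(big_mkord xpredT Kb) (big_cat_nat (leq0n i.+1) ij1)/= lerDl.
by apply: sumr_ge0.
Qed.

Let Q : R := mu^-1 * (8 / c0) ^+ p.
Let Q0 : 0 <= Q.
Proof. by rewrite mulr_ge0// ?invr_ge0 ?exprn_ge0// ?divr_ge0// ltW. Qed.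

Let dlV k : (dl k.+1)^-1 = Q * (r k)^-1 ^+ (3 * p).
Proof.
rewrite /dl /eg rS /Q.
have h1 := lt0r_neq0 mu0; have h2 := lt0r_neq0 c00; have h3 := lt0r_neq0 (r0 k).
rewrite invfM -exprVn exprM -mulrA -exprMn; congr (_ * _ ^+ _).
by field; rewrite h2 h3.
Qed.

Let Tj_le0 k y v m t N : `|y + t *: v - x0| < rho -> `|v| <= 1 -> (N <= Ns k)%N -> (N <= Ns k.+1)%N ->
  `|Tj k y v m t| <= A m * (Q * (r k)^-1 ^+ (3 * p)) ^+ (m + d) *
     (2 ^+ k.+2 * (KS (N + m) * E ^+ N * r k ^+ N)) * 2 ^+ m.
Proof.
move=> yx v1 N1 N2; have [_ JJ _ JB J0] := HJ k.
have B1 : 0 <= A m * (Q * (r k)^-1 ^+ (3 * p)) ^+ (m + d).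
  by rewrite mulr_ge0// exprn_ge0// mulr_ge0// exprn_ge0// invr_ge0 ltW.
have B2 : 0 <= 2 ^+ k.+2 * (KS (N + m) * E ^+ N * r k ^+ N).
  apply: mulr_ge0; first exact: exprn_ge0.
  apply: mulr_ge0; last exact/exprn_ge0/ltW.
  by apply: mulr_ge0; [exact: KS0|exact/exprn_ge0/ltW].
have [[z Xz yz]|far] := pselect (exists2 z, X z & `|y + t *: v - z| <= 3 * dl k.+1); last first.
  rewrite /Tj leib_eq0 ?normr0; first by apply: mulr_ge0; [exact: mulr_ge0|exact: exprn_ge0].
  move=> i; apply: J0 => z Xz; rewrite -/(dl k.+1).
  have : 3 * dl k.+1 < `|y + t *: v - z|.
    by rewrite ltNge; apply/negP => hh; apply: far; exists z.
  by have := dl0 k.+1; lra.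
have := @leib_le R m (J k y v) (gj k y v) t _ _ 1 ler01; rewrite mulr1; apply => i im; rewrite expr1n mulr1.
  apply: (le_trans (JB y v i t v1)); rewrite -/(dl k.+1) -dlV; apply: ler_pM => //.
  - by rewrite exprn_ge0// invr_ge0 ltW.
  - exact: Amono.
  - by rewrite ler_weXn2l ?leq_add2r// invf_ge1.
apply: (le_trans (gj_le i Xz yz yx v1 N1 N2)); rewrite ler_wpM2l ?exprn_ge0//.
rewrite ler_wpM2r ?exprn_ge0 ?(ltW (r0 k))// ler_wpM2r ?exprn_ge0 ?(ltW E0)//.
by apply: KS_ge; rewrite leq_add2l.
Qed.

Let Tj_bound m : exists2 C, 0 <= C & forall k y v t, `|y + t *: v - x0| < rho -> `|v| <= 1 ->
  `|Tj k y v m t| <= C * r k.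
Proof.
pose c := (3 * p * (m + d))%N.
have [k0 Hk0] := Ns_inf (m + c + 3).
pose C1 := A m * Q ^+ (m + d) * 8 * 2 ^+ m.
have C10 : 0 <= C1 by rewrite !mulr_ge0// exprn_ge0.
pose B k := A m * (Q * (r k)^-1 ^+ (3 * p)) ^+ (m + d) *
     (2 ^+ k.+2 * (KS (0 + m) * E ^+ 0 * r k ^+ 0)) * 2 ^+ m.
have B0 k : 0 <= B k.
  apply: mulr_ge0; last exact: exprn_ge0.
  apply: mulr_ge0; last by apply: mulr_ge0; [exact: exprn_ge0|rewrite !expr0 !mulr1; exact: KS0].
  apply: mulr_ge0 => //; apply: exprn_ge0; apply: mulr_ge0 => //.
  by apply: exprn_ge0; rewrite invr_ge0; exact: ltW.
pose C2 := \sum_(k < k0) B k / r k.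
have C20 : 0 <= C2 by apply: sumr_ge0 => k _; rewrite divr_ge0// ltW.
exists (C1 + C2); first exact: addr_ge0.
move=> k y v t yx v1; have [kk|kk] := ltnP k k0.
  apply: (@le_trans _ _ (B k)); first exact: Tj_le0.
  rewrite -ler_pdivrMr// ler_wpDl// /C2 (bigD1 (Ordinal kk))//= lerDl.
  by apply: sumr_ge0 => i _; rewrite divr_ge0// ltW.
pose N := minn (Ns k) (Ns k.+1).
have NN : (m + c + 3 <= N)%N by rewrite leq_min !Hk0// leqW.
have N0 : (0 < N)%N by apply: leq_trans NN; rewrite addn3.
have KN : KS (N + m) * E ^+ N <= 2 ^+ k.+1.
  have mN : (m <= N)%N by apply: leq_trans NN; rewrite -addnA leq_addr.
  apply: (@le_trans _ _ (Kbar N)).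
    by rewrite ler_wpM2r ?exprn_ge0 ?(ltW E0)//; apply: KS_mono; rewrite leq_add2l.
  have [n1|n2] := leqP (Ns k) (Ns k.+1).
    have NE : N = Ns k by apply/minn_idPl.
    by rewrite NE; apply: (le_trans (Ns_K _)); [rewrite -NE|rewrite ler_eXn2l// ltr1n].
  have NE : N = Ns k.+1 by apply/minn_idPr; exact: ltnW.
  by rewrite NE; apply: Ns_K; rewrite -NE.
have := @Tj_le0 k y v m t N yx v1 (geq_minl _ _) (geq_minr _ _); move/le_trans; apply.
have rV : (2 : R) ^+ k = (r k)^-1 by rewrite /r exprVn invrK.
have ri : 1 <= (r k)^-1 by rewrite invf_ge1.
have rr : (r k)^-1 ^+ c * (r k)^-1 ^+ 2 * r k ^+ N <= r k.
  have rn := lt0r_neq0 (r0 k).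
  have -> : (r k)^-1 ^+ c * (r k)^-1 ^+ 2 * r k ^+ N = r k ^+ (N - (c + 2)).
    have E3 : N = ((N - (c + 2)) + (c + 2))%N.
      by rewrite subnK//; apply: leq_trans NN; rewrite -addnA (leq_trans _ (leq_addl m _))// leq_add2l.
    rewrite {1}E3 -exprD [r k ^+ (_ + _)]exprD mulrCA -exprMn mulVf// expr1n mulr1//.
  have : r k ^+ (N - (c + 2)) <= r k ^+ 1.
    rewrite ler_wiXn2l ?(ltW (r0 k)) ?r1// subn_gt0; apply: leq_trans NN.
    by rewrite -addnS -addnA leq_addl.
  by rewrite expr1.
apply: (@le_trans _ _ (A m * (Q * (r k)^-1 ^+ (3 * p)) ^+ (m + d) *
     (2 ^+ k.+2 * (2 ^+ k.+1 * r k ^+ N)) * 2 ^+ m)).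
  rewrite ler_wpM2r ?exprn_ge0// ler_wpM2l//.
    by rewrite mulr_ge0// exprn_ge0// mulr_ge0// exprn_ge0// invr_ge0 ltW.
  by rewrite ler_wpM2l ?exprn_ge0// ler_wpM2r// exprn_ge0// ltW.
rewrite exprMn -exprM -/c !exprS rV.
have -> : A m * (Q ^+ (m + d) * (r k)^-1 ^+ c) * (2 * (2 * (r k)^-1) * (2 * (r k)^-1 * r k ^+ N)) * 2 ^+ m =
   C1 * ((r k)^-1 ^+ c * (r k)^-1 ^+ 2 * r k ^+ N) by rewrite /C1; ring.
by apply: (le_trans (ler_wpM2l C10 rr)); rewrite ler_wpM2r ?(ltW (r0 k))// lerDl.
Qed.

(* On the k-th neighbourhood of [X] the increments are smaller than any power of
   its width, which absorbs the derivatives of the cut-off [chi k]. *)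
Definition extF y := limn (series (fun k => chi k y * (Pop k.+1 f y - Pop k f y))).

Let ext_pure m : exists2 C, 0 <= C & forall y v, `|y - x0| < rho -> `|v| <= 1 ->
  exists2 a, 0 < a & exists G, [/\ jet_on [set s : R | `|s| < a] G,
    (forall s, `|s| < a -> G 0%N s = extF (y + s *: v)) & `|G m 0| <= C].
Proof.
have /choice[C HC] m' : exists C, 0 <= C /\ forall k y v t, `|y + t *: v - x0| < rho -> `|v| <= 1 ->
  `|Tj k y v m' t| <= C * r k by have [C ? ?] := Tj_bound m'; exists C.
exists (C m * 2); first by rewrite mulr_ge0//; have [] := HC m.
move=> y v yx v1; have v0 : 0 < `|v| + 1 by rewrite ltr_wpDl.
exists ((rho - `|y - x0|) / (`|v| + 1)); first by rewrite divr_gt0// subr_gt0.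
set O := [set s : R | _].
have inO s : O s -> `|y + s *: v - x0| < rho.
  rewrite /O /= ltr_pdivlMr// => sr; rewrite addrAC (le_lt_trans (ler_normD _ _))//.
  rewrite [ltLHS]addrC -ltrBrDr normrZ; apply: le_lt_trans sr.
  by rewrite ler_wpM2l// lerDl.
have cv i : cvgn (series (fun n => C i * r n)).
  by apply/cvg_ex; eexists; exact: geometric_half_cvg.
exists (fun i s => limn (series (fun n => Tj n y v i s))); split.
- apply: (jet_series (a := fun i n => C i * r n)) => //; first exact: open_absball.
  + by move=> n; apply: jet_on_sub (@Tj_jet n y v) => s /inO.
  + by move=> n i s /inO ys; exact: (HC i).2.
- move=> s sO; rewrite /extF; congr (limn (series _)); apply/funext => n.
  by rewrite /Tj /=; have [_ _ -> _ _] := HJ n.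
- have O0 : O 0 by rewrite /O /= normr0 divr_gt0// subr_gt0.
  have [_] := cvg_series_bound (cv m) (fun n => (HC m).2 n y v 0 (inO 0 O0) v1).
  by rewrite (cvg_lim _ (@geometric_half_cvg _ _)).
Qed.

Lemma ext_smooth : smooth_on (ball x0 rho) extF.
Proof.
apply: mixed_loc_smooth; first exact: ball_open.
move=> x; rewrite -ball_normE /= distrC => xr m.
have [C C0 H] := ext_pure m.
exists (rho - `|x - x0|), (polcst m (C / 1 ^+ m)); split; first by rewrite subr_gt0.
apply: pure_mixed; first by rewrite expr1n divr1.
apply: pure_of_line => // y v yx v1; apply: H => //.
by rewrite -[y - x0](subrKA x) (le_lt_trans (ler_normD _ _))// -ltrBrDr.
Qed.

Let rad_lip y s : X y -> `|y - x0| < rho -> 0 < s <= c0 -> `|f (y + s *: e) - f y| <= Kb 1 * E * s.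
Proof.
move=> Xy yx /andP[s0 sc].
have yx8 : `|y - x0| < eps / 8 by apply: lt_le_trans yx _; rewrite ge_min lexx orbT.
have ye : `|y - x0| < eps by move: yx8 eps0; lra.
have Hin q : 0 < q <= c0 -> U (y + q *: e) /\ `|y + q *: e - x0| < eps / 2.
  move=> /andP[q0 qc]; split.
    rewrite -[y + _]addr0; apply: cuspI => //; first by rewrite q0 (le_trans qc).
    by rewrite normr0 mulr_ge0 ?exprn_ge0 ?(ltW kap0) ?(ltW q0).
  rewrite addrAC (le_lt_trans (ler_normD _ _))// normrZ gtr0_norm//.
  have : q * `|e| <= eps / 8.
    by apply: le_trans c0e; apply: ler_pM => //; [exact: ltW|rewrite lerDl].
  by move: yx8 eps0; lra.
apply/ler_addgt0Pl => eta eta0.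
have [s1 s10 Hs1] := rad Xy ye eta0.
pose q := Num.min (s1 / 2) s.
have q0 : 0 < q by rewrite lt_min s0 divr_gt0.
have qs : q <= s by rewrite ge_min lexx orbT.
have qs1 : 0 < q < s1 by rewrite q0/= gt_min; apply/orP; left; move: s10; lra.
have -> : f (y + s *: e) - f y = (f (y + q *: e) - f y) + (f (y + s *: e) - f (y + q *: e)) by ring.
rewrite (le_trans (ler_normD _ _))// lerD//; first exact: Hs1.
have sg t : Num.min q s <= t <= Num.max q s -> 0 < t <= c0.
  rewrite (min_idPl qs) (max_idPr qs) => /andP[t1 t2].
  by rewrite (lt_le_trans q0)// (le_trans t2).
have := @mean_value_le R (fun t => f (y + t *: e)) (fun t => derivs [:: e] f (y + t *: e)) q s (Kb 1 * E).
move=> /(_ _ _)/le_trans; apply.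
- by move=> t /sg /Hin[Ut _]; exact: (derivs_line [::] oU Hm Ut).
- move=> t /sg /Hin[Ut tx]; apply: (le_trans (HKb [:: e] Ut tx)).
  by rewrite /nprod big_cons big_nil mulr1 ler_wpM2l// lerDl.
- rewrite ler_wpM2l ?mulr_ge0 ?(ltW E0)// ger0_norm ?subr_ge0// gerBl; exact: ltW.
Qed.

Lemma ext_eq y : X y -> `|y - x0| < rho -> extF y = f y.
Proof.
move=> Xy yx.
have y1 : `|y - x0| <= 1 by apply: ltW; apply: lt_le_trans yx _; rewrite ge_min lexx.
have SE n : series (fun k => chi k y * (Pop k.+1 f y - Pop k f y)) n = Pop n f y.
  elim: n => [|n IH].
    rewrite /series/= big_geq// /Pop /extrap.
    have -> : Ns 0 = 0%N by apply/eqP; rewrite -leqn0 Ns_le.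
    by rewrite big_ord0.
  rewrite seriesSr IH; have [c1 _ _ _ _] := HJ n; rewrite c1// mul1r; ring.
apply: cvg_lim => //; apply/cvgrPdist_le => eta eta0.
have [k0 Hk0] := Ns_inf 1; have [k1 Hk1] := half_pow_lt (Kb 1 * E) eta0.
exists (maxn k0 k1) => // n /=; rewrite geq_max => /andP[n0 n1]; rewrite SE distrC.
have Nn : (0 < Ns n)%N by exact: Hk0.
rewrite /Pop -(extrap_cst (eg n) (f y) Nn) -extrap_sub.
apply: le_trans (ltW (Hk1 n n1)).
have B0 : 0 <= Kb 1 * E * (c0 * r n ^+ 2).
  by rewrite !mulr_ge0 ?exprn_ge0 ?(ltW c00) ?(ltW E0) ?(ltW (r0 n)).
have := @extrap_le R (Ns n) (eg n) (fun s => f (y + s *: e) - f y) _ B0.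
move=> /(_ _)/le_trans; apply.
  move=> j jN; have jn : (j.+1 <= n.+1)%N by rewrite (leq_trans jN)// (leq_trans (Ns_le n)).
  apply: (le_trans (rad_lip Xy yx _)).
    by rewrite egc// andbT pmulrn_lgt0.
  by rewrite ler_wpM2l ?mulr_ge0 ?(ltW E0)//; exact: egn.
apply: (@le_trans _ _ ((r n)^-1 * (Kb 1 * E * (c0 * r n ^+ 2)))).
  rewrite ler_wpM2r//; have -> : (r n)^-1 = 2 ^+ n by rewrite /r exprVn invrK.
  by rewrite ler_eXn2l// ltr1n.
have -> : (r n)^-1 * (Kb 1 * E * (c0 * r n ^+ 2)) = Kb 1 * E * (c0 * r n).
  by field; rewrite gt_eqF.
rewrite ler_wpM2l ?mulr_ge0 ?(ltW E0)// ler_piMl ?(ltW (r0 n))//.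
by move: c04; lra.
Qed.

End Extension.

(** * The chain rule, and the theorem *)

Section ChainRule.
Variable R : realType.
Implicit Types (u v : R -> R) (O : set R).

Fixpoint dern (k : nat) O u : Prop :=
  if k is k'.+1 then (forall t, O t -> derivable u t 1) /\ dern k' O u^`()%classic else True.

Lemma dernW k O u : dern k.+1 O u -> dern k O u.
Proof. by elim: k u => // k IH u [h1 h2]; split=> //; exact: IH. Qed.

Lemma dern_ext k O u v : open O -> (forall t, O t -> u t = v t) -> dern k O u -> dern k O v.
Proof.
move=> oO; elim: k u v => // k IH u v uv [h1 h2].
have nr t : O t -> \forall x \near t, u x = v x.
  by move=> Ot; near=> x; apply: uv; near: x; exact: open_nbhs_nbhs.
split=> [t Ot|]; first by apply: near_eq_derivable (h1 t Ot); exact: nr.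
apply: IH h2 => t Ot; rewrite !derive1E; apply: near_eq_derive; exact: nr.
Unshelve. all: by end_near. Qed.

Lemma dern_add k O u v : open O -> dern k O u -> dern k O v -> dern k O (fun t => u t + v t).
Proof.
move=> oO; elim: k u v => // k IH u v [u1 u2] [v1 v2]; split.
  by move=> t Ot; apply: derivableD; [exact: u1|exact: v1].
apply: dern_ext (IH _ _ u2 v2) => // t Ot; rewrite !derive1E.
by rewrite deriveD; [|exact: u1|exact: v1].
Qed.

Lemma dern_mul k O u v : open O -> dern k O u -> dern k O v -> dern k O (fun t => u t * v t).
Proof.
move=> oO; elim: k u v => // k IH u v Hu Hv.
have [u1 u2] := Hu; have [v1 v2] := Hv; split.
  by move=> t Ot; apply: derivableM; [exact: u1|exact: v1].
have := dern_add oO (IH _ _ (dernW Hu) v2) (IH _ _ (dernW Hv) u2).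
apply: dern_ext => // t Ot; rewrite !derive1E.
by rewrite deriveM; [|exact: u1|exact: v1].
Qed.

Lemma dern_cst k O (a : R) : dern k O (fun=> a).
Proof.
elim: k a => // k IH a; split; first by move=> t _; exact: derivable_cst.
have -> : (fun=> a)^`()%classic = (fun=> 0 : R); last exact: IH.
by apply/funext => t; rewrite derive1_cst.
Qed.

Lemma dern_sum k O (I : Type) (r : seq I) (F : I -> R -> R) : open O ->
  (forall i, dern k O (F i)) -> dern k O (fun t => \sum_(i <- r) F i t).
Proof.
move=> oO H; elim: r => [|i r IH].
  by under eq_fun do rewrite big_nil; exact: dern_cst.
by under eq_fun do rewrite big_cons; exact: dern_add.
Qed.

Lemma dern_smooth k O u : smooth_curve u -> dern k O u.
Proof.
elim: k u => // k IH u su; split; first by move=> t _; exact: (su 0%N).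
by apply: IH => j t; rewrite -derive1Sn; exact: su.
Qed.

Lemma dern_derivable k O u t : dern k.+1 O u -> O t -> derivable (derive1n k u) t 1.
Proof.
by elim: k u => [|k IH] u [h1 h2] Ot; [exact: h1|rewrite derive1Sn; exact: IH].
Qed.

Variable d : nat.

Lemma smooth_coord (c : R -> 'rV[R]_d) i : smooth_curve c ->
  smooth_curve (fun t => c t 0 i) /\ forall k t, derive1n k (fun t => c t 0 i) t = (derive1n k c t) 0 i.
Proof.
move=> sc; have E k : derive1n k (fun t => c t 0 i) = fun t => (derive1n k c t) 0 i.
  elim: k => // k IH; rewrite derive1nS IH; apply/funext => t.
  by rewrite derive1nS !derive1E derive_mx ?mxE//; exact: sc.
split; last by move=> k t; rewrite E.
move=> k t; rewrite E; exact: ((derivable_mxP _ _ _).1 (sc k t) 0 i).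
Qed.

Lemma derive1_chain (c : R -> 'rV[R]_d) (F : 'rV[R]_d -> R) t :
  derivable c t 1 -> differentiable F (c t) -> derivable (F \o c) t 1 /\
  (F \o c)^`()%classic t = \sum_(i < d) 'D_(delta_mx 0 i) F (c t) * (c^`()%classic t) 0 i.
Proof.
move=> /derivable1_diffP dc dF.
have dFc : differentiable (F \o c) t by exact: differentiable_comp.
split; first exact/derivable1_diffP.
rewrite derive1E' // diff_comp //= -(derive1E' dc) [c^`()%classic t in LHS]row_sum_delta.
rewrite linear_sum; apply: eq_bigr => i _.
by rewrite linearZ deriveE// mulrC.
Qed.

Lemma chain_dern k (U : set 'rV[R]_d) (c : R -> 'rV[R]_d) (F : 'rV[R]_d -> R) : open U ->
  smooth_curve c -> smooth_on U F -> dern k [set t | U (c t)] (F \o c).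
Proof.
move=> oU sc; have cc : continuous c.
  by move=> t; apply: differentiable_continuous; apply/derivable1_diffP; exact: (sc 0%N).
have oO : open [set t | U (c t)] by exact: open_comp.
elim: k F => // k IH F sF.
have dF x : U x -> differentiable F x by move=> Ux; have [h1 _] := sF 1%N; exact: h1.
split; first by move=> t /dF h; have [] := derive1_chain (sc 0%N t) h.
apply: (@dern_ext _ _ (fun t => \sum_(i < d) ('D_(delta_mx 0 i) F \o c) t * (c^`()%classic t) 0 i)) => //.
  by move=> t /dF h; have [_ ->] := derive1_chain (sc 0%N t) h.
apply: dern_sum => // i; apply: dern_mul => //.
  by apply: IH => j; have [_ h2] := sF j.+1; exact: h2.
apply: dern_smooth; apply: (smooth_coord i _).1 => j t; rewrite -derive1Sn; exact: sc.
Qed.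

Lemma Cinf_sub_Ainf (X : set 'rV[R]_d) : Cinf_on X `<=` Ainf X.
Proof.
move=> f Hf c [sc cX] k t.
have [U [oU Uc [F [sF FE]]]] := Hf (c t) (cX t).
have cc : continuous c.
  by move=> s; apply: differentiable_continuous; apply/derivable1_diffP; exact: (sc 0%N).
have oO : open [set t | U (c t)] by exact: open_comp.
apply: (@dern_derivable _ [set t | U (c t)]) => //.
apply: dern_ext (chain_dern k.+1 oU sc sF) => // s /= Us.
by rewrite FE.
Qed.

End ChainRule.

Section Assembly.
Variables (R : realType) (n : nat).
Implicit Types (x y v w z : 'rV[R]_n.+1) (t s : R).
Variables (M : nat -> R) (M0 : positive_seq M) (lc : log_convex M) (nq : non_quasianalytic M).
Variables (X : set 'rV[R]_n.+1) (f : 'rV[R]_n.+1 -> R) (fA : AinfM M X f).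

Lemma radial_continuity x0 e p (kap h eps : R) y : 0 < h -> 0 < kap ->
  cusp_cond X x0 e p kap h eps -> X y -> `|y - x0| < eps -> forall eta : R, 0 < eta ->
  exists2 s0, 0 < s0 & forall s, 0 < s < s0 -> `|f (y + s *: e) - f y| <= eta.
Proof.
move=> h0 k0 S Xy yx eta eta0.
have [a a0 HG] := gcurve_jet M0 lc nq fA h0 k0 S.
have z0 : `|0 : 'rV[R]_n.+1| <= kap by rewrite normr0 ltW.
have [G JG G0] := HG y 0 Xy yx z0.
have O0 : [set s : R | `|s| < a] 0 by rewrite /= normr0.
have /cvgrPdist_le/(_ eta eta0)/nbhs_ballP[r /= r0 Hr] := is_derive_cont (JG 0%N 0 O0).
pose m := Num.min a r; have m0 : 0 < m by rewrite lt_min a0.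
exists (m ^+ 2); first by rewrite exprn_gt0.
move=> s /andP[s0 sm].
have q0 : 0 <= Num.sqrt s by exact: sqrtr_ge0.
have qm : Num.sqrt s < m.
  by rewrite -(@ltr_pXn2r _ 2)// ?nnegrE ?(ltW m0)// sqr_sqrtr// ltW.
have [qa qr] : Num.sqrt s < a /\ Num.sqrt s < r by move: qm; rewrite lt_min => /andP.
have -> : f (y + s *: e) = G 0%N (Num.sqrt s).
  by rewrite G0 ?ger0_norm// /gcurve scaler0 addr0 sqr_sqrtr// ltW.
have -> : f y = G 0%N 0 by rewrite G0 ?normr0// /gcurve expr0n/= scale0r scaler0 !addr0.
by rewrite distrC; apply: Hr; rewrite -ball_normE /= sub0r normrN ger0_norm.
Qed.

Lemma boundary_extension (alpha : R) x0 : alpha_set alpha X -> X x0 -> ~ (interior X) x0 ->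
  exists U : set 'rV[R]_n.+1, [/\ open U, U x0 &
    exists F, smooth_on U F /\ forall y, U y -> X y -> F y = f y].
Proof.
move=> aX Xx0 nX; have [_ [_ [[cX _] _]]] := aX.
have [e [p [kap [h [eps [kap0 h0 eps0 p0 cuspI]]]]]] := uniform_cusp_cond aX Xx0 nX.
have S : cusp_cond X x0 e p kap h eps.
  move=> y w q Xy yx /andP[q0 qh] wq; have [q1|q1] := eqVneq q 0.
    move: wq; rewrite q1 expr0n (gtn_eqF p0) mulr0 normr_le0 => /eqP ->.
    by rewrite scale0r !addr0.
  by apply: interior_subset; apply: cuspI => //; rewrite lt_def q1 q0.
have oU : open (interior X) by exact: open_interior.
have Hm := interior_mixed M0 lc nq fA.
have /choice[Kb HK] m : exists K, 0 <= K /\ forall vs y, size vs = m -> interior X y ->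
    `|y - x0| < eps / 2 -> `|derivs vs f y| <= K * nprod vs.
  have [K ? ?] := boundary_derivs M0 lc nq fA m cX h0 kap0 eps0 p0 S.
  by exists K.
have Kb0 m : 0 <= Kb m by have [] := HK m.
have HKb vs y : interior X y -> `|y - x0| < eps / 2 -> `|derivs vs f y| <= Kb (size vs) * nprod vs.
  by move=> Uy yx; have [_ H] := HK (size vs); exact: H.
have [A [A0 Amono] Hcut] := cutoff X x0 M0 nq.
have [Ns [Ns_le Ns_K Ns_inf]] := slow_sequence (Kbar e Kb).
pose mu := Num.min (Num.min (kap / 3) 1) (eps / 8).
pose c0 := Num.min (Num.min 4^-1 h) (eps / (8 * (`|e| + 1))).
have mu0 : 0 < mu by rewrite !lt_min ltr01 !divr_gt0.
have c00 : 0 < c0 by rewrite !lt_min h0 invr_gt0 ltr0n divr_gt0// mulr_gt0// ltr_wpDl.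
have c01 : c0 <= 1 by rewrite !ge_min invf_le1// ler1n.
pose dl k := mu * (c0 * (2^-1 ^+ k.+1) ^+ 3) ^+ p.
have r0 k : (0 : R) < 2^-1 ^+ k by rewrite exprn_gt0// invr_gt0.
have r1 k : (2^-1 : R) ^+ k <= 1 by rewrite exprn_ile1// ?invr_ge0// invf_le1// ler1n.
have dlb k : 0 < dl k <= 1.
  rewrite /dl mulr_gt0 ?exprn_gt0 ?mulr_gt0 ?exprn_gt0//= mulr_ile1 ?(ltW mu0)//.
  - by rewrite exprn_ge0// mulr_ge0 ?exprn_ge0 ?(ltW c00) ?(ltW (r0 _)).
  - by rewrite !ge_min lexx !orbT.
  - apply: exprn_ile1; first by rewrite mulr_ge0 ?exprn_ge0 ?(ltW c00) ?(ltW (r0 _)).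
    apply: mulr_ile1; [exact: ltW| |exact: c01|].
      by apply: exprn_ge0; exact: ltW.
    by apply: exprn_ile1; [exact: ltW|exact: r1].
have /choice[chiJ HJ] k : exists cJ : ('rV[R]_n.+1 -> R) * ('rV[R]_n.+1 -> 'rV[R]_n.+1 -> nat -> R -> R),
  [/\ forall y, X y -> `|y - x0| <= 1 -> cJ.1 y = 1,
      forall y v, jet_on setT (cJ.2 y v),
      forall y v t, cJ.2 y v 0%N t = cJ.1 (y + t *: v),
      forall y v m t, `|v| <= 1 -> `|cJ.2 y v m t| <= A m * (dl k)^-1 ^+ (m + n.+1) &
      forall y v m t, (forall z, X z -> 2 * dl k < `|y + t *: v - z|) -> cJ.2 y v m t = 0].
  by have [chi [J HJ]] := Hcut (dl k) (dlb k); exists (chi, J).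
have rad y : X y -> `|y - x0| < eps -> forall eta : R, 0 < eta ->
    exists2 s0, 0 < s0 & forall s, 0 < s < s0 -> `|f (y + s *: e) - f y| <= eta.
  by move=> Xy yx; exact: radial_continuity h0 kap0 S Xy yx.
exists (ball x0 (Num.min 1 (eps / 8))); split.
- exact: ball_open.
- by apply: ballxx; rewrite lt_min ltr01 divr_gt0.
- exists (extF f e h eps Ns (fun k => (chiJ k).1)); split.
    exact: (ext_smooth kap0 h0 eps0 oU Hm cuspI Kb0 HKb A0 Amono Ns_le Ns_K Ns_inf
             (J := fun k => (chiJ k).2) HJ).
  move=> y; rewrite -ball_normE /= distrC => yx Xy.
  exact: (ext_eq kap0 h0 eps0 oU Hm cuspI Kb0 HKb rad Ns_le Ns_inf
             (J := fun k => (chiJ k).2) HJ).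
Qed.

Lemma AinfM_Cinf : holder_set X -> Cinf_on X f.
Proof.
move=> [alpha aX] x Xx; have [ix|nix] := pselect ((interior X) x); last first.
  exact: boundary_extension aX Xx nix.
exists (interior X); split=> //; first exact: open_interior.
exists f; split=> //; apply: mixed_loc_smooth; first exact: open_interior.
exact: interior_mixed fA.
Qed.

End Assembly.

Unset Implicit Arguments.

Theorem theorem1p13 (R : realType) (n : nat) (X : set 'rV[R]_n.+1)
  (M : nat -> R) :
  holder_set X -> positive_seq M -> log_convex M -> non_quasianalytic M ->
  AinfM M X = Ainf X /\ Ainf X = Cinf_on X.
Proof.
move=> hX M0 lc nq.
have h1 : AinfM M X `<=` Cinf_on X by move=> f fA; exact: AinfM_Cinf fA hX.
have h2 : Cinf_on X `<=` Ainf X by exact: Cinf_sub_Ainf.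
have h3 : Ainf X `<=` AinfM M X by move=> f fA c [[sc _] cX]; apply: fA.
by split; apply/seteqP; split=> // f; [move/h1/h2|move/h3/h1].
Qed.
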